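(* Let $J\subseteq E$ be a graded ideal. Then for all $1\le r\le n$, $i\ge1$ and $j\ge0$, $$h_{i,i+j}(r)(E/J)\leq\sum_{k=1}^r \binom{r+i-k-1}{i-1}\alpha_{k,j}(E/J),$$ and equality holds for all $i\geq 1$, $j\ge 0$ and $1\leq r\leq n$ if and only if $J$ is componentwise linear.
   Context: $K$ is an infinite field and $E=K\langle e_1,\ldots,e_n\rangle$ is the standard graded exterior algebra. Generic annihilator numbers: for a graded $E$-module $M$ and $v\in E_1$, $H^j(M,v)$ denotes the homology at $M_j$ of the complex $\cdots\to M_{j-1}\xrightarrow{\cdot v}M_j\xrightarrow{\cdot v}M_{j+1}\to\cdots$. For a basis $v_1,\dots,v_n$ of $E_1$ put $\alpha_{i,j}(v_1,\dots,v_n;M)=\dim_KH^j(M/(v_1,\dots,v_{i-1})M,v_i)$ for $1\le i\le n$, $j\in\mathbb{Z}$. For a graded ideal $J\subseteq E$, put $$\alpha_{i,j}(E/J)=\alpha_{i,j}(e_1,\dots,e_n;E/\operatorname{gin}_{<_{\mathrm{rlex}}}(J)),$$ where $<_{\mathrm{rlex}}$ is the reverse lexicographic order with respect to $e_1<\dots<e_n$ (among monomials $e_F=e_{i_1}\wedge\dots\wedge e_{i_r}$, $F=\{i_1<\dots<i_r\}$, of the same degree, $e_A<_{\mathrm{rlex}}e_B$ iff $\min((A\setminus B)\cup(B\setminus A))\in A$), and $\operatorname{gin}_{<_{\mathrm{rlex}}}(J)$ is the generic initial ideal, i.e. the common value of $\operatorname{in}_{<_{\mathrm{rlex}}}(\varphi(J))$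 for $\varphi$ in a suitable non-empty Zariski-open subset of $\mathrm{GL}_n(K)$. Cartan homology: for $v_1,\dots,v_m\in E_1$, the Cartan complex $C_\bullet(v_1,\dots,v_m;E)$ is the free divided power algebra $E\langle x_1,\dots,x_m\rangle$, generated by divided powers $x_i^{(j)}$ with $x_i^{(j)}x_i^{(k)}=\frac{(j+k)!}{j!k!}x_i^{(j+k)}$. Thus $C_i$ is the free $E$-module with basis $x^{(a)}=x_1^{(a_1)}\cdots x_m^{(a_m)}$, $a\in\mathbb{N}^m$, $a_1+\dots+a_m=i$, with $E$-linear differential $x^{(a)}\mapsto\sum_{a_j>0}v_j\,x_1^{(a_1)}\cdots x_j^{(a_j-1)}\cdots x_m^{(a_m)}$. Setting $\deg x_i=1$ makes it a complex of graded modules ($x^{(a)}$ has internal degree $a_1+\dots+a_m$). For a graded $E$-module $M$ put $C_\bullet(v_1,\dots,v_m;M)=C_\bullet(v_1,\dots,v_m;E)\otimes_EM$ and let $H_i(v_1,\dots,v_m;M)$ be its $i$-th homology, with graded pieces $H_i(v_1,\dots,v_m;M)_j$. Cartan–Betti numbers: for a basis $v_1,\dots,v_n$ of $E_1$ put $h_{i,j}(r)(v_1,\dots,v_n;E/J)=\dim_KH_i(v_1,\dots,v_r;E/J)_j$. There is a non-empty Zariski-open set $W$ of bases of $E_1$ (identified with elements of $\mathrm{GL}_n(K)$) on which all these numbers are constant; the Cartan–Betti number $h_{i,j}(r)(E/J)$ is the value of $h_{i,j}(r)(v_1,\dots,v_n;E/J)$ for $(v_1,\dots,v_n)\in W$.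 A graded ideal $J\subseteq E$ is componentwise linear if for every $d$ the ideal generated by $J_d$ has a $d$-linear resolution over $E$ (i.e. its graded Betti numbers $\beta^E_{i,j}$ vanish for $j\neq i+d$). *)

(* Defs.v *)
From HB Require Import structures.
From mathcomp Require Import boolp classical_sets cardinality.
From mathcomp Require Import all_boot all_order all_algebra all_field.
From mathcomp Require Import mpoly.
From mathcomp Require Import ring.

Set Implicit Arguments.
Unset Strict Implicit.
Unset Printing Implicit Defensive.

Import GRing.Theory.
Local Open Scope ring_scope.

(* The exterior algebra K<e_1, ..., e_n>, in coordinates with respect to the  *)
(* monomials e_F, F a set of indices; the index i : 'I_n stands for e_(i+1).  *)
Definition ext (K : fieldType) (n : nat) := {ffun {set 'I_n} -> K^o}.

HB.instance Definition _ (K : fieldType) (n : nat) :=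
  Vector.copy (ext K n) {ffun {set 'I_n} -> K^o}.

Section ExteriorAlgebra.
Variables (K : fieldType) (n : nat).
Implicit Types (A B C D F : {set 'I_n}) (x y z : ext K n).

Definition ext_mon F : ext K n := [ffun A => (A == F)%:R : K^o].

(* The number of inversions of the concatenation of A and B: for disjoint A   *)
(* and B one has e_A e_B = (-1)^(ext_inv A B) e_(A u B).                      *)
Definition ext_inv A B : nat :=
  (\sum_(p : 'I_n * 'I_n) [&& p.1 \in A, p.2 \in B & p.2 < p.1])%N.

Definition ext_one : ext K n := ext_mon set0.

Definition ext_mul x y : ext K n :=
  [ffun C : {set 'I_n} => \sum_(A : {set 'I_n} | A \subset C)
     (-1) ^+ ext_inv A (C :\: A) * (x A : K) * (y (C :\: A) : K) : K^o].

Lemma ext_invUl A B C : [disjoint A & B] ->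
  ext_inv (A :|: B) C = (ext_inv A C + ext_inv B C)%N.
Proof.
move=> dAB; rewrite /ext_inv -big_split; apply: eq_bigr => -[a c] _ /=.
rewrite inE; case aA: (a \in A) => /=; last by rewrite add0n.
by rewrite (disjointFr dAB aA) addn0.
Qed.

Lemma ext_invUr A B C : [disjoint B & C] ->
  ext_inv A (B :|: C) = (ext_inv A B + ext_inv A C)%N.
Proof.
move=> dBC; rewrite /ext_inv -big_split; apply: eq_bigr => -[a b] _ /=.
rewrite inE; case: (a \in A) => //=; case bB: (b \in B) => /=.
  by rewrite (disjointFr dBC bB) addn0.
by rewrite add0n.
Qed.

Lemma ext_inv0l A : ext_inv set0 A = 0%N.
Proof. by rewrite /ext_inv big1 // => p _; rewrite inE. Qed.

Lemma ext_inv0r A : ext_inv A set0 = 0%N.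
Proof. by rewrite /ext_inv big1 // => p _; rewrite inE andbF. Qed.

Lemma ext_mulA : associative ext_mul.
Proof.
move=> x y z; apply/ffunP=> D; rewrite !ffunE.
transitivity (\sum_(A : {set 'I_n} | A \subset D)
  \sum_(B : {set 'I_n} | B \subset D :\: A)
    ((-1) ^+ (ext_inv A (D :\: A) + ext_inv B (D :\: A :\: B)) : K)
      * (x A : K) * (y B : K) * (z (D :\: A :\: B) : K)).
  apply: eq_bigr => A _; rewrite ffunE mulr_sumr; apply: eq_bigr => B _.
  by rewrite exprD; ring.
transitivity (\sum_(C : {set 'I_n} | C \subset D)
  \sum_(A : {set 'I_n} | A \subset C)
    ((-1) ^+ (ext_inv C (D :\: C) + ext_inv A (C :\: A)) : K)
      * (x A : K) * (y (C :\: A) : K) * (z (D :\: C) : K)); last first.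
  apply: eq_bigr => C _; rewrite ffunE mulr_sumr mulr_suml.
  by apply: eq_bigr => A _; rewrite exprD; ring.
rewrite [RHS](exchange_big_dep (fun A => A \subset D)) /=; last first.
  by move=> C A CD AC; apply: subset_trans CD.
apply: eq_bigr => A AD.
rewrite [RHS](reindex_onto (fun B => A :|: B) (fun C => C :\: A)) /=; last first.
  by move=> C /andP[_ AC]; rewrite setDE setUIr setUCr setIT; apply/setUidPr.
apply: eq_big => [B|B].
  rewrite subUset AD subsetUl andbT /= subsetD; congr (_ && _).
  by rewrite setDUl setDv set0U; apply/idP/eqP => /setDidPl.
rewrite subsetD => /andP[BD dBA].
have dAB : [disjoint A & B] by rewrite disjoint_sym.
have -> : (A :|: B) :\: A = B.
  by rewrite setDUl setDv set0U; apply/setDidPl.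
rewrite setDDl; congr (_ ^+ _ * _ * _ * _).
have -> : D :\: A = B :|: (D :\: (A :|: B)).
  apply/setP=> a; rewrite !inE; case aB: (a \in B) => /=; last by rewrite orbF.
  by rewrite (subsetP BD _ aB) (disjointFr dBA aB).
rewrite ext_invUr; last first.
  by rewrite -setI_eq0; apply/eqP/setP=> a; rewrite !inE; case: (a \in B);
     rewrite ?orbT ?andbF.
by rewrite ext_invUl // -addnA addnC.
Qed.

Lemma ext_mul1l : left_id (ext_one) ext_mul.
Proof.
move=> x; apply/ffunP=> C; rewrite ffunE (bigD1 set0) ?sub0set //=.
rewrite ext_inv0l expr0 mul1r ffunE eqxx mul1r setD0 big1 ?addr0 // => A.
by rewrite ffunE => /andP[_ /negPf->]; rewrite mulr0 mul0r.
Qed.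

Lemma ext_mul1r : right_id (ext_one) ext_mul.
Proof.
move=> x; apply/ffunP=> C; rewrite ffunE (bigD1 C) //=.
rewrite setDv ext_inv0r expr0 mul1r ffunE eqxx mulr1 big1 ?addr0 // => A.
case/andP=> AC nAC; rewrite ffunE.
have -> : (C :\: A == set0) = false.
  apply/negbTE; rewrite setD_eq0; apply: contra nAC => CA.
  by rewrite eqEsubset AC.
by rewrite mulr0.
Qed.

Lemma ext_mulDl : left_distributive ext_mul +%R.
Proof.
move=> x y z; apply/ffunP=> C; rewrite !ffunE -big_split /=.
by apply: eq_bigr => A _; rewrite ffunE mulrDr mulrDl.
Qed.

Lemma ext_mulDr : right_distributive ext_mul +%R.
Proof.
move=> x y z; apply/ffunP=> C; rewrite !ffunE -big_split /=.
by apply: eq_bigr => A _; rewrite ffunE mulrDr.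
Qed.

Lemma ext_one_neq0 : ext_one != 0.
Proof.
apply/eqP=> /ffunP/(_ set0); rewrite !ffunE eqxx => /eqP.
by rewrite oner_eq0.
Qed.

Lemma ext_scaleAl (a : K) x y : a *: ext_mul x y = ext_mul (a *: x) y.
Proof.
apply/ffunP=> C; rewrite !ffunE scaler_sumr; apply: eq_bigr => A _.
by rewrite ffunE /GRing.scale /=; ring.
Qed.

Lemma ext_scaleAr (a : K) x y : a *: ext_mul x y = ext_mul x (a *: y).
Proof.
apply/ffunP=> C; rewrite !ffunE scaler_sumr; apply: eq_bigr => A _.
by rewrite ffunE /GRing.scale /=; ring.
Qed.

End ExteriorAlgebra.

HB.instance Definition _ (K : fieldType) (n : nat) :=
  GRing.Zmodule_isNzRing.Build (ext K n) (@ext_mulA K n) (@ext_mul1l K n)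
    (@ext_mul1r K n) (@ext_mulDl K n) (@ext_mulDr K n) (ext_one_neq0 K n).
HB.instance Definition _ (K : fieldType) (n : nat) :=
  GRing.Lmodule_isLalgebra.Build K (ext K n) (@ext_scaleAl K n).
HB.instance Definition _ (K : fieldType) (n : nat) :=
  GRing.Lalgebra_isAlgebra.Build K (ext K n) (@ext_scaleAr K n).
HB.instance Definition _ (K : fieldType) (n : nat) :=
  Algebra_isFalgebra.Build K (ext K n).

Section GradedIdeals.
Variables (K : fieldType) (n : nat).
Local Notation E := (ext K n).

Definition ext_gen (i : 'I_n) : E := ext_mon K [set i].

Lemma ext_mon_mul (A B : {set 'I_n}) :
  ext_mon K A * ext_mon K B =
    if [disjoint A & B] then (-1) ^+ ext_inv A B *: ext_mon K (A :|: B) else 0.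
Proof.
apply/ffunP=> C; rewrite ffunE.
transitivity (((A \subset C) && (C :\: A == B))%:R * (-1) ^+ ext_inv A B : K).
  case: (boolP (A \subset C)) => [AC|nAC] /=; last first.
    rewrite mul0r big1 // => D DC; rewrite !ffunE.
    case: eqP => [DA|]; last by rewrite mulr0 mul0r.
    by rewrite -DA DC in nAC.
  rewrite (bigD1 A) //= !ffunE eqxx mulr1 big1 ?addr0; last first.
    by move=> D /andP[_ /negPf DA]; rewrite !ffunE DA mulr0 mul0r.
  by case: eqP => [->|_]; rewrite ?mulr1 ?mul1r ?mulr0 ?mul0r.
case: (boolP [disjoint A & B]) => dAB; rewrite !ffunE.
  suff -> : (A \subset C) && (C :\: A == B) = (C == A :|: B).
    by rewrite /GRing.scale /= mulrC.
  apply/andP/eqP=> [[AC /eqP<-]|->].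
    by rewrite setDE setUIr setUCr setIT; apply/esym/setUidPr.
  rewrite subsetUl setDUl setDv set0U; split=> //.
  by apply/eqP/setDidPl; rewrite disjoint_sym.
case: eqP => [CB|]; last by rewrite andbF mul0r.
case/negP: dAB; rewrite -CB -setI_eq0; apply/eqP/setP=> a; rewrite !inE.
by case: (a \in A).
Qed.

Lemma ext_gen_sqr (i : 'I_n) : ext_gen i * ext_gen i = 0.
Proof. by rewrite ext_mon_mul disjoints1 inE eqxx. Qed.

Lemma ext_genC (i j : 'I_n) : ext_gen j * ext_gen i = - (ext_gen i * ext_gen j).
Proof.
wlog ij : i j / (i <= j)%N => [wl|].
  have [/wl //|/ltnW/wl ->] := leqP i j; by rewrite opprK.
have [->|nij] := eqVneq i j; first by rewrite ext_gen_sqr oppr0.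
have {}ij : (i < j)%N by rewrite ltn_neqAle ij andbT.
have inv1 (a b : 'I_n) : ext_inv [set a] [set b] = (b < a)%N.
  rewrite /ext_inv (bigD1 (a, b)) //= !inE !eqxx /= big1 ?addn0 // => -[c d].
  rewrite xpair_eqE !inE /= => /negPf; case: eqP => //= _ ->.
  by [].
rewrite !ext_mon_mul !disjoints1 !inE eq_sym nij /= !inv1 ij.
by rewrite ltnNge (ltnW ij) /= expr0 scale1r expr1 scaleN1r finset.setUC.
Qed.

Lemma ext_mon_prod (F : {set 'I_n}) : ext_mon K F = \prod_(i in F) ext_gen i.
Proof.
suff prodE (s : seq 'I_n) : sorted (fun i j : 'I_n => i < j)%N s ->
    \prod_(i <- s) ext_gen i = ext_mon K [set i in s].
  rewrite -big_filter prodE.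
    by congr ext_mon; apply/setP=> i; rewrite inE mem_filter mem_index_enum andbT.
  have -> : index_enum 'I_n = enum 'I_n by rewrite enumT.
  apply: sorted_filter; first by move=> b a c; apply: ltn_trans.
  have := iota_ltn_sorted 0 n; rewrite -val_enum_ord.
  by rewrite sorted_map.
elim: s => [_|i s IHs /= ps].
  have -> : [set i : 'I_n in [::]] = set0 by apply/setP=> i; rewrite !inE.
  by rewrite big_nil.
rewrite big_cons IHs ?(path_sorted ps) // ext_mon_mul.
have lt_i j : j \in s -> (i < j)%N.
  move=> js; have ltn_trO : transitive (fun i j : 'I_n => i < j)%N.
    by move=> b a c; apply: ltn_trans.
  by move: ps; rewrite (path_sortedE ltn_trO) => /andP[/allP/(_ _ js)].
rewrite disjoints1 inE; case: (boolP (i \in s)) => [/lt_i|_].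
  by rewrite ltnn.
have -> : [set x in i :: s] = i |: [set x in s] by apply/setP=> x; rewrite !inE.
rewrite /ext_inv big1 ?expr0 ?scale1r // => -[a b] _ /=; rewrite !inE.
by case: eqP => //= ->; case: (boolP (b \in s)) => // /lt_i ib;
   rewrite ltnNge (ltnW ib).
Qed.

(* The component of degree j; it is 0 for j < 0 and for j > n. *)
Definition ext_homog (j : int) : {vspace E} :=
  <<[seq ext_mon K F | F in [pred F : {set 'I_n} | #|F|%:Z == j]]>>%VS.

Definition ideal_gen (U : {vspace E}) : {vspace E} :=
  (fullv * U * fullv)%VS.

Definition is_ideal (J : {vspace E}) : bool :=
  (fullv * J <= J)%VS && (J * fullv <= J)%VS.

Definition graded_ideal (J : {vspace E}) : bool :=
  is_ideal J && (J <= \sum_(d < n.+1) (J :&: ext_homog d))%VS.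

(* A <_rlex B; used only for sets of the same cardinality. *)
Definition rlex_lt (A B : {set 'I_n}) : bool :=
  [exists i in A :\: B,
     [forall k in (A :\: B) :|: (B :\: A), (i <= k)%N]].

(* e_B is the initial monomial of the homogeneous element f. *)
Definition is_init_mon (f : E) (B : {set 'I_n}) : bool :=
  (f B != 0) && [forall A, (f A != 0) ==> ((A == B) || rlex_lt A B)].

(* in_<rlex(J) for a graded ideal J. *)
Definition initial_ideal (J : {vspace E}) : {vspace E} :=
  ideal_gen <<[seq ext_mon K B | B in [pred B : {set 'I_n} |
    `[< exists2 f, f \in (J :&: ext_homog #|B|)%VS & is_init_mon f B >]]]>>%VS.

Definition lin_form (g : 'M[K]_n) (i : 'I_n) : E :=
  \sum_l g l i *: ext_gen l.

(* The K-algebra endomorphism of E with e_i |-> lin_form g i; the product is  *)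
(* taken in increasing order of the index.                                    *)
Definition ext_map_fun (g : 'M[K]_n) (x : E) : E :=
  \sum_(F : {set 'I_n}) (x F : K) *: \prod_(i in F) lin_form g i.

Lemma ext_map_fun_linear (g : 'M[K]_n) : linear (ext_map_fun g).
Proof.
move=> a x y; rewrite /ext_map_fun scaler_sumr -big_split /=.
by apply: eq_bigr => F _; rewrite !ffunE scalerDl scalerA.
Qed.

HB.instance Definition _ (g : 'M[K]_n) :=
  GRing.isLinear.Build K E E _ (ext_map_fun g) (ext_map_fun_linear g).

Definition ext_map (g : 'M[K]_n) : 'End(E) := linfun (ext_map_fun g).

End GradedIdeals.

(* Zariski-open subsets of GL_n(K), regarded as a subset of the affine space  *)
(* of n x n matrices: unions of principal open sets. Every open subset of the *)
(* variety GL_n is of this form, since det is invertible on GL_n.             *)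
Definition zariski_open (K : fieldType) (n : nat) (U : set 'M[K]_n) : Prop :=
  exists S : set {mpoly K[n * n]},
    forall g : 'M[K]_n,
      U g <-> g \in unitmx /\
              exists2 f, S f & f.@[fun k => mxvec g 0 k] != 0.

(* The common value of f on some non-empty Zariski-open subset of GL_n(K);    *)
(* for K infinite, two such subsets meet, so there is at most one such value. *)
(* The default x0 is taken if f is not generically constant.                  *)
Definition generic_value (K : fieldType) (n : nat) (T : choiceType) (x0 : T)
    (f : 'M[K]_n -> T) : T :=
  xget x0 (fun t : T => exists U : set 'M[K]_n,
    [/\ zariski_open U, exists g, U g & forall g, U g -> f g = t]).

Definition gin (K : fieldType) (n : nat) (J : {vspace ext K n}) :
    {vspace ext K n} :=
  generic_value 0%VS (fun g => initial_ideal (ext_map g @: J)%VS).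

(* The dimension of the homology at the middle term of the complex            *)
(* A0 -> B0 / (B0 n NB) -> C / NC induced by f and g. It is computed on       *)
(* representatives: the cycles are the b in B0 with g b in NC, and the        *)
(* boundaries are f (A0) + (B0 n NB), which is contained in the cycles.       *)
Definition quot_homology_dim (K : fieldType) (A B C : vectType K)
    (f : 'Hom(A, B)) (g : 'Hom(B, C))
    (A0 : {vspace A}) (B0 NB : {vspace B}) (NC : {vspace C}) : nat :=
  (\dim (B0 :&: (g @^-1: NC)) - \dim ((f @: A0) + (B0 :&: NB)))%N.

Section Annihilator.
Variables (K : fieldType) (n : nat).
Local Notation E := (ext K n).

(* dim_K H^j(E/I, v). *)
Definition mult_homology_dim (I : {vspace E}) (v : E) (j : int) : nat :=
  quot_homology_dim (amull v) (amull v)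
    (ext_homog K n (j - 1)) (ext_homog K n j) I I.

(* alpha_{k,j}(v_1, ..., v_n; E/I), for 1 <= k <= n and vs = [:: v_1, ...,    *)
(* v_n].                                                                      *)
Definition annihilator_dim (vs : seq E) (I : {vspace E}) (k : nat) (j : int) :
    nat :=
  mult_homology_dim (I + ideal_gen <<take k.-1 vs>>)%VS vs`_k.-1 j.

Definition alpha (J : {vspace E}) (k : nat) (j : int) : nat :=
  annihilator_dim [seq ext_gen K i | i <- enum 'I_n] (gin J) k j.

End Annihilator.

Section Cartan.
Variables (K : fieldType) (n : nat) (vs : seq (ext K n)).
Local Notation E := (ext K n).
Local Notation m := (size vs).

(* The exponents a in N^m with a_1 + ... + a_m = i. *)
Definition cartan_index (i : nat) : Type :=
  {a : 'X_{1..m < i.+1} | mdeg a == i}.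
HB.instance Definition _ (i : nat) := Finite.on (cartan_index i).

(* The free E-module C_i; c corresponds to the sum of the (c a) x^(a). *)
Definition cartan_chain (i : nat) := {ffun cartan_index i -> E}.
HB.instance Definition _ (i : nat) := Vector.on (cartan_chain i).

Definition cartan_mnm (i : nat) (a : cartan_index i) : 'X_{1..m} :=
  bmnm (val a).

(* The map C_i -> C_i', which is the Cartan differential for i = i'.+1, and 0 *)
(* for i = i' = 0: the coefficient of x^(a) contributes, multiplied by v_k,   *)
(* to that of x^(b) where a = b + (unit vector k).                            *)
Definition cartan_diff_fun (i i' : nat) (c : cartan_chain i) :
    cartan_chain i' :=
  [ffun b => \sum_(a : cartan_index i)
     \sum_(k < m | cartan_mnm a == (cartan_mnm b + U_(k))%MM)
       c a * vs`_k].

Lemma cartan_diff_fun_linear (i i' : nat) : linear (@cartan_diff_fun i i').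
Proof.
move=> t x y; apply/ffunP=> b; rewrite !ffunE scaler_sumr -big_split /=.
apply: eq_bigr => a _; rewrite scaler_sumr -big_split /=.
by apply: eq_bigr => k _; rewrite !ffunE mulrDl scalerAl.
Qed.

HB.instance Definition _ (i i' : nat) :=
  GRing.isLinear.Build K (cartan_chain i) (cartan_chain i') _
    (@cartan_diff_fun i i') (@cartan_diff_fun_linear i i').

Definition cartan_diff (i i' : nat) : 'Hom(cartan_chain i, cartan_chain i') :=
  linfun (@cartan_diff_fun i i').

Definition cartan_coef (i : nat) (a : cartan_index i) (c : cartan_chain i) : E :=
  c a.

Lemma cartan_coef_linear (i : nat) (a : cartan_index i) :
  linear (cartan_coef a).
Proof. by move=> t x y; rewrite /cartan_coef !ffunE. Qed.

HB.instance Definition _ (i : nat) (a : cartan_index i) :=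
  GRing.isLinear.Build K (cartan_chain i) E _
    (cartan_coef a) (cartan_coef_linear a).

(* The chains all of whose coefficients lie in U. *)
Definition cartan_chains_in (i : nat) (U : {vspace E}) :
    {vspace cartan_chain i} :=
  (\bigcap_(a : cartan_index i) (linfun (cartan_coef a) @^-1: U))%VS.

(* dim_K H_i(v_1, ..., v_m; E/J)_j, where C_i (x)_E E/J is C_i / J C_i and    *)
(* x^(a), for |a| = i, has degree i.                                          *)
Definition cartan_homology_dim (J : {vspace E}) (i : nat) (j : int) : nat :=
  quot_homology_dim (cartan_diff i.+1 i) (cartan_diff i i.-1)
    (cartan_chains_in i.+1 (ext_homog K n (j - i.+1%:Z)))
    (cartan_chains_in i (ext_homog K n (j - i%:Z)))
    (cartan_chains_in i J) (cartan_chains_in i.-1 J).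

End Cartan.

(* h_{i,j}(r)(E/J), as the generic value for each (r, i, j). If one open set  *)
(* W serves for all (r, i, j), these are the values taken on W, because any   *)
(* two non-empty open subsets of GL_n(K) meet.                                *)
Definition cartan_betti (K : fieldType) (n : nat) (J : {vspace ext K n})
    (r i : nat) (j : int) : nat :=
  generic_value 0%N (fun g : 'M[K]_n =>
    cartan_homology_dim (take r [seq lin_form g l | l <- enum 'I_n]) J i j).

Section Resolutions.
Variables (K : fieldType) (n : nat).
Local Notation E := (ext K n).

(* A graded free resolution ... -> F_1 -> F_0 -> J -> 0 by finitely generated *)
(* free left E-modules. F_i is the module of row vectors of length res_rank i *)
(* whose k-th basis element has degree res_deg i k; matrices act on the right.*)
Record graded_free_resolution (J : {vspace E}) := GradedFreeResolution {
  res_rank : nat -> nat;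
  res_deg : forall i, 'I_(res_rank i) -> int;
  res_aug : 'cV[E]_(res_rank 0);
  res_diff : forall i, 'M[E]_(res_rank i.+1, res_rank i);
  res_aug_homog : forall k, res_aug k 0 \in ext_homog K n (res_deg k);
  res_diff_homog : forall i k l,
    res_diff i k l \in ext_homog K n (res_deg k - res_deg l);
  res_aug_im : forall x : E,
    x \in J <-> exists y : 'rV[E]_(res_rank 0), y *m res_aug = x%:M;
  res_exact0 : forall y : 'rV[E]_(res_rank 0),
    y *m res_aug = 0 <-> exists z, y = z *m res_diff 0;
  res_exactS : forall i (y : 'rV[E]_(res_rank i.+1)),
    y *m res_diff i = 0 <-> exists z, y = z *m res_diff i.+1
}.

(* The differentials have entries in the maximal ideal (e_1, ..., e_n). *)
Definition res_minimal (J : {vspace E}) (R : graded_free_resolution J) : Prop :=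
  forall i k l, (res_diff R i k l) finset.set0 = 0.

(* The graded Betti numbers of J, read off from a minimal resolution. *)
Definition res_betti (J : {vspace E}) (R : graded_free_resolution J)
    (i : nat) (j : int) : nat :=
  #|[set k : 'I_(res_rank R i) | res_deg k == j]|.

Definition has_linear_resolution (J : {vspace E}) (d : nat) : Prop :=
  exists2 R : graded_free_resolution J, res_minimal R &
    forall (i : nat) (j : int), j != (i + d)%:Z -> res_betti R i j = 0%N.

Definition componentwise_linear (J : {vspace E}) : Prop :=
  forall d : nat,
    has_linear_resolution (ideal_gen (J :&: ext_homog K n d)) d.

End Resolutions.

(* Main.v *)
(* For a generic basis v of E_1, restricting a Cartan chain in x_1, ..., x_r   *)
(* to the exponents divisible by x_r gives a short exact sequence of complexes *)
(* and hence a long exact sequence whose connecting map is multiplication by   *)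
(* v_r, from H_i(r)_j to H_i(r-1)_(j+1).  Counting dimensions bounds h_i(r) by *)
(* h_i(r-1) + h_(i-1)(r), with the annihilator number in place of the last     *)
(* term for i = 1, and Pascal's rule sums this up; equality holds if all       *)
(* connecting maps vanish.  The numbers alpha of the reverse lexicographic gin *)
(* are those of E/J for generic v, because both are determined by the Hilbert  *)
(* functions of the quotients by (v_1, ..., v_k), which the initial ideal      *)
(* preserves.                                                                  *)
(* Equality for i = 1 makes H_1(k) -> H_1(n) injective; as v_1, ..., v_n is    *)
(* exact on E, this kills the generic annihilators of the quotient by J_<d> in *)
(* degree d, then in all higher degrees, whence the Cartan homology, and the   *)
(* resolution built from generators in the lowest degree is linear.            *)
(* Conversely a linear resolution kills the Cartan homology of that quotient   *)
(* in degrees >= d.  If x in degree j >= d is annihilated by v_k modulo        *)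
(* (v_1, ..., v_(k-1)), then, by descending induction on j, each x_k^(p) with  *)
(* coefficient x is the leading term of a cycle, hence of a boundary.  A       *)
(* functional detecting x extends, v being generic, to a polynomial family of  *)
(* functionals along the pencil spanned by v_k, ..., v_n; the coefficients of  *)
(* the family pair to zero with boundaries, so those at the powers of v_k      *)
(* vanish at x, a contradiction.                                               *)

From HB Require Import structures.
Require Import Defs.
From mathcomp Require Import boolp classical_sets cardinality.
From mathcomp Require Import all_boot all_order all_algebra all_field.
From mathcomp Require Import mpoly.
From mathcomp Require finmap.
From mathcomp Require Import zify ring.

Set Implicit Arguments.
Unset Strict Implicit.
Unset Printing Implicit Defensive.

Import GRing.Theory.
Local Open Scope ring_scope.

(** Everything is compared at one generic matrix [g], whose columns give linear forms [v]. Cartan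
    chains in [r + 1] variables that avoid the last variable form a subcomplex, and the quotient is
    a shifted copy of the whole complex. The long exact sequence H_i(r) -> H_i(r+1) -> H_(i-1)(r+1)
    -> H_(i-1)(r), with last map multiplication by [v r], is used through [les_exact], [les_inj] and
    [les_surj]. Dimension counts ([cartan_dim_le], [cartan_dim1_le]) and Pascal's rule bound Cartan
    homology by a binomial sum of annihilator numbers of E/J along [v] ([cartan_dim_le_binsum]),
    with equality when the connecting maps vanish ([cartan_dim_eq_binsum]). These annihilator
    numbers are those of the gin: by [annih_dimE] they depend only on the Hilbert functions of J +
    (v_0, ..., v_(r-1)), which the reverse lexicographic initial ideal preserves
    ([dim_initial_meets], [alpha_generic]).

    Linearity of a resolution is translated by dimension shifting: an ideal generated in degree d
    has a d-linear resolution exactly when the Cartan homology of its quotient vanishes in positive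
    homological degree and coefficient degrees at least d ([linear_resolution_exact],
    [cartan_exact_linear_resolution]).

    If equality holds, the case i = 1 makes H_1(r) -> H_1(r+1) injective. Since [v] is exact on E,
    the quotient by the ideal of J_d then has no generic annihilators in degree d
    ([inj_annih_exact]), and this propagates upwards ([annih_exact_linear_resolution]). Conversely,
    [regularity] derives from a linear resolution that generic annihilators vanish in all degrees at
    least d. Its core, [annih_exact_descent], pairs cycles led by powers of one variable with the
    coefficients of a polynomial family of functionals. The connecting maps for J then vanish by
    [mul_trivial_of_components]. *)

Section SpanInduction.
Variables (K : fieldType) (V : vectType K).

Lemma span_ind (X : seq V) (P : V -> Prop) :
    P 0 -> (forall a x y, P x -> P y -> P (a *: x + y)) ->
    (forall x, x \in X -> P x) ->
  forall x, x \in <<X>>%VS -> P x.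
Proof.
move=> P0 PD PX x; rewrite -[X]/(val (in_tuple X)) => /coord_span ->.
apply: big_ind => //.
  by move=> y z Py Pz; rewrite -[y]scale1r; apply: PD.
move=> i _; rewrite -[_ *: _]addr0; apply: PD => //.
by apply: PX; rewrite mem_nth // -?(size_tuple (in_tuple X)).
Qed.

End SpanInduction.

(** * Grading and sign rules of the exterior algebra *)

Section Homogeneous.
Variables (K : fieldType) (n : nat).
Local Notation E := (ext K n).
Implicit Types (x y z : E) (F A B C : {set 'I_n}) (i j : int).

Lemma ext_mulE x y C : (x * y) C =
  \sum_(A : {set 'I_n} | A \subset C)
     (-1) ^+ ext_inv A (C :\: A) * (x A : K) * (y (C :\: A) : K).
Proof. by rewrite ffunE. Qed.

Lemma ext_sumE x : x = \sum_F (x F : K) *: ext_mon K F.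
Proof.
apply/ffunP=> A; rewrite sum_ffunE (bigD1 A) //= big1 ?addr0 => [|F /negPf nF].
  by rewrite !ffunE eqxx /GRing.scale /= mulr1.
by rewrite !ffunE eq_sym nF /GRing.scale /= mulr0.
Qed.

Lemma mem_homogP j x :
  reflect (forall F, x F != 0 -> #|F|%:Z = j) (x \in ext_homog K n j).
Proof.
apply: (iffP idP) => [|hx].
  apply: (@span_ind K E _ (fun x => forall F, x F != 0 -> #|F|%:Z = j)).
  - by move=> F; rewrite ffunE eqxx.
  - move=> a y z hy hz F; rewrite !ffunE.
    have [yF|/hy //] := eqVneq (y F) 0.
    have [zF|/hz //] := eqVneq (z F) 0.
    by rewrite yF zF scaler0 addr0 eqxx.
  - move=> _ /imageP[A hA ->] F; rewrite ffunE.
    by have [->|] := eqVneq F A; rewrite ?eqxx // => _; apply/eqP.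
rewrite (ext_sumE x); apply: memv_suml => F _.
have [->|/hx hF] := eqVneq (x F) 0; first by rewrite scale0r mem0v.
apply/memvZ/memv_span; apply: image_f; by rewrite inE hF.
Qed.

Definition hcomp j x : E :=
  [ffun F : {set 'I_n} => (if #|F|%:Z == j then x F else 0) : K^o].

Lemma hcomp_is_linear j : linear (hcomp j).
Proof.
move=> a x y; apply/ffunP=> F; rewrite !ffunE; case: ifP => // _.
by rewrite scaler0 addr0.
Qed.
HB.instance Definition _ j := GRing.isLinear.Build K E E _ (hcomp j) (hcomp_is_linear j).

Lemma hcomp_homog j x : hcomp j x \in ext_homog K n j.
Proof. by apply/mem_homogP=> F; rewrite ffunE; case: ifP => [/eqP|_] //; rewrite eqxx. Qed.

Lemma hcomp_id j x : x \in ext_homog K n j -> hcomp j x = x.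
Proof.
move/mem_homogP=> hx; apply/ffunP=> F; rewrite ffunE.
by case: eqP => // nF; have [->//|/hx] := eqVneq (x F) 0.
Qed.

Lemma hcomp_neq i j x : x \in ext_homog K n i -> i != j -> hcomp j x = 0.
Proof.
move/mem_homogP=> hx nij; apply/ffunP=> F; rewrite !ffunE.
case: eqP => // hF; have [//|/hx] := eqVneq (x F) 0.
by rewrite hF => ji; rewrite ji eqxx in nij.
Qed.

Lemma hcomp_sum x : x = \sum_(d < n.+1) hcomp d%:Z x.
Proof.
apply/ffunP=> F; rewrite sum_ffunE.
have hF : (#|F| < n.+1)%N by rewrite ltnS -[leqRHS]card_ord max_card.
rewrite (bigD1 (Ordinal hF)) //= big1 ?addr0 => [|i ni].
  by rewrite !ffunE eqxx.
rewrite ffunE; case: eqP => // -[hi]; case/eqP: ni; exact: val_inj.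
Qed.

Lemma homog_mul i j x y : x \in ext_homog K n i -> y \in ext_homog K n j ->
  x * y \in ext_homog K n (i + j).
Proof.
move=> /mem_homogP hx /mem_homogP hy; apply/mem_homogP=> C.
have [/existsP[A /and3P[AC xA yA]] _|] :=
  boolP [exists A : {set 'I_n}, [&& A \subset C, x A != 0 & y (C :\: A) != 0]].
  rewrite -(hx _ xA) -(hy _ yA) cardsD (setIidPr AC).
  by rewrite -PoszD subnKC // subset_leq_card.
move/existsPn=> h; rewrite ext_mulE big1 ?eqxx // => A AC.
have := h A; rewrite AC /= negb_and !negbK => /orP[/eqP->|/eqP->].
  by rewrite mulr0 mul0r.
by rewrite mulr0.
Qed.

Lemma hcomp_mulr i j x y : y \in ext_homog K n j ->
  hcomp (i + j) (x * y) = hcomp i x * y.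
Proof.
move=> hy; rewrite {1}(hcomp_sum x) mulr_suml linear_sum /=.
have [/existsP[d /eqP hd]|/existsPn hn] := boolP [exists d : 'I_n.+1, d%:Z == i].
  rewrite (bigD1 d) //= big1 ?addr0 => [|e ne].
    by rewrite -hd hcomp_id //; apply: homog_mul => //; apply: hcomp_homog.
  apply: (@hcomp_neq (e%:Z + j)); first by apply: homog_mul (hcomp_homog _ _) hy.
  by rewrite (inj_eq (addIr j)) -hd eqz_nat; apply: contraNneq ne => /val_inj ->.
rewrite big1 => [|e _].
  suff -> : hcomp i x = 0 by rewrite mul0r.
  apply/ffunP=> F; rewrite !ffunE; case: eqP => // hF.
  have hF' : (#|F| < n.+1)%N by rewrite ltnS -[leqRHS]card_ord max_card.
  by have := hn (Ordinal hF'); rewrite hF eqxx.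
apply: (@hcomp_neq (e%:Z + j)); first by apply: homog_mul (hcomp_homog _ _) hy.
by rewrite (inj_eq (addIr j)) hn.
Qed.

Lemma homog_gt j x : (n%:Z < j)%R -> x \in ext_homog K n j -> x = 0.
Proof.
move=> nj /mem_homogP hx; apply/ffunP=> F; rewrite ffunE.
have [//|/hx hF] := eqVneq (x F) 0; move: nj; rewrite -hF => nj.
have : (#|F| <= n)%N by rewrite -[leqRHS]card_ord max_card.
by lia.
Qed.

Lemma homog_lt0 j x : (j < 0)%R -> x \in ext_homog K n j -> x = 0.
Proof.
move=> nj /mem_homogP hx; apply/ffunP=> F; rewrite ffunE.
by have [//|/hx hF] := eqVneq (x F) 0; lia.
Qed.

Lemma gen_homog (l : 'I_n) : ext_gen K l \in ext_homog K n 1.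
Proof.
apply/mem_homogP=> F; rewrite ffunE; have [->|] := eqVneq F [set l]; rewrite ?eqxx //.
by rewrite cards1.
Qed.

Lemma homog1E x : x \in ext_homog K n 1 ->
  x = \sum_l (x [set l] : K) *: ext_gen K l.
Proof.
move/mem_homogP=> hx; apply/ffunP=> F; rewrite sum_ffunE.
have [/cards1P[l ->]|nF] := boolP (#|F| == 1%N).
  rewrite (bigD1 l) //= big1 ?addr0 => [|k nk].
    by rewrite !ffunE eqxx /GRing.scale /= mulr1.
  rewrite !ffunE (inj_eq (@set1_inj _)) eq_sym (negPf nk).
  by rewrite /GRing.scale /= mulr0.
rewrite big1 => [|l _]; first by have [//|/hx [hF]] := eqVneq (x F) 0; rewrite hF in nF.
rewrite !ffunE; case: eqP => [hF|]; last by rewrite /GRing.scale /= mulr0.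
by rewrite hF cards1 in nF.
Qed.

Lemma homog1_anti x y : x \in ext_homog K n 1 -> y \in ext_homog K n 1 ->
  x * y = - (y * x).
Proof.
move=> /homog1E -> /homog1E ->; rewrite !mulr_suml -sumrN.
under eq_bigr do rewrite mulr_sumr; rewrite exchange_big /=.
under [RHS]eq_bigr do rewrite mulr_sumr -sumrN.
rewrite exchange_big [RHS]exchange_big /=; apply: eq_bigr => i _; apply: eq_bigr => k _.
rewrite -!scalerAl -!scalerAr ext_genC scalerN scalerN !scalerA mulrC.
by rewrite ext_genC !scalerN opprK.
Qed.

(** In characteristic 2 antisymmetry does not kill the diagonal, hence the two conditions. This
    yields both that linear forms square to zero and that the Cartan differential does. *)
Lemma alt_sum_eq0 (V : zmodType) (r : nat) (f : nat -> nat -> V) :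
    (forall k, f k k = 0) -> (forall k l, f k l = - f l k) ->
  \sum_(k < r) \sum_(l < r) f k l = 0.
Proof.
move=> f0 fN; elim: r => [|r IH]; first by rewrite big_ord0.
rewrite big_ord_recr /= big_ord_recr /= f0 addr0.
rewrite (eq_bigr (fun k : 'I_r => \sum_(l < r) f k l + f k r)) => [|k _]; last first.
  by rewrite big_ord_recr.
rewrite big_split /= IH add0r -big_split /= big1 // => k _.
by rewrite fN addrC addrN.
Qed.

Lemma homog1_sqr x : x \in ext_homog K n 1 -> x * x = 0.
Proof.
move=> /homog1E ->; rewrite mulr_suml.
(* The summand is extended by 0 to all pairs of naturals, the shape that [alt_sum_eq0] expects. *)
pose f k l : E := match insub k, insub l with Some i, Some j =>
   ((x [set i] : K) * (x [set j] : K)) *: (ext_gen K i * ext_gen K j) | _, _ => 0 end.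
transitivity (\sum_(k < n) \sum_(l < n) f k l).
  apply: eq_bigr => k _; rewrite mulr_sumr; apply: eq_bigr => l _.
  by rewrite /f !valK -scalerAl -scalerAr scalerA.
apply: alt_sum_eq0 => [k|k l].
  by rewrite /f; case: insub => // i; rewrite ext_gen_sqr scaler0.
rewrite /f; case: insub => [i|]; case: insub => [j|]; rewrite ?oppr0 //.
by rewrite ext_genC scalerN mulrC.
Qed.

Lemma homog_comm1 (j : nat) x y : x \in ext_homog K n 1 -> y \in ext_homog K n j ->
  x * y = (-1) ^+ j *: (y * x).
Proof.
move=> hx /mem_homogP hy; rewrite [y in LHS]ext_sumE [y in RHS]ext_sumE.
rewrite mulr_sumr mulr_suml scaler_sumr; apply: eq_bigr => F _.
rewrite -scalerAr -scalerAl scalerA mulrC -scalerA.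
have [->|/hy [<-]] := eqVneq (y F) 0; first by rewrite !scale0r.
congr (_ *: _); rewrite ext_mon_prod -big_filter cardE.
have -> : [seq i <- index_enum 'I_n | i \in F] = enum F.
  by rewrite [index_enum _]unlock; apply: eq_filter.
elim: (enum F) => [|k s IH]; first by rewrite big_nil mulr1 mul1r expr0 scale1r.
rewrite big_cons mulrA (homog1_anti hx (gen_homog k)) mulNr -mulrA IH -scalerAr mulrA.
by rewrite /= exprS -scalerA scaleN1r.
Qed.

End Homogeneous.

(** * Exponents of divided power monomials *)

Definition up (a : nat -> nat) (k : nat) : nat -> nat := fun l => (a l + (l == k))%N.
(** The subtraction is truncated, so this is division by [x_k] only when [0 < a k]. *)
Definition down (a : nat -> nat) (k : nat) : nat -> nat := fun l => (a l - (l == k))%N.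

Lemma upC a k l : up (up a k) l = up (up a l) k.
Proof. by apply: funext => m; rewrite /up addnAC. Qed.

Lemma upK a k : down (up a k) k = a.
Proof. by apply: funext => m; rewrite /up /down addnK. Qed.

Lemma downK a k : (0 < a k)%N -> up (down a k) k = a.
Proof. by move=> ak; apply: funext => m; rewrite /up /down; case: eqP => [->|] /=; lia. Qed.

(* Chains are functions on all exponents (nat -> nat); only the values on the *)
(* exponents of degree i in the first r variables matter.                     *)
Definition expo (r i : nat) (a : nat -> nat) : Prop :=
  (forall l, (r <= l)%N -> a l = 0%N) /\ (\sum_(l < r) a l)%N = i.

Lemma sum_up r a k : (k < r)%N -> (\sum_(l < r) up a k l = (\sum_(l < r) a l).+1)%N.
Proof.
move=> kr; rewrite big_split /= -addn1; congr addn.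
rewrite (bigD1 (Ordinal kr)) //= eqxx big1 // => l nl.
by case: eqP => // lk; case/eqP: nl; apply: val_inj.
Qed.

Lemma expo_up r i a k : (k < r)%N -> expo r i a -> expo r i.+1 (up a k).
Proof.
move=> kr [a0 sa]; split=> [l rl|]; last by rewrite sum_up // sa.
by rewrite /up a0 // gtn_eqF // (leq_trans kr).
Qed.

Lemma expo_down r i a k : (k < r)%N -> (0 < a k)%N -> expo r i.+1 a -> expo r i (down a k).
Proof.
move=> kr ak [a0 sa]; split=> [l rl|]; first by rewrite /down a0.
by apply: succn_inj; rewrite -sa -(sum_up _ kr) downK.
Qed.

Lemma expo_down0 r a k : (k < r)%N -> expo r 0 a -> a k = 0%N.
Proof. by move=> kr [_ /eqP]; rewrite sum_nat_eq0 => /forallP/(_ (Ordinal kr))/eqP. Qed.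

Lemma expo_widen r i a : expo r i a -> expo r.+1 i a.
Proof.
case=> a0 sa; split=> [l rl|]; first by apply: a0; apply: ltnW.
by rewrite big_ord_recr /= sa a0 // addn0.
Qed.

Lemma expo_at r i a : expo r i a -> a r = 0%N.
Proof. by case=> a0 _; apply: a0. Qed.

Lemma expo_narrow r i a : a r = 0%N -> expo r.+1 i a -> expo r i a.
Proof.
move=> ar [a0]; rewrite big_ord_recr /= ar addn0 => sa; split=> // l.
by rewrite leq_eqVlt => /orP[/eqP<-|/a0].
Qed.

Lemma expo0 r : expo r 0 (fun=> 0%N).
Proof. by split=> //; rewrite big1. Qed.

Lemma expo0E r a : expo r 0 a -> a = fun=> 0%N.
Proof.
move=> Xa; apply: funext => l; have [lr|rl] := ltnP l r; first exact: expo_down0 Xa.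
by case: Xa => -> .
Qed.

Lemma expo0r i a : ~ expo 0 i.+1 a.
Proof. by case=> _; rewrite big_ord0. Qed.

(** * Exactness for Cartan complexes *)

Section Cartan.
Variables (K : fieldType) (n : nat).
Local Notation E := (ext K n).
Local Notation H := (ext_homog K n).
Variables (v : nat -> E).
Hypothesis v1 : forall l, v l \in H 1.
Local Notation chain := ((nat -> nat) -> E).
Implicit Types (c d w z : chain) (a b : nat -> nat).

(** The Cartan differential read on coefficients. With divided powers no integer factors occur, and
    [x^(b)] receives one contribution from each exponent [up b l]. *)
Definition bd (r : nat) c : chain := fun b => \sum_(l < r) c (up b l) * v l.

Lemma bdS r c b : bd r.+1 c b = bd r c b + c (up b r) * v r.
Proof. by rewrite /bd big_ord_recr. Qed.

Lemma bdB r c d b : bd r (fun a => c a - d a) b = bd r c b - bd r d b.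
Proof. by rewrite /bd -sumrB; apply: eq_bigr => l _; rewrite mulrBl. Qed.

Lemma bdD r c d b : bd r (fun a => c a + d a) b = bd r c b + bd r d b.
Proof. by rewrite /bd -big_split; apply: eq_bigr => l _; rewrite mulrDl. Qed.

Lemma bdN r c b : bd r (fun a => - c a) b = - bd r c b.
Proof. by rewrite /bd -sumrN; apply: eq_bigr => l _; rewrite mulNr. Qed.

Lemma bdZ r t c b : bd r (fun a => t *: c a) b = t *: bd r c b.
Proof. by rewrite /bd scaler_sumr; apply: eq_bigr => l _; rewrite scalerAl. Qed.

Lemma bd_mulr r c x b : x \in H 1 -> bd r (fun a => c a * x) b = - (bd r c b * x).
Proof.
move=> hx; rewrite /bd mulr_suml -sumrN; apply: eq_bigr => l _.
by rewrite -!mulrA (homog1_anti hx (v1 l)) mulrN.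
Qed.

Lemma bdbd r c b : bd r (bd r c) b = 0.
Proof.
apply: etrans (@alt_sum_eq0 _ r (fun k l => c (up (up b k) l) * v l * v k) _ _).
- by apply: eq_bigr => k _; rewrite /bd mulr_suml.
- by move=> k; rewrite -mulrA homog1_sqr // mulr0.
- by move=> k l; rewrite -!mulrA upC (homog1_anti (v1 l) (v1 k)) mulrN.
Qed.

Lemma bd_homog r i j c b : (forall a, expo r i.+1 a -> c a \in H j) -> expo r i b ->
  bd r c b \in H (j + 1).
Proof.
move=> hc Xb; apply: memv_suml => l _; apply: homog_mul (v1 l).
exact/hc/expo_up.
Qed.

Lemma bd_up r c b k : bd r (fun a => c (up a k)) b = bd r c (up b k).
Proof. by apply: eq_bigr => l _; rewrite upC. Qed.

(** Inclusion of the complex without [x_r]. The cutoff is explicit because chains are defined on all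
    exponents. *)
Definition incl r z : chain := fun a => if a r == 0%N then z a else 0.

Lemma bd_incl0 r z b : b r = 0%N -> bd r.+1 (incl r z) b = bd r z b.
Proof.
move=> br; rewrite bdS {2}/incl /up br eqxx mul0r addr0.
apply: eq_bigr => l _; rewrite /incl.
by have -> : up b l r = 0%N by rewrite /up br (gtn_eqF (ltn_ord l)).
Qed.

Lemma bd_incl1 r z b : (0 < b r)%N -> bd r.+1 (incl r z) b = 0.
Proof.
move=> br; rewrite /bd big1 // => l _; rewrite /incl /up.
by rewrite addn_eq0 (gtn_eqF br) mul0r.
Qed.

Section Quotient.
Variable Q : {vspace E}.
Hypothesis QM : forall x y, x \in Q -> x * y \in Q.
Hypothesis QH : forall j x, x \in Q -> hcomp j x \in Q.

(* The variables of the paper are numbered from 1, these from 0, and j is the *)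
(* degree of the coefficients: cartan_exact r i j says that H_i(v_1..v_r;E/Q) *)
(* vanishes in degree i + j, annih_exact r j that the annihilator number      *)
(* alpha_(r+1,j) of v is 0, and mul_trivial r i j that the connecting map     *)
(* H_i(r+1) -> H_i(r), multiplication by v_(r+1), is 0 on coefficients of     *)
(* degree j.                                                                  *)
Definition in_add_span (r : nat) (x : E) : Prop :=
  exists y : nat -> E, x - \sum_(l < r) y l * v l \in Q.

(** The guard [i = i'.+1] makes every homogeneous chain of homological degree 0 a cycle. *)
Definition is_cycle (r i : nat) (j : int) c : Prop :=
  (forall a, expo r i a -> c a \in H j) /\
  (forall i' b, i = i'.+1 -> expo r i' b -> bd r c b \in Q).

Definition is_bound (r i : nat) (j : int) c : Prop :=
  (forall a, expo r i a -> c a \in H j) /\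
  exists2 w : chain, (forall a, expo r i.+1 a -> w a \in H (j - 1)) &
    forall a, expo r i a -> c a - bd r w a \in Q.

Definition annih_exact (r : nat) (j : int) : Prop :=
  forall x, x \in H j -> in_add_span r (x * v r) -> in_add_span r.+1 x.

Definition cartan_exact (r i : nat) (j : int) : Prop := forall c, is_cycle r i j c -> is_bound r i j c.

Definition mul_trivial (r i : nat) (j : int) : Prop :=
  forall y, is_cycle r.+1 i j y -> is_bound r i (j + 1) (fun a => y a * v r).

Lemma subrK1 (j : int) : j - 1 + 1 = j. Proof. by rewrite subrK. Qed.
Lemma addrK1 (j : int) : j + 1 - 1 = j. Proof. by rewrite addrK. Qed.

Lemma memQ_bd r i c b : (forall a, expo r i.+1 a -> c a \in Q) -> expo r i b -> bd r c b \in Q.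
Proof. by move=> hc Xb; apply: memv_suml => l _; apply/QM/hc/expo_up. Qed.

Lemma in_add_span_homog r j x : x \in H j -> in_add_span r x ->
  exists2 y : nat -> E, (forall l, y l \in H (j - 1)) & x - \sum_(l < r) y l * v l \in Q.
Proof.
move=> hx [y hy]; exists (fun l => hcomp (j - 1) (y l)) => [l|]; first exact: hcomp_homog.
have := QH j hy; rewrite linearB /= hcomp_id // linear_sum /=.
by under eq_bigr do rewrite -{1}[j]subrK1 hcomp_mulr //.
Qed.

Lemma bound0P r j c : is_bound r 0 j c <-> c (fun=> 0%N) \in H j /\ in_add_span r (c (fun=> 0%N)).
Proof.
split=> [[hc [w hw hb]]|[hc /(in_add_span_homog hc)[y hy hQ]]].
  split; first exact/hc/expo0; exists (fun l => w (up (fun=> 0%N) l)).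
  exact/hb/expo0.
split=> [a /expo0E->//|].
(* The 1-chain with coefficient [y l] at the unit exponent [l], as a formula additive in the
   exponent. *)
exists (fun a => \sum_(l < r) y l *+ a l) => [a _|a /expo0E->].
  by apply: memv_suml => l _; apply: rpredMn.
suff -> : bd r (fun a => \sum_(l < r) y l *+ a l) (fun=> 0%N) = \sum_(l < r) y l * v l by [].
apply: eq_bigr => l _; congr (_ * _); rewrite (bigD1 l) //= big1 ?addr0 => [|k nk].
  by rewrite /up eqxx.
by rewrite /up add0n (inj_eq val_inj) (negPf nk).
Qed.

Lemma cycle_mulv r i j y : is_cycle r.+1 i j y -> is_cycle r i (j + 1) (fun a => y a * v r).
Proof.
case=> hy cy; split=> [a /expo_widen Xa|i' b Ei Xb].
  by apply: homog_mul (v1 r); apply: hy.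
rewrite bd_mulr // rpredN.
have := cy i' b Ei (expo_widen Xb); rewrite bdS => /(QM (v r)).
by rewrite mulrDl -[_ * v r * v r]mulrA homog1_sqr // mulr0 addr0.
Qed.

Lemma bound_incl r i j z : is_bound r i j z -> is_bound r.+1 i j (incl r z).
Proof.
case=> hz [w hw hb]; split=> [a Xa|].
  rewrite /incl; case: eqP => [/expo_narrow/(_ Xa)/hz//|_]; exact: mem0v.
exists (incl r w) => a Xa; rewrite {1}/incl; case: eqP => [a0|/eqP a0].
- exact/hw/expo_narrow.
- exact: mem0v.
- by rewrite bd_incl0 //; apply/hb/expo_narrow.
- by rewrite bd_incl1 ?lt0n // subrr mem0v.
Qed.

Lemma boundD r i j c d : is_bound r i j c -> is_bound r i j d -> is_bound r i j (fun a => c a + d a).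
Proof.
case=> hc [w hw cw] [hd [u hu du]]; split=> [a Xa|].
  by rewrite rpredD ?hc ?hd.
exists (fun a => w a + u a) => a Xa; first by rewrite rpredD ?hw ?hu.
by rewrite bdD opprD addrACA rpredD ?cw ?du.
Qed.

Lemma bound_eq r i j c d : (forall a, expo r i a -> c a = d a) -> is_bound r i j c -> is_bound r i j d.
Proof.
move=> cd [hc [w hw cw]]; split=> [a Xa|]; first by rewrite -cd ?hc.
by exists w => // a Xa; rewrite -cd ?cw.
Qed.

(** Exactness at H_(i+1)(r+1): if the part of [z] divisible by [x_r] bounds [w], subtracting the
    boundary of [x_r] times [w] leaves a chain whose [x_r]-part lies in [Q], so that it comes from
    [r] variables. *)
Lemma les_exact r i j z : is_cycle r.+1 i.+1 j z -> is_bound r.+1 i j (fun a => z (up a r)) ->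
  exists2 z', is_cycle r i.+1 j z' & is_bound r.+1 i.+1 j (fun a => z a - incl r z' a).
Proof.
case=> hz cz [_ [w hw bw]].
(* [W] is [w] shifted by [x_r]. *)
pose W : chain := fun a => if a r == 0%N then 0 else w (down a r).
have hW a : expo r.+1 i.+2 a -> W a \in H (j - 1).
  rewrite /W; case: eqP => [_ _|/eqP a0 Xa]; first exact: mem0v.
  by apply/hw/expo_down => //; rewrite lt0n.
have bW a : bd r.+1 W (up a r) = bd r.+1 w a.
  apply: eq_bigr => l _; rewrite /W upC upK.
  by rewrite [up _ _ r]/up eqxx addn1.
pose z' : chain := fun a => z a - bd r.+1 W a.
have hz' a : expo r.+1 i.+1 a -> z' a \in H j.
  move=> Xa; rewrite rpredB ?hz // -[j]subrK1; exact: bd_homog hW Xa.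
have Qz' a : expo r.+1 i a -> z' (up a r) \in Q.
  by move=> Xa; rewrite /z' bW; apply: bw.
exists z'; split.
- by move=> a /expo_widen/hz'.
- move=> i' b [<-] Xb; have -> : bd r z' b = bd r.+1 z' b - z' (up b r) * v r by rewrite bdS addrK.
  rewrite rpredB ?QM ?Qz' //; last exact: expo_widen.
  by rewrite /z' bdB bdbd subr0; apply: cz (erefl _) _; apply: expo_widen.
- move=> a Xa; rewrite rpredB ?hz // /incl; case: ifP => [_|_]; rewrite ?mem0v //; exact: hz'.
- exists W => // a Xa; rewrite /incl; case: eqP => [_|/eqP a0].
    by rewrite /z' subKr subrr mem0v.
  rewrite subr0 -/(z' a) -(downK (k := r) (a := a)) ?lt0n //.
  by apply/Qz'/expo_down => //; rewrite lt0n.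
Qed.

(** If [w] bounds the included cycle, its [x_r]-part is itself a cycle, and its product with [v r]
    is the only obstruction to bounding [z] in [r] variables. A zero connecting map makes this
    product a boundary, which corrects [w]. *)
Lemma les_inj r i j z : mul_trivial r i (j - 1) -> is_bound r.+1 i j (incl r z) ->
  is_bound r i j z.
Proof.
move=> mu [hz [w hw bw]].
have hz' a : expo r i a -> z a \in H j.
  by move=> Xa; have := hz a (expo_widen Xa); rewrite /incl (expo_at Xa).
have cy : is_cycle r.+1 i (j - 1) (fun a => w (up a r)).
  split=> [a Xa|i' b Ei Xb]; first exact/hw/expo_up.
  rewrite bd_up; have := bw (up b r); rewrite Ei => /(_ (expo_up (ltnSn r) Xb)).
  by rewrite {1}/incl /up eqxx addn1 /= sub0r rpredN.
have := mu _ cy; rewrite subrK1 => -[_ [u hu bu]]; split=> //.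
exists (fun a => w a + u a) => a Xa; first by apply: rpredD; [exact/hw/expo_widen|exact: hu].
have := bw a (expo_widen Xa); rewrite /incl (expo_at Xa) /= bdS => h1.
have h2 := bu a Xa; rewrite bdD.
by have := rpredD h1 h2; rewrite !opprD !addrA subrK.
Qed.

(** A class killed by the connecting map lifts: take [y] shifted by [x_r], minus a chain [u]
    bounding [y * v r]. *)
Lemma les_surj r i j y : is_cycle r.+1 i j y -> is_bound r i (j + 1) (fun a => y a * v r) ->
  exists2 Z, is_cycle r.+1 i.+1 j Z & forall a, Z (up a r) = y a.
Proof.
case=> hy cy [_ [u hu bu]]; rewrite addrK1 in hu.
pose Z : chain := fun a => if a r == 0%N then - u a else y (down a r).
have Zup a : Z (up a r) = y a.
  by rewrite /Z upK /up eqxx addn1.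
exists Z => //; split=> [a Xa|_ b [<-] Xb].
  rewrite /Z; case: eqP => [a0|/eqP a0]; first by rewrite rpredN; apply/hu/expo_narrow.
  by apply/hy/expo_down => //; rewrite lt0n.
have [b0|b0] := posnP (b r).
  rewrite bdS Zup addrC.
  have -> : bd r Z b = - bd r u b.
    rewrite /bd -sumrN; apply: eq_bigr => l _; by rewrite /Z /up b0 (gtn_eqF (ltn_ord l)) mulNr.
  by apply: bu; apply: expo_narrow.
case: i => [|i] in hy cy hu bu Xb *; first by rewrite (expo_down0 _ Xb) in b0.
rewrite -(downK b0) -bd_up.
have -> : bd r.+1 (fun a => Z (up a r)) (down b r) = bd r.+1 y (down b r).
  by apply: eq_bigr => l _; rewrite Zup.
by apply: (cy i) => //; apply: expo_down.
Qed.

(** If [u] bounds [y], then [- u * v r] bounds [y * v r], and the term in [x_r] disappears since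
    [v r] squares to zero. *)
Lemma cartan_exact_mul_trivial r i j : cartan_exact r.+1 i j -> mul_trivial r i j.
Proof.
move=> hex y /[dup] /hex[_ [u hu bu]] [hy _]; split=> [a /expo_widen/hy ha|].
  exact: homog_mul.
rewrite addrK1; exists (fun a => - (u a * v r)) => [a Xa|a Xa].
  rewrite rpredN -[j]subrK1; apply: homog_mul (v1 r); exact/hu/expo_widen.
rewrite bdN bd_mulr // opprK; have := QM (v r) (bu a (expo_widen Xa)).
rewrite bdS mulrBl mulrDl -[_ * v r * v r]mulrA homog1_sqr // mulr0 addr0.
by [].
Qed.

Lemma annih_exact_cycle r j z : is_cycle r.+1 1 j z -> annih_exact r j -> is_bound r.+1 0 j (fun a => z (up a r)).
Proof.
case=> hz cz aex; apply/bound0P; have hr := expo_up (ltnSn r) (expo0 r.+1).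
split; first exact: hz; apply: aex; first exact: hz.
exists (fun l => - z (up (fun=> 0%N) l)).
have := cz _ _ (erefl _) (expo0 r.+1); rewrite bdS addrC /bd.
by under [in X in _ -> X]eq_bigr do rewrite mulNr; rewrite sumrN opprK.
Qed.

(** Double induction on [r] and [i] along the long exact sequence. The annihilator condition enters
    at homological degree 1, where the coefficient of [x_r] in a cycle is annihilated by [v r]. *)
Lemma annih_cartan_exact r i j : (forall k, (k < r)%N -> annih_exact k j) -> cartan_exact r i.+1 j.
Proof.
elim: r i => [|r IHr] i aex.
  move=> z _; split=> [a /expo0r//|]; exists (fun=> 0) => [a _|a /expo0r//].
  exact: mem0v.
have step i' z : is_cycle r.+1 i'.+1 j z -> is_bound r.+1 i' j (fun a => z (up a r)) ->
    is_bound r.+1 i'.+1 j z.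
  move=> cz bz; have [z' cz' bz'] := les_exact cz bz.
  have /bound_incl b' : is_bound r i'.+1 j z' by apply: IHr cz' => k /ltnW; apply: aex.
  by apply: bound_eq (boundD bz' b') => a _; apply: subrK.
elim: i => [|i IHi] z cz; apply: step (cz) _.
  by apply: annih_exact_cycle cz _; apply: aex.
apply: IHi; case: cz => hz cz; split=> [a Xa|i' b Ei Xb]; first exact/hz/expo_up.
by rewrite bd_up; apply: cz (erefl _) _; rewrite Ei; apply: expo_up.
Qed.

(** An annihilated [x] lifts to a 1-cycle with coefficient [x] at [x_r]. If the cycle bounds, that
    coefficient lies in the span. *)
Lemma cartan_exact_annih r j : cartan_exact r.+1 1 j -> annih_exact r j.
Proof.
move=> hex x hx qx; have [||Z cZ ZE] := @les_surj r 0 j (fun=> x).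
- by split.
- by apply/bound0P; split=> //; apply: homog_mul.
have [_ [w hw bw]] := hex _ cZ; rewrite -(ZE (fun=> 0%N)).
exists (fun l => w (up (up (fun=> 0%N) r) l)).
exact/bw/expo_up/expo0.
Qed.

(** Exactness in degree [j] kills the connecting maps into H_1 in degree [j + 1], so H_1(k+1)
    injects into H_1(m), which is zero there. *)
Lemma annih_exact_succ m j : (forall k, (k < m)%N -> annih_exact k j) -> cartan_exact m 1 (j + 1) ->
  forall k, (k < m)%N -> annih_exact k (j + 1).
Proof.
move=> aex hex k km; apply: cartan_exact_annih.
suff descent p : (k < p <= m)%N -> cartan_exact p 1 (j + 1) -> cartan_exact k.+1 1 (j + 1).
  by apply: descent hex; rewrite km leqnn.
elim: p => [//|p IH] /andP[kp pm] hp.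
move: kp; rewrite ltnS leq_eqVlt => /orP[/eqP->//|kp]; apply: IH => [|z cz].
  by rewrite kp ltnW.
apply: les_inj; first rewrite addrK1.
  by apply/cartan_exact_mul_trivial/annih_cartan_exact => q qp; apply/aex/(leq_trans qp).
have [hz bz] := cz; apply: hp; split=> [a Xa|i' b [<-] Xb].
  rewrite /incl; case: eqP => [a0|_]; last exact: mem0v.
  exact/hz/expo_narrow.
have b0 := expo_down0 (ltnSn p) Xb.
by rewrite bd_incl0 //; apply: bz (erefl _) _; apply: expo_narrow.
Qed.

End Quotient.
End Cartan.

(** * Dimensions of Cartan homology *)

Section CartanChains.
Variables (K : fieldType) (n : nat).
Local Notation E := (ext K n).
Local Notation H := (ext_homog K n).

(* The chain spaces of Defs with the length of the sequence of linear forms   *)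
(* replaced by a parameter r, so that their type does not depend on the forms. *)
Definition chain_idx (r i : nat) : Type := {a : 'X_{1..r < i.+1} | mdeg a == i}.
HB.instance Definition _ r i := Finite.on (chain_idx r i).
Definition chains (r i : nat) := {ffun chain_idx r i -> E}.
HB.instance Definition _ r i := Vector.on (chains r i).

Definition idx_mnm r i (a : chain_idx r i) : 'X_{1..r} := bmnm (val a).

Definition chain_diff_fun r (v : nat -> E) i i' (c : chains r i) : chains r i' :=
  [ffun b => \sum_(a : chain_idx r i)
     \sum_(k < r | idx_mnm a == (idx_mnm b + U_(k))%MM) c a * v k].

Lemma chain_diff_fun_linear r v i i' : linear (@chain_diff_fun r v i i').
Proof.
move=> t x y; apply/ffunP=> b; rewrite !ffunE scaler_sumr -big_split /=.
apply: eq_bigr => a _; rewrite scaler_sumr -big_split /=.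
by apply: eq_bigr => k _; rewrite !ffunE mulrDl scalerAl.
Qed.
HB.instance Definition _ r v i i' :=
  GRing.isLinear.Build K (chains r i) (chains r i') _ (@chain_diff_fun r v i i') (@chain_diff_fun_linear r v i i').

Definition chain_diff r v i i' : 'Hom(chains r i, chains r i') := linfun (@chain_diff_fun r v i i').

Definition chain_coef r i (a : chain_idx r i) (c : chains r i) : E := c a.
Lemma chain_coef_linear r i a : linear (@chain_coef r i a).
Proof. by move=> t x y; rewrite /chain_coef !ffunE. Qed.
HB.instance Definition _ r i a :=
  GRing.isLinear.Build K (chains r i) E _ (@chain_coef r i a) (@chain_coef_linear r i a).

Definition chains_in r i (U : {vspace E}) : {vspace chains r i} :=
  (\bigcap_(a : chain_idx r i) (linfun (chain_coef a) @^-1: U))%VS.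

Definition homology_dim r (v : nat -> E) (J : {vspace E}) (i : nat) (j : int) : nat :=
  quot_homology_dim (chain_diff r v i.+1 i) (chain_diff r v i i.-1)
    (chains_in r i.+1 (ext_homog K n (j - i.+1%:Z)))
    (chains_in r i (ext_homog K n (j - i%:Z)))
    (chains_in r i J) (chains_in r i.-1 J).

Lemma cartan_homology_dimE (vs : seq E) J i j :
  cartan_homology_dim vs J i j = homology_dim (size vs) (nth 0 vs) J i j.
Proof. by []. Qed.

Lemma homology_dim_ext r (v v' : nat -> E) J i j : (forall l, (l < r)%N -> v l = v' l) ->
  homology_dim r v J i j = homology_dim r v' J i j.
Proof.
move=> vv'; have e k k' : chain_diff r v k k' = chain_diff r v' k k'.
  apply/lfunP=> c; rewrite !lfunE; apply/ffunP=> b; rewrite !ffunE.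
  by apply: eq_bigr => a _; apply: eq_bigr => l _; rewrite vv'.
by rewrite /homology_dim !e.
Qed.

Definition fromX r (m : 'X_{1..r}) : nat -> nat := nth 0%N m.
Definition toX r (a : nat -> nat) : 'X_{1..r} := [multinom a i | i < r].

Lemma fromXE r (m : 'X_{1..r}) (k : 'I_r) : fromX m k = m k.
Proof. by rewrite (mnm_nth 0%N). Qed.

Lemma fromX_expo r (m : 'X_{1..r}) : expo r (mdeg m) (fromX m).
Proof.
split=> [l rl|]; first by rewrite /fromX nth_default // size_tuple.
by rewrite mdegE; apply: eq_bigr => k _; rewrite fromXE.
Qed.

Lemma fromXK r : cancel (@fromX r) (toX r).
Proof. by move=> m; apply/mnmP=> k; rewrite mnmE fromXE. Qed.

Lemma toXK r i a : expo r i a -> fromX (toX r a) = a.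
Proof.
case=> a0 _; apply: funext => l; have [lr|rl] := ltnP l r.
  by rewrite -[l]/(val (Ordinal lr)) fromXE mnmE.
by rewrite /fromX nth_default ?size_tuple // a0.
Qed.

Lemma mdeg_toX r i a : expo r i a -> mdeg (toX r a) = i.
Proof. by case=> _ <-; rewrite mdegE; apply: eq_bigr => k _; rewrite mnmE. Qed.

Lemma chain_idx_expo r i (a : chain_idx r i) : expo r i (fromX (idx_mnm a)).
Proof. by have := fromX_expo (idx_mnm a); rewrite (eqP (valP a)). Qed.

Lemma chain_idx_exists r i a : expo r i a -> exists b : chain_idx r i, idx_mnm b = toX r a.
Proof.
move=> /mdeg_toX ha; have lt : (mdeg (toX r a) < i.+1)%N by rewrite ha.
have h : mdeg (BMultinom lt) == i by rewrite /= ha.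
by exists (exist (fun a : 'X_{1..r < i.+1} => mdeg a == i) (BMultinom lt) h).
Qed.

Lemma idx_mnm_inj r i : injective (@idx_mnm r i).
Proof. by move=> a b ab; apply/val_inj/val_inj. Qed.

(** A sum with at most one term, so that no index has to be constructed for exponents outside the
    range. *)
Definition chain_fun r i (c : chains r i) : (nat -> nat) -> E :=
  fun a => \sum_(b : chain_idx r i | idx_mnm b == toX r a) c b.
Definition chain_of r i (f : (nat -> nat) -> E) : chains r i := [ffun a => f (fromX (idx_mnm a))].

Lemma chain_fun_idx r i (c : chains r i) a : chain_fun c (fromX (idx_mnm a)) = c a.
Proof.
by rewrite /chain_fun fromXK (big_pred1 a) // => b /=; rewrite -(inj_eq (@idx_mnm_inj _ _)).
Qed.

Lemma chain_funK r i f a : expo r i a -> chain_fun (chain_of r i f) a = f a.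
Proof.
move=> Xa; have [b hb] := chain_idx_exists Xa.
by rewrite -(toXK Xa) -hb chain_fun_idx ffunE.
Qed.

Lemma chain_fun_linear r i t (c d : chains r i) a : chain_fun (t *: c + d) a = t *: chain_fun c a + chain_fun d a.
Proof.
by rewrite /chain_fun scaler_sumr -big_split; apply: eq_bigr => b _; rewrite !ffunE.
Qed.

Lemma chain_funB r i (c d : chains r i) a : chain_fun (c - d) a = chain_fun c a - chain_fun d a.
Proof. by rewrite addrC -scaleN1r chain_fun_linear scaleN1r addrC. Qed.

Lemma chain_funD r i (c d : chains r i) a : chain_fun (c + d) a = chain_fun c a + chain_fun d a.
Proof. by rewrite -[c]scale1r chain_fun_linear !scale1r. Qed.

Lemma mem_chains_in r i (U : {vspace E}) (c : chains r i) :
  reflect (forall a, expo r i a -> chain_fun c a \in U) (c \in chains_in r i U).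
Proof.
apply: (iffP idP) => [hc a Xa|hc].
  have [b hb] := chain_idx_exists Xa; rewrite -(toXK Xa) -hb chain_fun_idx.
  move/subv_bigcapP: hc => /(_ b isT); rewrite -memvE -memv_preim lfunE.
  by [].
rewrite memvE; apply/subv_bigcapP => b _; rewrite -memvE -memv_preim lfunE /=.
by rewrite /chain_coef -chain_fun_idx; apply/hc/chain_idx_expo.
Qed.

Lemma chain_fun_diff r v i (c : chains r i.+1) b : expo r i b ->
  chain_fun (chain_diff r v i.+1 i c) b = bd v r (chain_fun c) b.
Proof.
move=> Xb; have [b' hb] := chain_idx_exists Xb.
rewrite -{1}(toXK Xb) -hb chain_fun_idx lfunE ffunE.
under eq_bigr do rewrite big_mkcond.
rewrite exchange_big /=; apply: eq_bigr => k _; rewrite -big_mkcond /=.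
rewrite /chain_fun mulr_suml; apply: eq_bigl => a; congr (_ == _).
apply/mnmP=> l; rewrite mnmDE mnm1E mnmE hb mnmE /up.
by rewrite eq_sym.
Qed.

Lemma chain_diff00 r v (c : chains r 0) : chain_diff r v 0 0 c = 0.
Proof.
rewrite lfunE; apply/ffunP=> b; rewrite !ffunE big1 // => a _; rewrite big1 // => k.
move/eqP/(congr1 (@mdeg r)); rewrite mdegD mdeg1.
by rewrite (eqP (valP a)) addn1.
Qed.

Section Homology.
Variables (v : nat -> E).
Hypothesis v1 : forall l, v l \in H 1.
Variable Q : {vspace E}.
Hypothesis QM : forall x y, x \in Q -> x * y \in Q.
Hypothesis QH : forall j x, x \in Q -> hcomp j x \in Q.

Definition cycle_space r i (j : int) : {vspace chains r i} :=
  (chains_in r i (H j) :&: (chain_diff r v i i.-1 @^-1: chains_in r i.-1 Q))%VS.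
Definition bound_space r i (j : int) : {vspace chains r i} :=
  ((chain_diff r v i.+1 i @: chains_in r i.+1 (H (j - 1))) + (chains_in r i (H j) :&: chains_in r i Q))%VS.

Lemma homology_dimE r i j :
  homology_dim r v Q i (j + i%:Z) = (\dim (cycle_space r i j) - \dim (bound_space r i j))%N.
Proof.
rewrite /homology_dim /quot_homology_dim /cycle_space /bound_space addrK.
by have -> : j + i%:Z - i.+1%:Z = j - 1 by lia.
Qed.

Lemma mem_cycle_space r i j c : reflect (is_cycle v Q r i j (chain_fun c)) (c \in cycle_space r i j).
Proof.
rewrite memv_cap -memv_preim; apply: (iffP andP) => [[/mem_chains_in hc hd]|[hc hd]].
  split=> // i' b Ei Xb; subst i.
  by move/mem_chains_in/(_ b Xb): hd; rewrite chain_fun_diff.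
split; first exact/mem_chains_in.
case: i c hc hd => [|i] c hc hd /=; first by rewrite chain_diff00 mem0v.
by apply/mem_chains_in => b Xb; rewrite chain_fun_diff //; apply: hd.
Qed.

Lemma mem_bound_space r i j c : reflect (is_bound v Q r i j (chain_fun c)) (c \in bound_space r i j).
Proof.
apply: (iffP memv_addP) => [[_ /memv_imgP[w /mem_chains_in hw ->] [d]]|[hc [w hw bw]]].
  rewrite memv_cap => /andP[/mem_chains_in hd /mem_chains_in qd] ->; split=> [a Xa|].
    rewrite chain_funD rpredD ?hd // chain_fun_diff // -[j]subrK1.
    exact: (bd_homog v1 hw).
  by exists (chain_fun w) => // a Xa; rewrite chain_funD chain_fun_diff // addrC addKr qd.
have hW : chain_of r i.+1 w \in chains_in r i.+1 (H (j - 1)).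
  by apply/mem_chains_in => a Xa; rewrite chain_funK // hw.
exists (chain_diff r v i.+1 i (chain_of r i.+1 w)); first exact: memv_img.
have bE b : expo r i b -> bd v r (chain_fun (chain_of r i.+1 w)) b = bd v r w b.
  by move=> Xb; apply: eq_bigr => l _; rewrite chain_funK //; apply: expo_up.
exists (c - chain_diff r v i.+1 i (chain_of r i.+1 w)); last by rewrite addrC subrK.
rewrite memv_cap; apply/andP; split; apply/mem_chains_in => a Xa.
  rewrite chain_funB chain_fun_diff //; apply: rpredB; first exact: hc.
  by rewrite -[j]subrK1; apply: (bd_homog v1) Xa; apply/mem_chains_in.
by rewrite chain_funB chain_fun_diff // bE // bw.
Qed.

End Homology.
End CartanChains.

(** * Dimension counts for exact sequences of subquotients *)

Section Subquotients.
Variables (K : fieldType).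

(** Rank-nullity for the map from [A] to the quotient of the target by [B]. It turns kernels into
    images, whose generic dimensions are easy to control. *)
Lemma dim_preim_cap (U V : vectType K) (f : 'Hom(U, V)) (A : {vspace U}) (B : {vspace V}) :
  (\dim (A :&: f @^-1: B) + \dim (f @: A + B) = \dim A + \dim B)%N.
Proof.
have fE : (f @: (A :&: f @^-1: B) = (f @: A) :&: B)%VS.
  apply/vspaceP=> y; apply/memv_imgP/memv_capP => [[x]|[/memv_imgP[x xA ->] fxB]].
    by rewrite memv_cap -memv_preim => /andP[xA fxB] ->; rewrite memv_img.
  by exists x => //; rewrite memv_cap -memv_preim xA.
have kE : ((A :&: f @^-1: B) :&: lker f = A :&: lker f)%VS.
  apply/vspaceP=> x; rewrite !memv_cap -memv_preim memv_ker.
  by case: eqP => [->|]; rewrite ?andbF // mem0v !andbT.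
have := limg_ker_dim f (A :&: f @^-1: B); rewrite fE kE.
have := limg_ker_dim f A; have := dimv_sum_cap (f @: A) B.
lia.
Qed.

Variables (X Y W : vectType K) (f : 'Hom(X, Y)) (g : 'Hom(Y, W)).
Variables (ZX BX : {vspace X}) (ZY BY : {vspace Y}) (ZW BW : {vspace W}).
Hypotheses (sBX : (BX <= ZX)%VS) (sBY : (BY <= ZY)%VS) (sBW : (BW <= ZW)%VS).
Hypotheses (fZ : forall x, x \in ZX -> f x \in ZY) (fB : forall x, x \in BX -> f x \in BY).
Hypothesis gZ : forall y, y \in ZY -> g y \in ZW.
Hypothesis gB : forall y, y \in BY -> g y \in BW.
Hypothesis gf : forall x, x \in ZX -> g (f x) \in BW.
Hypothesis exY : forall y, y \in ZY -> g y \in BW ->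
  exists2 x, x \in ZX & y - f x \in BY.

(** For an exact ZX/BX -> ZY/BY -> ZW/BW, the middle dimension plus the kernel of the first map and
    the cokernel of the second is the sum of the outer ones. The bounds keep the truncated
    subtractions honest. *)
Let subq_dims :
  [/\ (\dim BX <= \dim (ZX :&: f @^-1: BY))%N, (\dim (g @: ZY + BW) <= \dim ZW)%N &
    (\dim ZY - \dim BY + (\dim (ZX :&: f @^-1: BY) - \dim BX) +
      (\dim ZW - \dim (g @: ZY + BW)) =
      (\dim ZX - \dim BX) + (\dim ZW - \dim BW))%N].
Proof.
have NE : (ZY :&: g @^-1: BW = f @: ZX + BY)%VS.
  apply/vspaceP=> y; apply/memv_capP/memv_addP => [[yZ]|].
    rewrite -memv_preim => /(exY yZ)[x xZ xB].
    exists (f x); first exact: memv_img.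
    by exists (y - f x) => //; rewrite addrC subrK.
  case=> _ /memv_imgP[x xZ ->] [b bB ->]; rewrite -memv_preim linearD.
  by rewrite rpredD ?fZ ?(subvP sBY) // rpredD ?gf ?gB.
have h1 := dim_preim_cap f ZX BY; have h2 := dim_preim_cap g ZY BW.
rewrite NE in h2.
have le1 : (\dim BX <= \dim (ZX :&: f @^-1: BY))%N.
  by apply: dimvS; apply/subvP=> x xB; rewrite memv_cap (subvP sBX) // -memv_preim fB.
have le2 : (\dim (ZX :&: f @^-1: BY) <= \dim ZX)%N by apply/dimvS/capvSl.
have le3 : (\dim (g @: ZY + BW) <= \dim ZW)%N.
  by apply: dimvS; rewrite subv_add sBW andbT; apply/subvP=> _ /memv_imgP[y /gZ h ->].
have le4 := dimvS sBX; have le5 := dimvS sBY; have le6 := dimvS sBW.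
have le7 : (\dim BW <= \dim (g @: ZY + BW))%N by apply/dimvS/addvSr.
have le8 : (\dim BY <= \dim (f @: ZX + BY))%N by apply/dimvS/addvSr.
split=> //; lia.
Qed.

Lemma subq_le :
  (\dim ZY - \dim BY <= (\dim ZX - \dim BX) + (\dim ZW - \dim BW))%N.
Proof. by case: subq_dims; lia. Qed.

Lemma subq_eq : (forall x, x \in ZX -> f x \in BY -> x \in BX) ->
    (forall w, w \in ZW -> exists2 y, y \in ZY & w - g y \in BW) ->
  (\dim ZY - \dim BY = (\dim ZX - \dim BX) + (\dim ZW - \dim BW))%N.
Proof.
move=> inj surj; have [l1 l2] := subq_dims.
have -> : (ZX :&: f @^-1: BY = BX)%VS.
  apply/eqP; rewrite eqEsubv; apply/andP; split; apply/subvP=> x.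
    by rewrite memv_cap -memv_preim => /andP[xZ /(inj _ xZ)].
  by move=> xB; rewrite memv_cap (subvP sBX) // -memv_preim fB.
have -> : (g @: ZY + BW = ZW)%VS; last by lia.
apply/eqP; rewrite eqEsubv subv_add sBW andbT; apply/andP; split; apply/subvP.
  by move=> _ /memv_imgP[y /gZ h ->].
move=> w /surj[y yZ wB]; rewrite -(subrK (g y) w) addrC.
by rewrite memv_add // memv_img.
Qed.

Lemma subq_inj :
    (\dim ZY - \dim BY = (\dim ZX - \dim BX) + (\dim ZW - \dim BW))%N ->
  forall x, x \in ZX -> f x \in BY -> x \in BX.
Proof.
move=> e x xZ xB; have [l1 l2 h] := subq_dims.
have : (BX == ZX :&: f @^-1: BY)%VS.
  rewrite eqEdim; apply/andP; split; last by lia.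
  by apply/subvP=> y yB; rewrite memv_cap (subvP sBX) // -memv_preim fB.
by move/eqP->; rewrite memv_cap xZ -memv_preim.
Qed.

End Subquotients.

(** * Recursion for Cartan numbers and binomial sums *)

Section Numbers.
Variables (K : fieldType) (n : nat).
Local Notation E := (ext K n).
Local Notation H := (ext_homog K n).
Variables (v : nat -> E).
Hypothesis v1 : forall l, v l \in H 1.
Variable Q : {vspace E}.
Hypothesis QM : forall x y, x \in Q -> x * y \in Q.
Hypothesis QH : forall j x, x \in Q -> hcomp j x \in Q.
Variable Qr : nat -> {vspace E}.
Hypothesis QrP : forall r x, x \in Qr r <-> in_add_span v Q r x.

Definition annih_dim (r : nat) (j : int) : nat :=
  (\dim (H j :&: amulr (v r) @^-1: Qr r) - \dim (H j :&: Qr r.+1))%N.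

Definition cincl r i (c : chains K n r i) : chains K n r.+1 i := chain_of r.+1 i (incl r (chain_fun c)).
Lemma cincl_linear r i : linear (@cincl r i).
Proof.
move=> t c d; apply/ffunP=> a; rewrite !ffunE /incl; case: ifP => _.
  by rewrite chain_fun_linear.
by rewrite scaler0 addr0.
Qed.
HB.instance Definition _ r i :=
  GRing.isLinear.Build K (chains K n r i) (chains K n r.+1 i) _ (@cincl r i) (@cincl_linear r i).

Definition cdivx r i (c : chains K n r.+1 i.+1) : chains K n r.+1 i :=
  chain_of r.+1 i (fun a => chain_fun c (up a r)).
Lemma cdivx_linear r i : linear (@cdivx r i).
Proof. by move=> t c d; apply/ffunP=> a; rewrite !ffunE chain_fun_linear. Qed.
HB.instance Definition _ r i :=
  GRing.isLinear.Build K (chains K n r.+1 i.+1) (chains K n r.+1 i) _ (@cdivx r i) (@cdivx_linear r i).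

(** In homological degree 1 this replaces [cdivx]: its values lie in the annihilator of [v r], so
    the third term of the sequence becomes the annihilator number instead of all of H_0. *)
Definition clast r (c : chains K n r.+1 1) : E := chain_fun c (up (fun=> 0%N) r).
Lemma clast_linear r : linear (@clast r).
Proof. by move=> t c d; rewrite /clast chain_fun_linear. Qed.
HB.instance Definition _ r :=
  GRing.isLinear.Build K (chains K n r.+1 1) E _ (@clast r) (@clast_linear r).

Lemma cycle_eq r i j c d : (forall a, expo r i a -> c a = d a) -> is_cycle v Q r i j c -> is_cycle v Q r i j d.
Proof.
move=> cd [hc cc]; split=> [a Xa|i' b Ei Xb]; first by rewrite -cd ?hc.
have -> : bd v r d b = bd v r c b; last exact: cc Ei Xb.
by apply: eq_bigr => l _; rewrite cd // Ei; apply: expo_up.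
Qed.

Lemma bound_cycle r i j c : is_bound v Q r i j c -> is_cycle v Q r i j c.
Proof.
case=> hc [w _ hw]; split=> // i' b Ei Xb.
have -> : bd v r c b = bd v r (fun a => c a - bd v r w a) b by rewrite bdB bdbd ?subr0.
by apply: (memQ_bd v QM) Xb => a Xa; apply: hw; rewrite Ei.
Qed.

Lemma cycle_incl r i j c : is_cycle v Q r i j c -> is_cycle v Q r.+1 i j (incl r c).
Proof.
case=> hc cc; split=> [a Xa|i' b Ei Xb].
  rewrite /incl; case: eqP => [a0|_]; [exact/hc/expo_narrow|exact: mem0v].
have [b0|b0] := posnP (b r); last by rewrite bd_incl1 // mem0v.
by rewrite bd_incl0 //; apply: cc Ei _; apply: expo_narrow.
Qed.

Lemma cycle_div r i j c : is_cycle v Q r i.+1 j c -> forall k, (k < r)%N ->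
  is_cycle v Q r i j (fun a => c (up a k)).
Proof.
case=> hc cc k kr; split=> [a Xa|i' b Ei Xb]; first exact/hc/expo_up.
by rewrite bd_up; apply: cc (erefl _) _; rewrite Ei; apply: expo_up.
Qed.

Lemma bound_div r i j c : is_bound v Q r i.+1 j c -> forall k, (k < r)%N ->
  is_bound v Q r i j (fun a => c (up a k)).
Proof.
case=> hc [w hw cw] k kr; split=> [a Xa|]; first exact/hc/expo_up.
exists (fun a => w (up a k)) => a Xa; first exact/hw/expo_up.
by rewrite bd_up; apply/cw/expo_up.
Qed.

Lemma bound0 r i j : is_bound v Q r i j (fun=> 0).
Proof.
split=> [a _|]; first exact: mem0v; exists (fun=> 0) => a _; first exact: mem0v.
by rewrite /bd big1 ?subr0 ?mem0v // => l _; rewrite mul0r.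
Qed.

Definition cartan_dim r i j := homology_dim r v Q i (j + i%:Z).

Let Z := cycle_space v Q.
Let B := bound_space v Q.
Let mZ := mem_cycle_space v Q.
Let mB := mem_bound_space v1 Q.

Let BZ r i j : (B r i j <= Z r i j)%VS.
Proof. by apply/subvP=> c /mB/bound_cycle cc; apply/mZ. Qed.

Section Step.
Variables (r : nat) (j : int).
Let ZA := (H j :&: amulr (v r) @^-1: Qr r)%VS.
Let BA := (H j :&: Qr r.+1)%VS.

Let mZA x : x \in ZA <-> x \in H j /\ in_add_span v Q r (x * v r).
Proof.
rewrite memv_cap -memv_preim lfunE /=; split.
  by case/andP=> -> /QrP.
by case=> -> /QrP.
Qed.

Let mBA x : x \in BA <-> x \in H j /\ in_add_span v Q r.+1 x.
Proof.
by rewrite memv_cap; split=> [/andP[-> /QrP]|[-> /QrP]].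
Qed.

Let BZA : (BA <= ZA)%VS.
Proof.
apply/subvP=> x /mBA[hx [y hy]]; apply/mZA; split=> //.
exists (fun l => - (y l * v r)).
have := QM (v r) hy; rewrite big_ord_recr /= mulrBl mulrDl -[_ * v r * v r]mulrA.
rewrite homog1_sqr // mulr0 addr0; congr (_ - _ \in Q).
rewrite mulr_suml; apply: eq_bigr => l _.
by rewrite mulNr -!mulrA (homog1_anti (v1 l) (v1 r)) mulrN.
Qed.

Let fL i : 'Hom(chains K n r i, chains K n r.+1 i) := linfun (@cincl r i).
Let gL i : 'Hom(chains K n r.+1 i.+1, chains K n r.+1 i) := linfun (@cdivx r i).
Let g0 : 'Hom(chains K n r.+1 1, E) := linfun (@clast r).

Let totf i c a : expo r.+1 i a -> chain_fun (fL i c) a = incl r (chain_fun c) a.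
Proof. by move=> Xa; rewrite lfunE chain_funK. Qed.
Let totg i c a : expo r.+1 i a -> chain_fun (gL i c) a = chain_fun c (up a r).
Proof. by move=> Xa; rewrite lfunE chain_funK. Qed.

Let fZ i c : c \in Z r i j -> fL i c \in Z r.+1 i j.
Proof.
by move/mZ/cycle_incl=> h; apply/mZ; apply: cycle_eq h => a Xa; rewrite totf.
Qed.
Let fB i c : c \in B r i j -> fL i c \in B r.+1 i j.
Proof.
move/mB/bound_incl=> h; apply/mB.
by apply: bound_eq h => a Xa; rewrite totf.
Qed.
Let gZ i c : c \in Z r.+1 i.+1 j -> gL i c \in Z r.+1 i j.
Proof.
move/mZ/cycle_div/(_ r (ltnSn r))=> h; apply/mZ.
by apply: cycle_eq h => a Xa; rewrite totg.
Qed.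
Let gB i c : c \in B r.+1 i.+1 j -> gL i c \in B r.+1 i j.
Proof.
move/mB/bound_div/(_ r (ltnSn r))=> h; apply/mB.
by apply: bound_eq h => a Xa; rewrite totg.
Qed.
Let gf i c : c \in Z r i.+1 j -> gL i (fL i.+1 c) \in B r.+1 i j.
Proof.
move=> _; apply/mB; apply: bound_eq (bound0 _ _ _) => a Xa.
by rewrite totg // totf ?/incl ?[up a r r]/up ?eqxx ?addn1 //; apply: expo_up.
Qed.
Let exY i c : c \in Z r.+1 i.+1 j -> gL i c \in B r.+1 i j ->
  exists2 x, x \in Z r i.+1 j & c - fL i.+1 x \in B r.+1 i.+1 j.
Proof.
move=> /mZ cc /mB cb.
have [|z' cz' bz'] := les_exact v1 QM cc (j := j).
  by apply: bound_eq cb => a Xa; rewrite totg.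
exists (chain_of r i.+1 z').
  by apply/mZ; apply: cycle_eq cz' => a Xa; rewrite chain_funK.
apply/mB; apply: bound_eq bz' => a Xa; rewrite chain_funB totf // /incl.
by case: eqP => // a0; rewrite chain_funK //; apply: expo_narrow.
Qed.

Let g0Z c : c \in Z r.+1 1 j -> g0 c \in ZA.
Proof.
move/mZ=> [hc cc]; rewrite lfunE; apply/mZA; split; first exact/hc/expo_up/expo0.
exists (fun l => - chain_fun c (up (fun=> 0%N) l)).
have := cc _ _ (erefl _) (expo0 r.+1); rewrite bdS addrC /bd.
by under [in X in _ -> X]eq_bigr do rewrite mulNr; rewrite sumrN opprK.
Qed.
Let g0BE c : c \in Z r.+1 1 j -> g0 c \in BA <-> gL 0 c \in B r.+1 0 j.
Proof.
move/mZ=> [hc cc]; rewrite lfunE; split=> [/mBA h|/mB/bound0P].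
  by apply/mB/bound0P => //; rewrite totg //; apply: expo0.
rewrite totg; last exact: expo0.
by move=> h; apply/mBA; apply: h.
Qed.

Lemma cartan_dim_le i : (cartan_dim r.+1 i.+2 j <= cartan_dim r i.+2 j + cartan_dim r.+1 i.+1 j)%N.
Proof.
by rewrite /cartan_dim !homology_dimE; apply: (@subq_le _ _ _ _ (fL i.+2) (gL i.+1)) => //;
  do ?[exact: BZ]; do ?[exact: fZ]; do ?[exact: fB]; do ?[exact: gZ]; do ?[exact: gB];
  do ?[exact: gf]; exact: exY.
Qed.

(** The first vanishing gives injectivity on the left of the sequence, the second surjectivity on
    the right. *)
Lemma cartan_dim_eq i : mul_trivial v Q r i.+2 (j - 1) -> mul_trivial v Q r i.+1 j ->
  cartan_dim r.+1 i.+2 j = (cartan_dim r i.+2 j + cartan_dim r.+1 i.+1 j)%N.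
Proof.
move=> mu1 mu2; rewrite /cartan_dim !homology_dimE; apply: (@subq_eq _ _ _ _ (fL i.+2) (gL i.+1)) => //;
  do ?[exact: BZ]; do ?[exact: fZ]; do ?[exact: fB]; do ?[exact: gZ]; do ?[exact: gB];
  do ?[exact: gf]; do ?[exact: exY].
  move=> c /mZ cc /mB cb; apply/mB; apply: (les_inj mu1).
  by apply: bound_eq cb => a Xa; rewrite totf.
move=> c /mZ cc; have [|Y cY YE] := les_surj cc; first exact: mu2.
exists (chain_of r.+1 i.+2 Y).
  by apply/mZ; apply: cycle_eq cY => a Xa; rewrite chain_funK.
apply/mB; apply: bound_eq (bound0 _ _ _) => a Xa; rewrite chain_funB totg // chain_funK ?YE ?subrr //.
exact: expo_up.
Qed.

Let g0B c : c \in B r.+1 1 j -> g0 c \in BA.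
Proof. by move=> h; apply/(g0BE (subvP (BZ _ _ _) _ h))/gB. Qed.
Let g0f c : c \in Z r 1 j -> g0 (fL 1 c) \in BA.
Proof. by move=> h; apply/(g0BE (fZ h))/gf. Qed.
Let ex0 c : c \in Z r.+1 1 j -> g0 c \in BA ->
  exists2 x, x \in Z r 1 j & c - fL 1 x \in B r.+1 1 j.
Proof. by move=> h /(g0BE h); apply: exY. Qed.

Lemma cartan_dim1_le : (cartan_dim r.+1 1 j <= cartan_dim r 1 j + annih_dim r j)%N.
Proof.
by rewrite /cartan_dim !homology_dimE; apply: (@subq_le _ _ _ _ (fL 1) g0) => //;
  do ?[exact: BZ]; do ?[exact: fZ]; do ?[exact: fB]; do ?[exact: g0Z]; do ?[exact: g0B];
  do ?[exact: g0f]; exact: ex0.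
Qed.

(** Surjectivity is automatic: elements annihilated by [v r] are exactly those that [les_surj]
    lifts. *)
Lemma cartan_dim1_eq : mul_trivial v Q r 1 (j - 1) -> cartan_dim r.+1 1 j = (cartan_dim r 1 j + annih_dim r j)%N.
Proof.
move=> mu1; rewrite /cartan_dim !homology_dimE; apply: (@subq_eq _ _ _ _ (fL 1) g0) => //;
  do ?[exact: BZ]; do ?[exact: fZ]; do ?[exact: fB]; do ?[exact: g0Z]; do ?[exact: g0B];
  do ?[exact: g0f]; do ?[exact: ex0].
  move=> c /mZ cc /mB cb; apply/mB; apply: (les_inj mu1).
  by apply: bound_eq cb => a Xa; rewrite totf.
move=> x /mZA[hx qx]; have [||Y cY YE] := @les_surj _ _ v Q r 0 j (fun=> x).
- by split.
- by apply/bound0P => //; split=> //; apply: homog_mul.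
exists (chain_of r.+1 1 Y).
  by apply/mZ; apply: cycle_eq cY => a Xa; rewrite chain_funK.
rewrite lfunE /= /clast chain_funK ?YE ?subrr ?mem0v //; exact/expo_up/expo0.
Qed.

Lemma cartan_dim1_inj : cartan_dim r.+1 1 j = (cartan_dim r 1 j + annih_dim r j)%N ->
  forall z, is_cycle v Q r 1 j z -> is_bound v Q r.+1 1 j (incl r z) -> is_bound v Q r 1 j z.
Proof.
rewrite /cartan_dim !homology_dimE => e z cz bz.
have /mB : chain_of r 1 z \in B r 1 j.
  apply: (@subq_inj _ _ _ _ (fL 1) g0 _ _ _ _ ZA BA _ _ _ _ _ _ _ _ _ e) => //;
  do ?[exact: BZ]; do ?[exact: fZ]; do ?[exact: fB]; do ?[exact: g0Z]; do ?[exact: g0B];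
  do ?[exact: g0f]; do ?[exact: ex0].
    by apply/mZ; apply: cycle_eq cz => a Xa; rewrite chain_funK.
  apply/mB; apply: bound_eq bz => a Xa; rewrite totf // /incl.
  by case: eqP => // a0; rewrite chain_funK //; apply: expo_narrow.
by apply: bound_eq => a Xa; rewrite chain_funK.
Qed.

End Step.

Lemma cartan_dim0 i j : cartan_dim 0 i.+1 j = 0%N.
Proof.
rewrite /cartan_dim homology_dimE; apply/eqP; rewrite subn_eq0; apply/dimvS/subvP => c _.
apply/mB; split=> [a /expo0r//|]; exists (fun=> 0) => a; last by move/expo0r.
by rewrite mem0v.
Qed.

(** The bound of the theorem with [k] counted from 0 and with [i] one less than the homological
    degree. *)
Definition binsum r i j := (\sum_(k < r) 'C(r + i - k - 1, i) * annih_dim k j)%N.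

Lemma binsumS0 r j : binsum r.+1 0 j = (binsum r 0 j + annih_dim r j)%N.
Proof.
rewrite /binsum big_ord_recr /= bin0 mul1n; congr addn.
by apply: eq_bigr => k _; rewrite !bin0.
Qed.

Lemma binsumSS r i j : binsum r.+1 i.+1 j = (binsum r i.+1 j + binsum r.+1 i j)%N.
Proof.
(* The added summand [k = r] has the coefficient ['C(i, i.+1)], which is 0. Pascal's rule then
   applies termwise. *)
have -> : binsum r i.+1 j = (\sum_(k < r.+1) 'C(r + i - k, i.+1) * annih_dim k j)%N.
  rewrite big_ord_recr /= [X in _ = (_ + X * _)%N]bin_small; last by lia.
  rewrite mul0n addn0; apply: eq_bigr => k _; congr ('C(_, _) * _)%N.
  by have := ltn_ord k; lia.
rewrite /binsum -big_split /=; apply: eq_bigr => k _.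
rewrite -mulnDl; congr (_ * _)%N; have kr := ltn_ord k.
have -> : (r.+1 + i.+1 - k - 1 = (r + i - k).+1)%N by lia.
have -> : (r.+1 + i - k - 1 = r + i - k)%N by lia.
by rewrite binS.
Qed.

Lemma cartan_dim_le_binsum r i j : (cartan_dim r i.+1 j <= binsum r i j)%N.
Proof.
elim: r i => [|r IHr] i; first by rewrite cartan_dim0.
elim: i => [|i IHi].
  by rewrite binsumS0; apply: leq_trans (cartan_dim1_le r j) _; rewrite leq_add2r.
by rewrite binsumSS; apply: leq_trans (cartan_dim_le r j i) _; apply: leq_add.
Qed.

Lemma cartan_dim_eq_binsum m r i j :
    (forall k i, (k < m)%N -> mul_trivial v Q k i.+1 (j - 1)) ->
    (forall k i, (k < m)%N -> mul_trivial v Q k i.+1 j) -> (r <= m)%N ->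
  cartan_dim r i.+1 j = binsum r i j.
Proof.
move=> mu1 mu2; elim: r i => [|r IHr] i rm; first by rewrite cartan_dim0 /binsum big_ord0.
elim: i => [|i IHi].
  by rewrite binsumS0 cartan_dim1_eq ?IHr 1?ltnW //; apply: mu1.
by rewrite binsumSS cartan_dim_eq ?IHr 1?ltnW ?IHi //; [apply: mu1|apply: mu2].
Qed.

Lemma cartan_dim_binsum_inj m j : (forall r, (r <= m)%N -> cartan_dim r 1 j = binsum r 0 j) ->
  forall r z, (r < m)%N -> is_cycle v Q r 1 j z -> is_bound v Q r.+1 1 j (incl r z) -> is_bound v Q r 1 j z.
Proof.
move=> h r z rm; apply: cartan_dim1_inj.
by rewrite !h ?binsumS0 // ltnW.
Qed.

End Numbers.

(** * Ideals of linear forms and annihilator numbers *)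

Section Quotients.
Variables (K : fieldType) (n : nat).
Local Notation E := (ext K n).
Local Notation H := (ext_homog K n).

Definition lspan (v : nat -> E) (r : nat) : {vspace E} :=
  (\sum_(l < r) limg (amulr (v l)))%VS.

Lemma mem_lspan v r x :
  x \in lspan v r <-> exists y : nat -> E, x = \sum_(l < r) y l * v l.
Proof.
split=> [/memv_sumP[f hf ->]|[y ->]]; last first.
  by apply: memv_sumr => l _; apply/memv_imgP; exists (y l); rewrite ?memvf // lfunE.
have hy (l : 'I_r) : exists y, f l = y * v l.
  by have /memv_imgP[y _ ->] := hf l isT; exists y; rewrite lfunE.
have [y hy'] := choice hy.
exists (fun l => if insub l is Some k then y k else 0).
by apply: eq_bigr => l _; rewrite valK.
Qed.

Lemma in_add_spanE v Q r x : in_add_span v Q r x <-> x \in (Q + lspan v r)%VS.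
Proof.
split=> [[y hy]|/memv_addP[q hq [w /mem_lspan[y ->] ->]]]; last first.
  by exists y; rewrite addrK.
rewrite -(subrK (\sum_(l < r) y l * v l) x) memv_add //.
by apply/mem_lspan; exists y.
Qed.

Variables (v : nat -> E).
Hypothesis v1 : forall l, v l \in H 1.

Lemma lspan_mull r x y : x \in lspan v r -> y * x \in lspan v r.
Proof.
case/mem_lspan=> z ->; apply/mem_lspan; exists (fun l => y * z l).
by rewrite mulr_sumr; apply: eq_bigr => l _; rewrite mulrA.
Qed.

(** Linear forms commute with homogeneous elements up to sign, so this left ideal is two-sided. *)
Lemma lspan_mulr r x y : x \in lspan v r -> x * y \in lspan v r.
Proof.
case/mem_lspan=> z ->; rewrite [y]hcomp_sum mulr_sumr; apply: memv_suml => d _.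
apply/mem_lspan; exists (fun l => (-1) ^+ d *: (z l * hcomp d%:Z y)).
rewrite mulr_suml; apply: eq_bigr => l _.
by rewrite -mulrA (homog_comm1 (v1 l) (hcomp_homog _ _)) -scalerAr -scalerAl mulrA.
Qed.

Lemma ideal_gen_sub (U W : {vspace E}) : (U <= W)%VS ->
    (forall x y, x \in W -> y * x \in W) -> (forall x y, x \in W -> x * y \in W) ->
  (ideal_gen U <= W)%VS.
Proof.
move=> UW Wl Wr; apply/prodvP=> x y xU _; apply: Wr.
move: x xU; apply/subvP/prodvP => z u _ uU; apply/Wl/(subvP UW) => //.
Qed.

Lemma mem_ideal_gen (U : {vspace E}) x y z : x \in U -> y * x * z \in ideal_gen U.
Proof. by move=> xU; rewrite !memv_mul ?memvf. Qed.

Lemma sub_ideal_gen (U : {vspace E}) : (U <= ideal_gen U)%VS.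
Proof. by apply/subvP=> x /(@mem_ideal_gen U x 1 1); rewrite mul1r mulr1. Qed.

Lemma ideal_gen_mull (U : {vspace E}) x y : x \in ideal_gen U -> y * x \in ideal_gen U.
Proof.
move=> hx; have : y * x \in (fullv * ideal_gen U)%VS by rewrite memv_mul ?memvf.
by rewrite /ideal_gen !prodvA; apply/subvP; do 2!apply: prodvSl; apply: subvf.
Qed.

Lemma ideal_gen_mulr (U : {vspace E}) x y : x \in ideal_gen U -> x * y \in ideal_gen U.
Proof.
move=> hx; have : x * y \in (ideal_gen U * fullv)%VS by rewrite memv_mul ?memvf.
by rewrite /ideal_gen -!prodvA; apply/subvP; do 2!apply: prodvSr; apply: subvf.
Qed.

End Quotients.

Section TakeSpan.
Variables (K : fieldType) (n : nat) (vs : seq (ext K n)).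
Local Notation E := (ext K n).
Local Notation H := (ext_homog K n).
Local Notation v := (nth 0 vs).
Hypothesis v1 : forall l, v l \in H 1.

Lemma lspan_take r : ideal_gen <<take r vs>>%VS = lspan v r.
Proof.
apply/eqP; rewrite eqEsubv; apply/andP; split.
  apply: ideal_gen_sub => [|x y|x y]; [|exact: lspan_mull|exact: lspan_mulr].
  apply/span_subvP=> x /(nthP 0)[l]; rewrite size_take_min leq_min => /andP[lr lv] <-.
  apply/mem_lspan; exists (fun k => (k == l)%:R).
  rewrite (bigD1 (Ordinal lr)) //= eqxx mul1r big1 ?addr0 ?nth_take // => k nk.
  by case: eqP => [e|]; rewrite ?mul0r //; case/eqP: nk; apply: val_inj.
apply/subvP=> x /mem_lspan[y ->]; apply: memv_suml => l _.
have [lv|vl] := ltnP l (size vs); last by rewrite nth_default // mulr0 mem0v.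
rewrite -[_ * _]mulr1; apply: mem_ideal_gen; apply: memv_span.
rewrite -(nth_take (n0 := r)) // mem_nth // size_take_min leq_min lv andbT.
exact: ltn_ord.
Qed.

Section Ideal.
Variable Q : {vspace E}.
Hypothesis QM : forall x y, x \in Q -> x * y \in Q.
Hypothesis QH : forall j x, x \in Q -> hcomp j x \in Q.

Definition Qtake (r : nat) : {vspace E} := (Q + ideal_gen <<take r vs>>)%VS.

Lemma QtakeP r x : x \in Qtake r <-> in_add_span v Q r x.
Proof. by rewrite /Qtake lspan_take; split=> /in_add_spanE. Qed.

Lemma QtakeS_homog r (j : int) :
  (amulr (v r) @: H (j - 1) + (H j :&: Qtake r) = H j :&: Qtake r.+1)%VS.
Proof.
apply/vspaceP=> x; apply/memv_addP/memv_capP => [[_ /memv_imgP[z hz ->] [w]]|].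
  rewrite memv_cap => /andP[hw /QtakeP[y hy]] ->; rewrite lfunE /=; split.
    by rewrite rpredD // -[j]subrK1 homog_mul.
  apply/QtakeP; exists (fun l => if l == r then z else y l).
  have e : \sum_(l < r) (if l == r :> nat then z else y l) * v l = \sum_(l < r) y l * v l.
    by apply: eq_bigr => l _; rewrite (ltn_eqF (ltn_ord l)).
  by rewrite big_ord_recr /= eqxx e [X in _ - X]addrC opprD addrACA subrr add0r.
case=> hx /QtakeP/(in_add_span_homog v1 QH hx)[y hy]; rewrite big_ord_recr /= => hQ.
exists (y r * v r); first by apply/memv_imgP; exists (y r) => //; rewrite lfunE.
exists (x - y r * v r); last by rewrite addrC subrK.
rewrite memv_cap rpredB //=; last by rewrite -[j]subrK1 homog_mul.
by apply/QtakeP; exists y; rewrite -addrA -opprD [y r * _ + _]addrC.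
Qed.

(** Annihilator numbers are determined by the Hilbert functions of two successive ideals. This is
    what allows the comparison of [J] with its initial ideal. *)
Lemma annih_dimE r (j : int) : annih_dim v Qtake r j =
  (\dim (H j) + \dim (H (j + 1) :&: Qtake r)
    - \dim (H (j + 1) :&: Qtake r.+1) - \dim (H j :&: Qtake r.+1))%N.
Proof.
rewrite /annih_dim; congr subn.
have -> : (H j :&: amulr (v r) @^-1: Qtake r =
           H j :&: amulr (v r) @^-1: (H (j + 1) :&: Qtake r))%VS.
  apply/vspaceP=> x; rewrite !memv_cap -!memv_preim memv_cap lfunE /=.
  by case: (boolP (x \in H j)) => //= hx; rewrite homog_mul.
have := dim_preim_cap (amulr (v r)) (H j) (H (j + 1) :&: Qtake r).
by have := QtakeS_homog r (j + 1); rewrite addrK1 => -> <-; rewrite addnK.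
Qed.

Lemma annihilator_dim_gens r (j : nat) : annihilator_dim vs Q r.+1 j%:Z = annih_dim v Qtake r j.
Proof.
rewrite /annihilator_dim /mult_homology_dim /quot_homology_dim /annih_dim /= -/(Qtake r).
have amE k x : x \in H k%:Z -> v r * x \in Qtake r = (x * v r \in Qtake r).
  by move=> hx; rewrite (homog_comm1 (v1 r) hx) rpredZsign.
have -> : (H j :&: amull (v r) @^-1: Qtake r = H j :&: amulr (v r) @^-1: Qtake r)%VS.
  apply/vspaceP=> x; rewrite !memv_cap -!memv_preim !lfunE /=.
  by case: (boolP (x \in H j)) => //= /amE.
congr (_ - \dim _)%N; rewrite -QtakeS_homog; congr (_ + _)%VS.
(* In degree 0 the preceding component is zero. In higher degrees left and right multiplication by
   [v r] differ by a sign. *)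
case: j {amE} => [|j].
  suff -> : H (0%:Z - 1) = 0%VS by rewrite !limg0.
  apply/eqP; rewrite -subv0; apply/subvP=> x /homog_lt0 -> //; exact: mem0v.
have -> : (j.+1%:Z - 1) = j%:Z by lia.
apply/eqP; rewrite eqEsubv; apply/andP; split; apply/subvP=> _ /memv_imgP[x hx ->].
  rewrite !lfunE /= (homog_comm1 (v1 r) hx) rpredZsign.
  by apply/memv_imgP; exists x => //; rewrite lfunE.
have := homog_comm1 (v1 r) hx; rewrite !lfunE /= => e.
rewrite -(rpredZsign _ j) -e.
by apply/memv_imgP; exists x => //; rewrite lfunE.
Qed.

End Ideal.
End TakeSpan.

(** * Generic ranks *)

Section Nonvanishing.
Variable K : fieldType.
Hypothesis infK : infinite_set [set: K]%classic.

Lemma poly_nonroot (p : {poly K}) : p != 0 -> exists t, p.[t] != 0.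
Proof.
move=> p0; have [B _ hB] := infinite_set_fset (size p) infK.
have : ~~ all (root p) (finmap.enum_fset B).
  by apply/negP=> /(max_poly_roots p0)/(_ (finmap.fset_uniq B)); rewrite ltnNge hB.
by case/allPn=> t _ nt; exists t.
Qed.

Lemma mpoly_nonroot n (p : {mpoly K[n]}) : p != 0 -> exists t : 'I_n -> K, p.@[t] != 0.
Proof.
elim: n p => [|n IH] p p0.
  exists (fun=> 0); apply: contraNneq p0 => h; apply/eqP/mpolyP => m; rewrite mcoeff0.
  have E (m' : 'X_{1..0}) : m' = 0%MM by apply/mnmP=> -[].
  rewrite (E m) -h mevalE [p in LHS]mpolyE linear_sum /=; apply: eq_bigr => m' _.
  by rewrite big_ord0 mulr1 mcoeffZ mcoeffX (E m') eqxx mulr1.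
have [m0 hm0] : exists m, p@_m != 0.
  apply/not_existsP => h; case/eqP: p0; apply/mpolyP => m; rewrite mcoeff0.
  by apply/eqP; move: (h m) => /negP; rewrite negbK.
(* The coefficient of the power of the last variable that occurs in the monomial [m0], hence
   nonzero. *)
pose q := (muni p)`_(m0 ord_max).
have q0 : q != 0.
  apply: contraNneq (hm0) => q0; rewrite -(mcoeff0 _ [multinom (m0 (widen_ord (leqnSn n) i)) | i < n]) -q0 /q muniE.
  rewrite coef_sum raddf_sum /= (bigD1_seq m0) ?msupp_uniq //=; last first.
    by rewrite mcoeff_msupp.
  rewrite coefZ coefXn eqxx mulr1 mcoeffZ mcoeffX eqxx mulr1 big1 ?addr0 // => m nm.
  rewrite coefZ coefXn; case: eqP => [e|]; last by rewrite mulr0 mcoeff0.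
  rewrite mulr1 mcoeffZ mcoeffX; case: eqP => [e'|]; last by rewrite mulr0.
  case/eqP: nm; apply/mnmP=> i; have [->//|ni] := eqVneq i ord_max.
  have lti : (i < n)%N by have := ltn_ord i; rewrite ltnS leq_eqVlt => /orP[/eqP h|//]; case/eqP: ni; apply: val_inj.
  have := congr1 (fun m : 'X_{1..n} => m (Ordinal lti)) e'; rewrite /= !mnmE.
  by have -> : widen_ord (leqnSn n) (Ordinal lti) = i by apply: val_inj.
have [t ht] := IH _ q0.
have : map_poly (meval t) (muni p) != 0.
  by apply: contraNneq ht => h; rewrite /q -coef_map h coef0.
case/poly_nonroot=> s hs.
exists (fun i => if insub (i : nat) : option 'I_n is Some j then t j else s).
apply: contraNneq hs => <-; apply/eqP; rewrite muniE rmorph_sum horner_sum mevalE.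
apply: eq_bigr => m _; rewrite /= map_polyZ hornerZ map_polyXn hornerXn /= mevalZ mevalX.
rewrite big_ord_recr /= insubF ?ltnn // -mulrA; congr (_ * (_ * _)).
apply: eq_bigr => i _; rewrite mnmE insubT /= => [|lti]; first exact: ltn_ord.
by congr (t _ ^+ _); apply: val_inj.
Qed.

Definition eval_mx N (t : 'I_N -> K) m n (A : 'M[{mpoly K[N]}]_(m, n)) : 'M[K]_(m, n) :=
  map_mx (meval t) A.

Lemma eval_mx_mul N (t : 'I_N -> K) m n p (A : 'M[{mpoly K[N]}]_(m, n)) (B : 'M_(n, p)) :
  eval_mx t (A *m B) = eval_mx t A *m eval_mx t B.
Proof. exact: map_mxM. Qed.

Lemma eval_mx_C N (t : 'I_N -> K) m n (A : 'M[K]_(m, n)) : eval_mx t (map_mx (@mpolyC N K) A) = A.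
Proof. by apply/matrixP=> i j; rewrite !mxE mevalC. Qed.

Lemma eval_mx_D N (t : 'I_N -> K) m n (A B : 'M[{mpoly K[N]}]_(m, n)) :
  eval_mx t (A + B) = eval_mx t A + eval_mx t B.
Proof. by apply/matrixP=> i j; rewrite !mxE mevalD. Qed.

Lemma eval_mx_Z N (t : 'I_N -> K) m n f (A : 'M[{mpoly K[N]}]_(m, n)) :
  eval_mx t (f *: A) = f.@[t] *: eval_mx t A.
Proof. by apply/matrixP=> i j; rewrite !mxE mevalM. Qed.

Lemma eval_mx_0 N (t : 'I_N -> K) m n : eval_mx t (0 : 'M_(m, n)) = 0.
Proof. by apply/matrixP=> i j; rewrite !mxE meval0. Qed.

Lemma eval_mx_det N (t : 'I_N -> K) n (A : 'M[{mpoly K[N]}]_n) : (\det A).@[t] = \det (eval_mx t A).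
Proof. by rewrite -det_map_mx. Qed.

Lemma eval_mx_adj N (t : 'I_N -> K) n (A : 'M[{mpoly K[N]}]_n) : eval_mx t (\adj A) = \adj (eval_mx t A).
Proof. exact: map_mx_adj. Qed.

Lemma eval_mx_inj N m n (A B : 'M[{mpoly K[N]}]_(m, n)) : (forall t, eval_mx t A = eval_mx t B) -> A = B.
Proof.
move=> h; apply/matrixP=> i j; apply/eqP; rewrite -subr_eq0; apply/negPn/negP.
case/mpoly_nonroot=> t; have := congr1 (fun M : 'M_(m, n) => M i j) (h t).
by rewrite !mxE mevalB => ->; rewrite subrr eqxx.
Qed.

Section RankPencil.
Variables (N s q : nat) (A : 'M[{mpoly K[N]}]_(s, q)) (t0 : 'I_N -> K).
Let A0 := eval_mx t0 A.
Let rho := \rank A0.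
Let L := invmx (col_ebase A0).
Let R := invmx (row_ebase A0).
Let C m n (M : 'M[K]_(m, n)) := map_mx (@mpolyC N K) M.
Let B := C L *m A *m C R.
(** [L] and [R] are constant base changes making [A] a partial identity at [t0]. [Hm] completes the
    first [rho] rows of [B] by rows of the identity; it is the identity at [t0], so its determinant
    is a nonzero polynomial, and these rows are independent wherever it does not vanish. *)
Let Hm : 'M[{mpoly K[N]}]_q := C (pid_mx rho) *m B + C (copid_mx rho).

Let rho_s : (rho <= s)%N. Proof. exact: rank_leq_row. Qed.
Let rho_q : (rho <= q)%N. Proof. exact: rank_leq_col. Qed.

Let eval_mxB t : eval_mx t B = L *m eval_mx t A *m R.
Proof. by rewrite !eval_mx_mul !eval_mx_C. Qed.

Let eval_mxH t : eval_mx t Hm = pid_mx rho *m eval_mx t B + copid_mx rho.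
Proof. by rewrite eval_mx_D eval_mx_mul !eval_mx_C. Qed.

Let B0 : eval_mx t0 B = pid_mx rho.
Proof.
rewrite eval_mxB -/A0 -[A0]mulmx_ebase !mulmxA mulVmx ?col_ebase_unit // mul1mx.
by rewrite -mulmxA mulmxV ?row_ebase_unit // mulmx1.
Qed.

Let H0 : eval_mx t0 Hm = 1%:M.
Proof.
by rewrite eval_mxH B0 pid_mx_id // /copid_mx addrC subrK.
Qed.

Let pidH t : (pid_mx rho : 'M[K]_q) *m eval_mx t Hm = (pid_mx rho : 'M[K]_(q, s)) *m eval_mx t B.
Proof.
by rewrite eval_mxH mulmxDr mul_pid_mx_copid // addr0 mulmxA pid_mx_id.
Qed.

Lemma rank_open : exists2 f : {mpoly K[N]}, f != 0 &
  forall t, f.@[t] != 0 -> (\rank (eval_mx t0 A) <= \rank (eval_mx t A))%N.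
Proof.
exists (\det Hm) => [|t].
  apply/eqP=> h; have := congr1 (meval t0) h; rewrite eval_mx_det H0 det1 meval0.
  by move/eqP; rewrite oner_eq0.
rewrite eval_mx_det -unitfE -[_ \is a _]/(eval_mx t Hm \in unitmx) => uH.
have : (\rank ((pid_mx rho : 'M[K]_q) *m eval_mx t Hm) = rho)%N.
  by rewrite mxrankMfree ?row_free_unit // rank_pid_mx.
rewrite pidH eval_mxB -/A0 -/rho => <-; apply: leq_trans (mxrankM_maxr _ _) _.
by apply: leq_trans (mxrankM_maxl _ _) _; apply: mxrankM_maxr.
Qed.

(* Cramer's rule produces the polynomial kernel vector: the first rho rows
   of B annihilate adj(H) (1 - pid) c by construction, and the others depend
   on them wherever det H does not vanish. *)
Lemma kernel_lift (c : 'cV[K]_q) :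
    (forall t, (\rank (eval_mx t A) <= \rank (eval_mx t0 A))%N) -> eval_mx t0 A *m c = 0 ->
  exists2 D : 'cV[{mpoly K[N]}]_q, A *m D = 0 & eval_mx t0 D = c.
Proof.
move=> hr Ac0; pose c' := row_ebase A0 *m c.
pose D' := \adj Hm *m C (copid_mx rho) *m C c'.
have pc' : pid_mx rho *m c' = 0 :> 'cV_q.
  have : pid_mx rho *m c' = 0 :> 'cV_s.
    rewrite -B0 eval_mxB /c' !mulmxA mulmxKV ?row_ebase_unit //.
    by rewrite -mulmxA Ac0 mulmx0.
  move/(congr1 (mulmx (pid_mx rho : 'M[K]_(q, s)))).
  by rewrite mulmx0 mulmxA pid_mx_id.
have D'0 : eval_mx t0 D' = c'.
  rewrite /D' !eval_mx_mul !eval_mx_C eval_mx_adj H0 adj1 mul1mx.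
  by rewrite /copid_mx mulmxBl mul1mx pc' subr0.
have BD t : \det (eval_mx t Hm) *: eval_mx t (B *m D') = 0.
  have [->|dH] := eqVneq (\det (eval_mx t Hm)) 0; first by rewrite scale0r.
  have uH : eval_mx t Hm \in unitmx by rewrite -unitfE in dH.
  have rp : (\rank ((pid_mx rho : 'M[K]_(q, s)) *m eval_mx t B) = rho)%N.
    by rewrite -pidH mxrankMfree ?row_free_unit // rank_pid_mx.
  have sub : (eval_mx t B <= (pid_mx rho : 'M[K]_(q, s)) *m eval_mx t B)%MS.
    rewrite -(geq_leqif (mxrank_leqif_sup _)) ?submxMl // rp eval_mxB.
    apply: leq_trans (mxrankM_maxl _ _) _; apply: leq_trans (mxrankM_maxr _ _) _.
    exact: hr.
  case/submxP: sub => M hM; rewrite eval_mx_mul hM -mulmxA -pidH.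
  have -> : pid_mx rho *m eval_mx t Hm *m eval_mx t D' = 0 :> 'cV_q.
    rewrite /D' !eval_mx_mul !eval_mx_C eval_mx_adj !mulmxA.
    rewrite -[_ *m eval_mx t Hm *m _]mulmxA mul_mx_adj mul_mx_scalar -!scalemxAl.
    by rewrite mul_pid_mx_copid // ?mul0mx ?scaler0 ?mul0mx.
  by rewrite mulmx0 scaler0.
have dH0 : \det Hm != 0.
  apply/eqP=> h; have := congr1 (meval t0) h; rewrite eval_mx_det H0 det1 meval0.
  by move/eqP; rewrite oner_eq0.
have BD0 : B *m D' = 0.
  have : \det Hm *: (B *m D') = 0.
    by apply: eval_mx_inj => t; rewrite eval_mx_Z eval_mx_det BD eval_mx_0.
  move=> h; apply/matrixP=> i j; move/matrixP/(_ i j): h; rewrite ![in X in X -> _]mxE.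
  by move/eqP; rewrite mulf_eq0 (negPf dH0) => /eqP; rewrite !mxE.
exists (C R *m D'); last first.
  by rewrite eval_mx_mul eval_mx_C D'0 /c' mulmxA mulVmx ?row_ebase_unit // mul1mx.
have : C (col_ebase A0) *m (B *m D') = 0 by rewrite BD0 mulmx0.
have CL : C (col_ebase A0) *m C L = 1%:M.
  by rewrite /C -(map_mxM (mpolyC N (R := K))) mulmxV ?col_ebase_unit // map_mx1.
by rewrite /B -!mulmxA (mulmxA (C (col_ebase A0)) (C L)) CL mul1mx.
Qed.

End RankPencil.

Lemma rank_generic N s q (A : 'M[{mpoly K[N]}]_(s, q)) : exists2 f : {mpoly K[N]}, f != 0 &
  forall t t', f.@[t] != 0 -> (\rank (eval_mx t' A) <= \rank (eval_mx t A))%N.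
Proof.
pose P k := `[< exists t, \rank (eval_mx t A) = k >].
have exP : exists k, P k by exists (\rank (eval_mx (fun=> 0) A)); apply/asboolP; exists (fun=> 0).
have bP k : P k -> (k <= s)%N by move/asboolP=> [t <-]; apply: rank_leq_row.
case: (ex_maxnP exP bP) => k /asboolP[t0 <-] hmax.
have [f f0 hf] := rank_open A t0.
by exists f => // t t' /hf; apply: leq_trans; apply: hmax; apply/asboolP; exists t'.
Qed.

End Nonvanishing.

(** * Generic properties of invertible matrices *)

Section Generic.
Import VectorInternalTheory.
Variables (K : fieldType) (n : nat).
Hypothesis infK : infinite_set [set: K]%classic.
Local Notation pol := {mpoly K[n * n]}.

Definition mx_pt (g : 'M[K]_n) : 'I_(n * n) -> K := fun k => mxvec g 0 k.

Lemma mx_pt_surj (t : 'I_(n * n) -> K) : exists g, mx_pt g =1 t.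
Proof.
exists (vec_mx (\row_k t k)) => k; by rewrite /mx_pt vec_mxK mxE.
Qed.

(** One nonzero polynomial suffices, since every non-empty open set contains a non-empty principal
    one. Finite conjunctions become products of polynomials. *)
Definition generic (P : 'M[K]_n -> Prop) : Prop :=
  exists2 f : pol, f != 0 & forall g, g \in unitmx -> f.@[mx_pt g] != 0 -> P g.

Definition Gmx : 'M[pol]_n := \matrix_(i, j) 'X_(mxvec_index i j).

Lemma eval_mx_Gmx g : eval_mx (mx_pt g) Gmx = g.
Proof. by apply/matrixP=> i j; rewrite !mxE mevalXU /mx_pt mxvecE. Qed.

Lemma detG_neq0 : \det Gmx != 0.
Proof.
apply/eqP=> h; have := congr1 (meval (mx_pt 1%:M)) h; rewrite eval_mx_det eval_mx_Gmx det1 meval0.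
by move/eqP; rewrite oner_eq0.
Qed.

Lemma generic_ex P : generic P -> exists2 g, g \in unitmx & P g.
Proof.
case=> f f0 hf; have fd0 : f * \det Gmx != 0 by rewrite mulf_neq0 ?detG_neq0.
have [t] := mpoly_nonroot infK fd0; have [g gt] := mx_pt_surj t.
rewrite -(meval_eq _ gt) mevalM mulf_eq0 negb_or eval_mx_det eval_mx_Gmx => /andP[fg dg].
have ug : g \in unitmx by rewrite unitmxE unitfE.
by exists g => //; apply: hf.
Qed.

Lemma genericI P P' : generic P -> generic P' -> generic (fun g => P g /\ P' g).
Proof.
move=> [f f0 hf] [f' f'0 hf']; exists (f * f'); first exact: mulf_neq0.
by move=> g ug; rewrite mevalM mulf_eq0 negb_or => /andP[fg f'g]; split; [apply: hf|apply: hf'].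
Qed.

Lemma generic_imp P P' : (forall g, g \in unitmx -> P g -> P' g) -> generic P -> generic P'.
Proof. by move=> PP' [f f0 hf]; exists f => // g ug /(hf g ug)/(PP' g ug). Qed.

Lemma generic_true : generic (fun=> True).
Proof. by exists 1 => //; apply: oner_neq0. Qed.

Lemma generic_all (I : finType) (P : I -> 'M[K]_n -> Prop) :
  (forall i, generic (P i)) -> generic (fun g => forall i, P i g).
Proof.
move=> hP; suff h (s : seq I) : generic (fun g => forall i, i \in s -> P i g).
  by apply: generic_imp (h (enum I)) => g _ Pg i; apply: Pg; rewrite mem_enum.
elim: s => [|i s IH]; first by apply: generic_imp generic_true.
apply: generic_imp (genericI (hP i) IH) => g _ [Pi Ps] j.
by rewrite inE => /orP[/eqP->|/Ps].
Qed.

Lemma generic_value_eq (T : choiceType) (x0 t : T) (f : 'M[K]_n -> T) :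
  generic (fun g => f g = t) -> generic_value x0 f = t.
Proof.
move=> gen; apply: xget_unique.
  case: gen (generic_ex gen) => p p0 hp [g0 ug0 _].
  exists [set g | g \in unitmx /\ p.@[mx_pt g] != 0]%classic; split.
  - exists [set p]%classic => g; split=> [[ug pg]|[ug [q -> pg]]]; split=> //.
    by exists p.
  - have pd0 : p * \det Gmx != 0 by rewrite mulf_neq0 ?detG_neq0.
    have [u] := mpoly_nonroot infK pd0; have [g gt] := mx_pt_surj u.
    rewrite -(meval_eq _ gt) mevalM mulf_eq0 negb_or eval_mx_det eval_mx_Gmx => /andP[fg dg].
    by exists g; split=> //; rewrite unitmxE unitfE.
  - by move=> g [ug pg]; apply: hp.
move=> t' [U [[S SE] [g1 /SE[ug1 [q Sq qg1]]] hU]].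
have gen' : generic (fun g => f g = t').
  exists q; first by apply: contraNneq qg1 => ->; rewrite meval0.
  by move=> g ug qg; apply: hU; apply/SE; split=> //; exists q.
by have [g _ [<- <-]] := generic_ex (genericI gen gen').
Qed.

(** By Cramer's rule the entries of the inverse are polynomials divided by the determinant;
    denominators are cleared. This makes generic properties stable under inversion of the matrix. *)
Lemma inv_poly (f : pol) : exists N : nat, exists f' : pol,
  forall g, g \in unitmx -> f'.@[mx_pt g] = \det g ^+ N * f.@[mx_pt (invmx g)].
Proof.
pose P (f : pol) := exists N : nat, exists f' : pol,
  forall g, g \in unitmx -> f'.@[mx_pt g] = \det g ^+ N * f.@[mx_pt (invmx g)].
have PD p q : P p -> P q -> P (p + q).
  move=> [N [p' hp]] [M [q' hq]]; exists (N + M)%N.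
  exists (\det Gmx ^+ M * p' + \det Gmx ^+ N * q') => g ug.
  rewrite !mevalD !mevalM !rmorphXn /= !eval_mx_det !eval_mx_Gmx hp // hq //.
  by rewrite exprD; ring.
have PM p q : P p -> P q -> P (p * q).
  move=> [N [p' hp]] [M [q' hq]]; exists (N + M)%N.
  exists (p' * q') => g ug; by rewrite !mevalM hp // hq // exprD; ring.
have PC c : P c%:MP by exists 0%N; exists c%:MP => g _; rewrite !mevalC expr0 mul1r.
have PX k : P 'X_k.
  case/mxvec_indexP: k => i j; exists 1%N; exists ((\adj Gmx) i j) => g ug.
  have -> : ((\adj Gmx) i j).@[mx_pt g] = (eval_mx (mx_pt g) (\adj Gmx)) i j by rewrite [RHS]mxE.
  rewrite eval_mx_adj eval_mx_Gmx mevalXU /mx_pt mxvecE expr1 /invmx ug [X in _ = _ * X]mxE mulrA mulfV ?mul1r //.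
  by rewrite -unitfE -unitmxE.
change (P f); rewrite [f]mpolyE; apply: (big_ind P _ PD) => [|m _]; first by rewrite -mpolyC0.
rewrite -mul_mpolyC; apply: (PM) => //; rewrite mpolyXE_id.
apply: (big_ind P _ PM) => [|k _]; first by rewrite -mpolyC1.
by elim: (m k) => [|e IH]; [rewrite expr0 -mpolyC1|rewrite exprS; apply: (PM)].
Qed.

Lemma generic_inv P : generic P -> generic (fun g => P (invmx g)).
Proof.
move=> gen; have [f f0 hf] := gen; have [N [f' hf']] := inv_poly f.
exists f' => [|g ug].
  have gf : generic (fun g => f.@[mx_pt g] != 0) by exists f.
  have [g ug fg] := generic_ex gf.
  apply: contraNneq fg => e; have := hf' (invmx g); rewrite unitmx_inv invmxK => /(_ ug).
  rewrite e meval0 => /esym/eqP; rewrite mulf_eq0 expf_eq0 => /orP[/andP[_]|//].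
  by rewrite det_inv invr_eq0 => /eqP d0; move: ug; rewrite unitmxE d0 unitr0.
by rewrite hf' // mulf_eq0 negb_or => /andP[_ h]; apply: hf h; rewrite unitmx_inv.
Qed.

Section PolyVec.
Variable V : vectType K.

Definition polyvec (F : 'M[K]_n -> V) : Prop :=
  exists s : seq (pol * V), forall g, F g = \sum_(x <- s) x.1.@[mx_pt g] *: x.2.

Lemma polyvec_cst w : polyvec (fun=> w).
Proof. by exists [:: (1, w)] => g; rewrite big_seq1 meval1 scale1r. Qed.

Lemma polyvec0 : polyvec (fun=> 0).
Proof. by exists [::] => g; rewrite big_nil. Qed.

Lemma polyvecD F G : polyvec F -> polyvec G -> polyvec (fun g => F g + G g).
Proof. by move=> [s hs] [t ht]; exists (s ++ t) => g; rewrite big_cat hs ht. Qed.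

Lemma polyvecZ f F : polyvec F -> polyvec (fun g => f.@[mx_pt g] *: F g).
Proof.
move=> [s hs]; exists [seq (f * x.1, x.2) | x <- s] => g.
rewrite big_map hs scaler_sumr; apply: eq_bigr => x _.
by rewrite /= mevalM scalerA.
Qed.

Lemma polyvec_sum (I : Type) (r : seq I) (P : pred I) (F : I -> 'M[K]_n -> V) :
  (forall i, P i -> polyvec (F i)) -> polyvec (fun g => \sum_(i <- r | P i) F i g).
Proof.
move=> hF; elim: r => [|i r [s hs]].
  by case: polyvec0 => s hs; exists s => g; rewrite big_nil.
case Pi: (P i).
  case: (polyvecD (hF i Pi) (ex_intro _ s hs)) => t ht.
  by exists t => g; rewrite big_cons Pi ht.
by exists s => g; rewrite big_cons Pi hs.
Qed.

Lemma polyvec_coord F : polyvec F -> forall k, exists f : pol, forall g, v2r (F g) 0 k = f.@[mx_pt g].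
Proof.
move=> [s hs] k; exists (\sum_(x <- s) v2r x.2 0 k *: x.1) => g.
rewrite hs linear_sum summxE raddf_sum /=; apply: eq_bigr => x _.
by rewrite linearZ mxE mevalZ mulrC.
Qed.

Lemma polyvec_eq F G : (forall g, F g = G g) -> polyvec F -> polyvec G.
Proof. by move=> FG [s hs]; exists s => g; rewrite -FG. Qed.

Lemma dim_span_mx (X : seq V) : \dim <<X>> = \rank (b2mx (in_tuple X)).
Proof. by rewrite [span]unlock /dimv mx2vsK. Qed.

Lemma span_pencil (I : finType) (X : I -> 'M[K]_n -> V) : (forall i, polyvec (X i)) ->
  exists m (A : 'M[pol]_(m, dim V)), forall g,
    \dim <<[seq X i g | i <- enum I]>> = \rank (eval_mx (mx_pt g) A).
Proof.
move=> hX; pose c i k := xget 0 [set f : pol | forall g, v2r (X i g) 0 k = f.@[mx_pt g]]%classic.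
have hc i k g : v2r (X i g) 0 k = (c i k).@[mx_pt g].
  have [f hf] := polyvec_coord (hX i) k.
  by rewrite /c; case: xgetP => [_ -> h //|] /(_ f).
exists #|I|, (\matrix_(i, k) c (enum_val i) k) => g.
rewrite dim_span_mx; set Y := [seq X i g | i <- enum I].
have sY : size Y = #|I| by rewrite size_map cardE.
have rk m m' (e : m = m') (M : 'M[K]_(m, dim V)) : \rank (castmx (e, erefl) M) = \rank M.
  by case: m' / e; rewrite castmx_id.
rewrite (_ : eval_mx _ _ = castmx (sY, erefl) (b2mx (in_tuple Y))) ?rk //.
apply/matrixP=> i k; rewrite castmxE !mxE cast_ord_id -hc (tnth_nth 0) /=.
congr (v2r _ 0 k); rewrite (nth_map (enum_val i)) -?cardE ?ltn_ord //.
by congr (X _ g); apply: enum_val_nth.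
Qed.

Lemma generic_span (I : finType) (X : I -> 'M[K]_n -> V) : (forall i, polyvec (X i)) ->
  exists D, generic (fun g => \dim <<[seq X i g | i <- enum I]>> = D) /\
    forall g, (\dim <<[seq X i g | i <- enum I]>> <= D)%N.
Proof.
move=> /span_pencil[m [A hA]]; have [f f0 hf] := rank_generic A.
have gf : generic (fun g => f.@[mx_pt g] != 0) by exists f.
have [g0 _ fg0] := generic_ex gf.
exists (\rank (eval_mx (mx_pt g0) A)); split=> [|g]; last by rewrite hA hf.
by exists f => // g _ fg; rewrite hA; apply/eqP; rewrite eqn_leq !hf.
Qed.

End PolyVec.

Lemma polyvec_lin (V W : vectType K) (L : 'Hom(V, W)) F :
  polyvec F -> polyvec (fun g => L (F g)).
Proof.
move=> [s hs]; exists [seq (x.1, L x.2) | x <- s] => g.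
by rewrite big_map hs linear_sum; apply: eq_bigr => x _; rewrite linearZ.
Qed.

(** The dimension is the rank of a polynomial matrix. The upper bound by the generic value holds for
    every matrix, singular ones included. *)
Lemma generic_img (V W : vectType K) (psi : 'M[K]_n -> 'Hom(V, W)) (U : {vspace V}) (B : {vspace W}) :
    (forall u, polyvec (fun g => psi g u)) ->
  exists D, generic (fun g => \dim (psi g @: U + B) = D) /\
    forall g, (\dim (psi g @: U + B) <= D)%N.
Proof.
move=> hpsi.
pose I : finType := ('I_(\dim U) + 'I_(\dim B))%type.
pose X (i : I) g :=
  match i with inl k => psi g (vbasis U)`_k | inr k => (vbasis B)`_k end.
have hX i : polyvec (X i) by case: i => k; [apply: hpsi|apply: polyvec_cst].
have [D hD] := generic_span hX; exists D.
suff e g : (psi g @: U + B = <<[seq X i g | i <- enum I]>>)%VS.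
  by case: hD => h1 h2; split=> [|g]; [apply: generic_imp h1 => g _ <-|rewrite e]; rewrite ?e.
rewrite -[X in (_ @: X + _)%VS](span_basis (vbasisP U)) limg_span.
rewrite -[X in (_ + X)%VS](span_basis (vbasisP B)) -span_cat.
apply: eq_span => w; rewrite mem_cat; apply/orP/mapP => [[]|[[k|k] _ ->]] /=.
- case/mapP=> u /(nthP 0)[k]; rewrite size_tuple => hk <- ->.
  by exists (inl (Ordinal hk) : I); rewrite ?mem_enum.
- case/(nthP 0)=> k; rewrite size_tuple => hk <-.
  by exists (inr (Ordinal hk) : I); rewrite ?mem_enum.
- by left; rewrite map_f // mem_nth // size_tuple.
- by right; rewrite mem_nth // size_tuple.
Qed.

Lemma polyvec_mul (F G : 'M[K]_n -> ext K n) : polyvec F -> polyvec G -> polyvec (fun g => F g * G g).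
Proof.
move=> [s hs] [t ht]; exists [seq (x.1 * y.1, x.2 * y.2) | x <- s, y <- t] => g.
rewrite big_allpairs_dep hs ht mulr_suml; apply: eq_bigr => x _.
rewrite mulr_sumr; apply: eq_bigr => y _.
by rewrite /= mevalM -scalerAl -scalerAr scalerA.
Qed.

Lemma polyvec_lin_form i : polyvec (fun g => lin_form g i).
Proof.
exists [seq ('X_(mxvec_index l i), ext_gen K l) | l <- index_enum 'I_n] => g.
by rewrite big_map; apply: eq_bigr => l _; rewrite /= mevalXU /mx_pt mxvecE.
Qed.

End Generic.

(** * Generic initial ideals *)

Section ExtMap.
Variables (K : fieldType) (n : nat).
Local Notation E := (ext K n).
Local Notation H := (ext_homog K n).
Implicit Types (g h : 'M[K]_n) (x y : E) (A B C F : {set 'I_n}) (b c i : 'I_n).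

Lemma prod_enum (f : 'I_n -> E) F : \prod_(i in F) f i = \prod_(i <- enum F) f i.
Proof.
rewrite -big_filter.
have -> : [seq i <- index_enum 'I_n | i \in F] = enum F.
  by rewrite [index_enum _]unlock; apply: eq_filter.
by [].
Qed.

Lemma enum_setU1_min b C : (forall c, c \in C -> (b < c)%N) -> enum (b |: C) = b :: enum C.
Proof.
move=> bC; have tr : transitive (fun i k : 'I_n => (i < k)%N).
  by move=> k i l; apply: ltn_trans.
have sorted_enum F : sorted (fun i k : 'I_n => (i < k)%N) (enum F).
  have -> : enum F = [seq i <- enum 'I_n | i \in F] by rewrite enumT; apply: eq_filter.
  apply: (sorted_filter tr).
  by have := iota_ltn_sorted 0 n; rewrite -val_enum_ord sorted_map.
apply: (@irr_sorted_eq _ _ tr) => //.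
- by move=> i; rewrite ltnn.
- rewrite /= (path_sortedE tr) sorted_enum andbT; apply/allP=> c.
  by rewrite mem_enum => /bC.
- by move=> i; rewrite inE !mem_enum !inE.
Qed.

Lemma prod_setU1_min (f : 'I_n -> E) b C : (forall c, c \in C -> (b < c)%N) ->
  \prod_(i in b |: C) f i = f b * \prod_(i in C) f i.
Proof. by move=> bC; rewrite !prod_enum enum_setU1_min // big_cons. Qed.

Lemma mon_setU1_min b C : (forall c, c \in C -> (b < c)%N) ->
  ext_mon K (b |: C) = ext_gen K b * ext_mon K C.
Proof. by move=> bC; rewrite !ext_mon_prod prod_setU1_min. Qed.

(** Monomials are products in increasing order, so adjoining a new smallest index is left
    multiplication by a generator, without a sign. *)
Lemma set_min_ind (P : {set 'I_n} -> Prop) : P set0 ->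
    (forall b C, (forall c, c \in C -> (b < c)%N) -> P C -> P (b |: C)) ->
  forall F, P F.
Proof.
move=> P0 PU F; have [m] := ubnP #|F|; elim: m F => // m IH F.
have [->//|[i0 i0F]] := set_0Vmem F; rewrite ltnS => Fm.
have [b bF bmin] := arg_minnP (fun i : 'I_n => i : nat) i0F.
have {}bF : b \in F by [].
rewrite -(setD1K bF); apply: PU => [c|].
  rewrite !inE => /andP[nc cF]; rewrite ltn_neqAle bmin // andbT.
  by rewrite eq_sym.
by apply: IH; rewrite (leq_trans _ Fm) // [X in (_ < X)%N](cardsD1 b) bF.
Qed.

Lemma lin_form_homog g i : lin_form g i \in H 1.
Proof. by apply: memv_suml => l _; apply/memvZ/gen_homog. Qed.

Lemma ext_mapE g x : ext_map g x = ext_map_fun g x.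
Proof. by rewrite lfunE. Qed.

Lemma ext_map_mon g F : ext_map g (ext_mon K F) = \prod_(i in F) lin_form g i.
Proof.
rewrite ext_mapE /ext_map_fun (bigD1 F) //= ffunE eqxx scale1r.
rewrite [X in _ + X]big1 ?addr0 // => A nA.
by rewrite ffunE (negPf nA) scale0r.
Qed.

Lemma ext_map_gen g i : ext_map g (ext_gen K i) = lin_form g i.
Proof. by rewrite ext_map_mon big_set1. Qed.

Lemma ext_map1 g : ext_map g 1 = 1.
Proof. by rewrite -[1 in LHS]/(ext_mon K set0) ext_map_mon big_set0. Qed.

Lemma ext_mon_supp B F : ext_mon K B F != 0 -> F = B.
Proof. by rewrite ffunE; have [//|_] := eqVneq F B; rewrite eqxx. Qed.

Lemma ext_map_genM_min g b x :
    (forall F, x F != 0 -> forall c, c \in F -> (b < c)%N) ->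
  ext_map g (ext_gen K b * x) = lin_form g b * ext_map g x.
Proof.
move=> hx; rewrite [x]ext_sumE mulr_sumr !linear_sum mulr_sumr /=.
apply: eq_bigr => F _; rewrite -scalerAr !linearZ /= -scalerAr.
have [->|/hx bF] := eqVneq (x F) 0; first by rewrite !scale0r.
by rewrite -mon_setU1_min // !ext_map_mon prod_setU1_min.
Qed.

(** Sorting [i] into the monomial uses only anticommutation and zero squares, which hold for the
    images [lin_form g i] as well. *)
Lemma ext_map_genM_mon g i B :
  ext_map g (ext_gen K i * ext_mon K B) = lin_form g i * ext_map g (ext_mon K B).
Proof.
elim/set_min_ind: B i => [|b B bB IH] i.
  by rewrite -[ext_mon K set0]/(1 : E) ext_map1 !mulr1 ext_map_gen.
rewrite mon_setU1_min // (ext_map_genM_min g (x := ext_mon K B)); last first.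
  by move=> F /ext_mon_supp->.
have [ib|bi|ib] := ltngtP (i : nat) b.
- rewrite -mon_setU1_min // (ext_map_genM_min g (x := ext_mon K _)); last first.
    move=> F /ext_mon_supp-> c.
    by rewrite in_setU1 => /orP[/eqP->//|/bB]; apply: ltn_trans.
  rewrite mon_setU1_min // (ext_map_genM_min g (x := ext_mon K B)) //.
  by move=> F /ext_mon_supp->.
- rewrite mulrA ext_genC mulNr -mulrA linearN /= ext_map_genM_min.
    rewrite IH !mulrA (homog1_anti (lin_form_homog g i) (lin_form_homog g b)).
    by rewrite mulNr.
  move=> F; rewrite ext_mon_mul; case: ifP => _; last by rewrite ffunE eqxx.
  rewrite ffunE scaler_eq0 negb_or => /andP[_ /ext_mon_supp->] c.
  by rewrite in_setU1 => /orP[/eqP->|/bB].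
- have -> : i = b by apply: val_inj.
  by rewrite !mulrA ext_gen_sqr (homog1_sqr (lin_form_homog g b)) !mul0r linear0.
Qed.

Lemma ext_map_genM g i x : ext_map g (ext_gen K i * x) = lin_form g i * ext_map g x.
Proof.
rewrite [x]ext_sumE mulr_sumr !linear_sum mulr_sumr /=; apply: eq_bigr => F _.
by rewrite -scalerAr !linearZ /= -scalerAr ext_map_genM_mon.
Qed.

Lemma ext_mapM g x y : ext_map g (x * y) = ext_map g x * ext_map g y.
Proof.
have monM A : ext_map g (ext_mon K A * y) = ext_map g (ext_mon K A) * ext_map g y.
  elim/set_min_ind: A => [|b A bA IH].
    by rewrite -[ext_mon K set0]/(1 : E) ext_map1 !mul1r.
  by rewrite mon_setU1_min // -mulrA !ext_map_genM IH mulrA.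
rewrite [x]ext_sumE mulr_suml !linear_sum mulr_suml /=; apply: eq_bigr => F _.
by rewrite -scalerAl !linearZ /= -scalerAl monM.
Qed.

Lemma ext_map_prod g (I : Type) (r : seq I) (P : pred I) (f : I -> E) :
  ext_map g (\prod_(i <- r | P i) f i) = \prod_(i <- r | P i) ext_map g (f i).
Proof. by apply: (big_morph _ (ext_mapM g) (ext_map1 g)). Qed.

Lemma ext_map_lin_form h g i : ext_map h (lin_form g i) = lin_form (h *m g) i.
Proof.
rewrite /lin_form linear_sum /=.
under eq_bigr do rewrite linearZ /= ext_map_gen /lin_form scaler_sumr.
rewrite exchange_big /=; apply: eq_bigr => l _; rewrite mxE scaler_suml.
by apply: eq_bigr => k _; rewrite scalerA mulrC.
Qed.

Lemma ext_map_comp h g x : ext_map h (ext_map g x) = ext_map (h *m g) x.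
Proof.
rewrite [x]ext_sumE !linear_sum /=; apply: eq_bigr => F _.
rewrite !linearZ /= !ext_map_mon ext_map_prod; congr (_ *: _).
by apply: eq_bigr => i _; rewrite ext_map_lin_form.
Qed.

Lemma lin_form1 i : lin_form (1%:M : 'M[K]_n) i = ext_gen K i.
Proof.
rewrite /lin_form (bigD1 i) //= mxE eqxx scale1r big1 ?addr0 // => l nl.
by rewrite mxE (negPf nl) scale0r.
Qed.

Lemma ext_map_1 x : ext_map 1%:M x = x.
Proof.
rewrite [x]ext_sumE linear_sum /=; apply: eq_bigr => F _.
rewrite linearZ /= ext_map_mon [in RHS]ext_mon_prod; congr (_ *: _).
by apply: eq_bigr => i _; rewrite lin_form1.
Qed.

Lemma ext_mapK g : g \in unitmx -> cancel (ext_map g) (ext_map (invmx g)).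
Proof. by move=> ug x; rewrite ext_map_comp mulVmx // ext_map_1. Qed.

Lemma ext_mapVK g : g \in unitmx -> cancel (ext_map (invmx g)) (ext_map g).
Proof. by move=> ug x; rewrite ext_map_comp mulmxV // ext_map_1. Qed.

Lemma ext_map_homog g j x : x \in H j -> ext_map g x \in H j.
Proof.
move=> /mem_homogP hx; rewrite [x]ext_sumE linear_sum; apply: memv_suml => F _.
have [->|/hx <-] := eqVneq (x F) 0; first by rewrite scale0r linear0 mem0v.
rewrite linearZ /= memvZ // ext_map_mon prod_enum cardE.
elim: (enum F) => [|i s IH] /=.
  rewrite big_nil; apply/mem_homogP=> A; rewrite ffunE.
  by have [->|_] := eqVneq A set0; rewrite ?cards0 ?eqxx.
rewrite big_cons; have -> : (size s).+1%:Z = 1 + (size s)%:Z by lia.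
exact: homog_mul (lin_form_homog _ _) IH.
Qed.

Definition gideal (J : {vspace E}) : Prop :=
  [/\ forall x y, x \in J -> x * y \in J, forall x y, x \in J -> y * x \in J &
      forall j x, x \in J -> hcomp j x \in J].

Lemma graded_idealP J : graded_ideal J -> gideal J.
Proof.
case/andP=> /andP[/prodvP hl /prodvP hr] /subvP hs; split=> [x y xJ|x y xJ|j x /hs].
- by apply: hr; rewrite ?memvf.
- by apply: hl; rewrite ?memvf.
case/memv_sumP=> f hf ->; rewrite linear_sum; apply: memv_suml => d _ /=.
have := hf d isT; rewrite memv_cap => /andP[fJ fd].
have [dj|dj] := eqVneq (d%:Z) j; first by rewrite -dj hcomp_id.
by rewrite (hcomp_neq fd dj) mem0v.
Qed.

Lemma gideal_map g J : g \in unitmx -> gideal J -> gideal (ext_map g @: J)%VS.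
Proof.
move=> ug [hr hl cartan_dim]; split=> [_ y /memv_imgP[x xJ ->]|_ y /memv_imgP[x xJ ->]|j _ /memv_imgP[x xJ ->]].
- by rewrite -[y](ext_mapVK ug) -ext_mapM memv_img ?hr.
- by rewrite -[y](ext_mapVK ug) -ext_mapM memv_img ?hl.
have -> : hcomp j (ext_map g x) = ext_map g (hcomp j x); last by rewrite memv_img ?cartan_dim.
rewrite [x in LHS]hcomp_sum !linear_sum /=.
have hp (d : int) : hcomp d (ext_map g (hcomp d x)) = ext_map g (hcomp d x).
  by rewrite hcomp_id // ext_map_homog // hcomp_homog.
have [/existsP[d /eqP hd]|/existsPn hn] := boolP [exists d : 'I_n.+1, d%:Z == j].
  rewrite (bigD1 d) //= hd hp big1 ?addr0 // => e ne.
  apply: (@hcomp_neq _ _ e%:Z); first exact/ext_map_homog/hcomp_homog.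
  by rewrite -hd eqz_nat; apply: contraNneq ne => /val_inj ->.
rewrite big1 => [|e _]; last first.
  by apply: (@hcomp_neq _ _ e%:Z); [exact/ext_map_homog/hcomp_homog|exact: hn].
suff -> : hcomp j x = 0 by rewrite linear0.
apply/ffunP=> F; rewrite !ffunE; case: eqP => // hF.
have hF' : (#|F| < n.+1)%N by rewrite ltnS -[leqRHS]card_ord max_card.
by have := hn (Ordinal hF'); rewrite hF eqxx.
Qed.

End ExtMap.

(** * Reverse lexicographic order and initial monomials *)

Section Rlex.
Variable n : nat.
Implicit Types (A B C D G : {set 'I_n}) (i k : 'I_n).

Lemma rlexP A B : reflect
  (exists i, [/\ i \in A, i \notin B & forall k, (k < i)%N -> (k \in A) = (k \in B)])
  (rlex_lt A B).
Proof.
apply: (iffP existsP) => [[i /andP[iAB /forallP h]]|[i [iA iB h]]].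
  move: iAB; rewrite inE => /andP[iB iA]; exists i; split=> // k ki.
  have := h k; rewrite !inE leqNgt ki implybF.
  by case: (k \in A); case: (k \in B).
exists i; rewrite inE iA iB /=; apply/forallP=> k; rewrite !inE.
by apply/implyP; apply: contraTT; rewrite -ltnNge => /h ->; case: (k \in B).
Qed.

Lemma rlex_irr A : rlex_lt A A = false.
Proof. by apply/negbTE/negP => /rlexP[i [iA]]; rewrite iA. Qed.

Lemma rlex_trans B A C : rlex_lt A B -> rlex_lt B C -> rlex_lt A C.
Proof.
move=> /rlexP[i [iA iB hi]] /rlexP[k [kB kC hk]]; apply/rlexP.
have [ik|ki|ik] := ltngtP (i : nat) k.
- exists i; split=> [//||l li]; first by rewrite -hk.
  by rewrite hi // hk // (ltn_trans li).
- exists k; split=> [|//|l lk]; first by rewrite hi.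
  by rewrite hi ?(ltn_trans lk) // hk.
- by move: kB; rewrite -(val_inj ik) (negPf iB).
Qed.

Lemma rlex_total A B : A != B -> rlex_lt A B || rlex_lt B A.
Proof.
move=> nAB; have [i0 hi0] : exists i, (i \in A) != (i \in B).
  apply/existsP; apply: contraNT nAB => /existsPn h; apply/eqP/setP=> i.
  by have := h i; rewrite negbK => /eqP.
have [i hi imin] := arg_minnP (P := fun i => (i \in A) != (i \in B)) (fun i : 'I_n => i : nat) hi0.
have eqk k : (k < i)%N -> (k \in A) = (k \in B).
  by move=> ki; apply/eqP/negPn/negP => /imin; rewrite leqNgt ki.
case iA: (i \in A) hi => hi.
  by apply/orP; left; apply/rlexP; exists i; split=> //; move: hi; case: (i \in B).
apply/orP; right; apply/rlexP; exists i; split=> [||k ki]; rewrite ?iA //.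
  by move: hi; case: (i \in B).
by rewrite eqk.
Qed.

Lemma rlex_max (S : {set {set 'I_n}}) B0 : B0 \in S ->
  exists2 B, B \in S & forall A, A \in S -> (A == B) || rlex_lt A B.
Proof.
move=> B0S.
pose c B := #|[set A in S | rlex_lt A B]|.
have [B BS hmax] := arg_maxnP (P := fun B => B \in S) c B0S.
exists B => // A AS; have [//|nAB] := eqVneq A B.
have /orP[->//|BA] := rlex_total nAB.
have : (c A <= c B)%N := hmax A AS; rewrite leqNgt => /negP[].
apply: proper_card; apply/properP; split.
  by apply/subsetP=> D; rewrite !inE => /andP[-> DB]; apply: rlex_trans DB BA.
by exists B; rewrite !inE ?BS ?BA // rlex_irr andbF.
Qed.

Lemma rlex_anti A B : rlex_lt A B -> rlex_lt B A -> False.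
Proof. by move=> AB BA; have := rlex_trans AB BA; rewrite rlex_irr. Qed.

(** The property singling out this order: monomials in the ideal of the first [k] variables are
    smaller than those outside it. *)
Lemma rlex_meet (k : nat) A B : (exists2 l, l \in A & (l < k)%N) ->
  (forall l, l \in B -> (k <= l)%N) -> rlex_lt A B.
Proof.
move=> [l0 l0A l0k] hB.
have [l lA lmin] := arg_minnP (P := fun l => l \in A) (fun i : 'I_n => i : nat) l0A.
have lk : (l < k)%N by apply: leq_ltn_trans l0k; apply: lmin.
apply/rlexP; exists l; split=> // [|m ml].
  by apply/negP=> /hB; rewrite leqNgt lk.
apply/idP/idP=> [/lmin|/hB]; first by rewrite leqNgt ml.
by rewrite leqNgt (ltn_trans ml lk).
Qed.

Lemma rlex_setU A B G : [disjoint A & G] -> [disjoint B & G] -> rlex_lt A B ->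
  rlex_lt (A :|: G) (B :|: G).
Proof.
move=> dA dB /rlexP[i [iA iB h]]; apply/rlexP; exists i; split.
- by rewrite inE iA.
- by rewrite inE negb_or iB (disjointFr dA iA).
- by move=> k /h e; rewrite !inE e.
Qed.

End Rlex.

Section InitialMonomials.
Variables (K : fieldType) (n : nat).
Local Notation E := (ext K n).
Local Notation H := (ext_homog K n).
Implicit Types (S M : {set {set 'I_n}}) (A B C F G : {set 'I_n}) (V : {vspace E}).

Definition mon_span S : {vspace E} := <<[seq ext_mon K B | B <- enum S]>>%VS.

Lemma mem_mon_spanP S (x : E) : reflect (forall F, x F != 0 -> F \in S) (x \in mon_span S).
Proof.
apply: (iffP idP) => [|hx].
  apply: (@span_ind K E _ (fun x => forall F, x F != 0 -> F \in S)).
  - by move=> F; rewrite ffunE eqxx.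
  - move=> a y z hy hz F; rewrite !ffunE.
    have [yF|/hy //] := eqVneq (y F) 0.
    have [zF|/hz //] := eqVneq (z F) 0.
    by rewrite yF zF scaler0 addr0 eqxx.
  - by move=> _ /mapP[A + ->] F /ext_mon_supp->; rewrite mem_enum.
rewrite (ext_sumE x); apply: memv_suml => F _.
have [->|/hx hF] := eqVneq (x F) 0; first by rewrite scale0r mem0v.
by apply/memvZ/memv_span/map_f; rewrite mem_enum.
Qed.

Definition init_set V : {set {set 'I_n}} :=
  [set B | `[< exists2 f, f \in V & is_init_mon f B >]].

Lemma init_setP V B : reflect (exists2 f, f \in V & is_init_mon f B) (B \in init_set V).
Proof. by rewrite inE; apply: asboolP. Qed.

Lemma init_monP (f : E) B : reflect (f B != 0 /\ forall A, f A != 0 -> (A == B) || rlex_lt A B)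
  (is_init_mon f B).
Proof.
apply: (iffP andP) => -[fB h]; split=> //.
  by move=> A; apply/implyP; move/forallP: h.
by apply/forallP=> A; apply/implyP/h.
Qed.

Lemma init_mon B : is_init_mon (ext_mon K B) B.
Proof.
by apply/init_monP; split=> [|A /ext_mon_supp->]; rewrite ?eqxx // ffunE eqxx oner_eq0.
Qed.

Lemma exists_init (f : E) : f != 0 -> exists B, is_init_mon f B.
Proof.
move=> f0; have [B0 hB0] : exists B, f B != 0.
  apply/existsP; apply: contraNT f0 => /existsPn h; apply/eqP/ffunP=> B; rewrite ffunE.
  by have := h B; rewrite negbK => /eqP.
have [|B] := @rlex_max n [set B | f B != 0] B0; first by rewrite inE.
rewrite inE => fB hB; exists B; apply/init_monP; split=> // A fA.
by apply: hB; rewrite inE.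
Qed.

Lemma tri_free S (f : {set 'I_n} -> E) : (forall B, B \in S -> is_init_mon (f B) B) ->
  free [seq f B | B <- enum S].
Proof.
move=> hf; set X := [seq f B | B <- enum S].
have sX : size X = #|S| by rewrite size_map cardE.
rewrite -[X]/(val (in_tuple X)); apply/freeP => k k0.
pose c B : K := if @insub nat (fun i => (i < size X)%N) _ (index B (enum S)) is Some i then k i else 0.
have kc (i : 'I_(size X)) : k i = c (nth set0 (enum S) i).
  rewrite /c index_uniq ?enum_uniq -?cardE -?sX ?ltn_ord //; by rewrite valK.
have sum0 : \sum_(B in S) c B *: f B = 0.
  rewrite -[RHS]k0 -big_enum /= (big_nth set0) big_mkord -cardE.
  rewrite -sX; apply: eq_bigr => i _; rewrite kc; congr (_ *: _).
  by rewrite (nth_map set0) // -cardE -sX ltn_ord.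
suff c0 B : B \in S -> c B = 0.
  move=> i; rewrite kc c0 // -mem_enum mem_nth // -cardE -sX ltn_ord //.
move=> BS; apply/eqP/negPn/negP => cB.
have [|D] := @rlex_max n [set B in S | c B != 0] B; first by rewrite inE BS.
rewrite inE => /andP[DS cD] hD.
have := congr1 (fun x : E => x D) sum0; rewrite sum_ffunE (bigD1 D) //= big1 => [|A /andP[AS nAD]].
  rewrite addr0 !ffunE => /eqP; rewrite scaler_eq0 (negPf cD) /=.
  by have /init_monP[/negPf-> _] := hf D DS.
rewrite ffunE; have [->|cA] := eqVneq (c A) 0; first by rewrite scale0r.
have [->|fA] := eqVneq (f A D) 0; first by rewrite scaler0.
have /init_monP[_ /(_ D fA)] := hf A AS; rewrite eq_sym (negPf nAD) /= => DA.
have := hD A; rewrite inE AS cA (negPf nAD) => /(_ isT) AD.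
by case: (rlex_anti DA AD).
Qed.

Lemma dim_mon_span S : \dim (mon_span S) = #|S|.
Proof.
have fr : free [seq ext_mon K B | B <- enum S] by apply: tri_free => B _; apply: init_mon.
by rewrite /mon_span (eqnP fr) size_map -cardE.
Qed.

Definition mon_proj S (x : E) : E := [ffun F : {set 'I_n} => (if F \in S then x F else 0) : K^o].
Lemma mon_proj_is_linear S : linear (mon_proj S).
Proof.
move=> a x y; apply/ffunP=> F; rewrite !ffunE; case: ifP => // _.
by rewrite scaler0 addr0.
Qed.
HB.instance Definition _ S := GRing.isLinear.Build K E E _ (mon_proj S) (mon_proj_is_linear S).

(** Projection to the initial monomials is injective on [V], and elements with distinct initial
    monomials are independent. *)
Lemma dim_init_set V : \dim V = #|init_set V|.
Proof.
apply/eqP; rewrite eqn_leq; apply/andP; split.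
  have inj : (V :&: lker (linfun (mon_proj (init_set V))) = 0)%VS.
    apply/eqP; rewrite -subv0; apply/subvP=> f; rewrite memv_cap memv_ker lfunE /= memv0.
    case/andP=> fV /eqP e; apply/negPn/negP => /exists_init[B iB].
    have BV : B \in init_set V by apply/init_setP; exists f.
    have := congr1 (fun x : E => x B) e; rewrite !ffunE BV.
    by case/init_monP: iB => /eqP.
  rewrite -(limg_dim_eq inj) -dim_mon_span; apply/dimvS/subvP=> _ /memv_imgP[x _ ->].
  apply/mem_mon_spanP=> F; rewrite lfunE ffunE; by case: ifP => //; rewrite eqxx.
have hf B : exists f, B \in init_set V -> f \in V /\ is_init_mon f B.
  by case: (boolP (B \in init_set V)) => [/init_setP[f]|]; [exists f|exists 0].
have [f {}hf] := choice hf.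
have fr : free [seq f B | B <- enum (init_set V)] by apply: tri_free => B /hf[].
rewrite cardE -(size_map f) -(eqnP fr); apply/dimvS/span_subvP=> _ /mapP[B + ->].
by rewrite mem_enum => /hf[].
Qed.

(** Being an initial monomial becomes a jump of dimensions, hence a condition on ranks that is
    constant for generic coordinates. *)
Lemma init_set_dim V B : (B \in init_set V) =
  (\dim (V :&: mon_span [set A | rlex_lt A B]) < \dim (V :&: mon_span [set A | (A == B) || rlex_lt A B]))%N.
Proof.
set V1 := (V :&: _)%VS; set V2 := (_ :&: _)%VS.
have s12 : (V1 <= V2)%VS.
  apply/capvS => //; apply/subvP=> x /mem_mon_spanP h; apply/mem_mon_spanP=> F /h.
  by rewrite !inE => ->; rewrite orbT.
rewrite ltn_neqAle dimvS // andbT (dimv_leqif_sup s12).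
apply/init_setP/subvPn => [[f fV /init_monP[fB h]]|[f]].
  exists f; rewrite /V2 /V1 !memv_cap fV /=.
    by apply/mem_mon_spanP=> F /h; rewrite inE.
  by apply/negP=> /mem_mon_spanP/(_ B fB); rewrite inE rlex_irr.
rewrite /V2 /V1 !memv_cap => /andP[fV /mem_mon_spanP h]; rewrite fV /=.
move=> nf; exists f => //; apply/init_monP; split=> [|A /h]; last by rewrite inE.
apply: contraNneq nf => fB0; apply/mem_mon_spanP=> F hF; have := h F hF; rewrite !inE.
by case/orP=> // /eqP FB; rewrite FB fB0 eqxx in hF.
Qed.

Definition init_mons (I : {vspace E}) : {set {set 'I_n}} :=
  [set B : {set 'I_n} | B \in init_set (I :&: H #|B|)].

Lemma initial_idealE I : initial_ideal I = ideal_gen (mon_span (init_mons I)).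
Proof.
rewrite /initial_ideal /mon_span; congr ideal_gen; apply: eq_span => x.
apply/imageP/mapP => -[B].
  by rewrite inE => hB ->; exists B => //; rewrite mem_enum inE inE.
by rewrite mem_enum inE inE => hB ->; exists B.
Qed.

Lemma mul_mon_supp (f : E) G D : (f * ext_mon K G) D != 0 -> G \subset D /\ f (D :\: G) != 0.
Proof.
rewrite ext_mulE => h.
have [A /andP[AD]] : exists A : {set 'I_n}, (A \subset D) && ((f A != 0) && (D :\: A == G)).
  apply/existsP; apply: contraNT h => /existsPn h; rewrite big1 // => A AD.
  have := h A; rewrite AD /= negb_and negbK => /orP[/eqP->|nG]; first by rewrite mulr0 mul0r.
  by rewrite ffunE (negPf nG) mulr0.
case/andP=> fA /eqP <-; rewrite subsetDl; split=> //.
by rewrite setDDr setDv set0U (setIidPr AD).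
Qed.

Lemma mul_mon_neq0 (f : E) G B : [disjoint B & G] -> f B != 0 -> (f * ext_mon K G) (B :|: G) != 0.
Proof.
move=> dBG fB; rewrite ext_mulE (bigD1 B) ?subsetUl //= big1 ?addr0.
  have -> : (B :|: G) :\: B = G.
    by rewrite setDUl setDv set0U; apply/setDidPl; rewrite disjoint_sym.
  by rewrite ffunE eqxx mulr1 mulf_neq0 // signr_eq0.
move=> A /andP[AD nAB]; rewrite ffunE; case: eqP => [e|]; last by rewrite mulr0.
case/eqP: nAB; have -> : A = (B :|: G) :\: ((B :|: G) :\: A).
  by rewrite setDDr setDv set0U; apply/esym/setIidPr.
by rewrite e setDUl setDv setU0; apply/setDidPl.
Qed.

Lemma mon_homog G : ext_mon K G \in H #|G|.
Proof. by apply/mem_homogP=> F /ext_mon_supp->. Qed.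

Section Ideal.
Variable I : {vspace E}.
Hypothesis gI : gideal I.

Lemma init_mons_up B C : B \subset C -> B \in init_mons I -> C \in init_mons I.
Proof.
move=> BC; rewrite !inE => /asboolP[f]; rewrite memv_cap => /andP[fI fH] /init_monP[fB h].
have [hr _ _] := gI.
pose G := C :\: B.
have CE : C = B :|: G by rewrite /G setDE setUIr setUCr setIT; apply/esym/setUidPr.
have dBG : [disjoint B & G] by rewrite /G -setI_eq0 setIDA setIC -setIDA setDv setI0.
apply/asboolP; exists (f * ext_mon K G).
  rewrite memv_cap hr //=; have -> : #|C|%:Z = #|B|%:Z + #|G|%:Z.
    by rewrite CE cardsU (disjoint_setI0 dBG) cards0 subn0 PoszD.
  by apply: homog_mul => //; apply: mon_homog.
apply/init_monP; split=> [|D /mul_mon_supp[GD /h]]; first by rewrite CE mul_mon_neq0.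
have DE : D = (D :\: G) :|: G.
  by rewrite setUC setDE setUIr setUCr setIT; apply/esym/setUidPr.
case/orP=> [/eqP e|lt]; first by rewrite DE e CE eqxx.
apply/orP; right; rewrite DE CE; apply: rlex_setU => //.
by rewrite -setI_eq0 setIDAC setIC setDIl setDv set0I.
Qed.

Lemma mon_span_ideal S x y : (forall B C, B \subset C -> B \in S -> C \in S) ->
  x \in mon_span S -> x * y \in mon_span S /\ y * x \in mon_span S.
Proof.
move=> up /mem_mon_spanP hx; split; apply/mem_mon_spanP=> C; rewrite ext_mulE => h.
  have [A /andP[AC xA]] : exists A : {set 'I_n}, (A \subset C) && (x A != 0).
    apply/existsP; apply: contraNT h => /existsPn h; rewrite big1 // => A AC.
    by have := h A; rewrite AC negbK => /eqP->; rewrite mulr0 mul0r.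
  by apply: up AC _; apply: hx.
have [A /andP[AC xA]] : exists A : {set 'I_n}, (A \subset C) && (x (C :\: A) != 0).
  apply/existsP; apply: contraNT h => /existsPn h; rewrite big1 // => A AC.
  by have := h A; rewrite AC negbK => /eqP->; rewrite mulr0.
by apply: (up (C :\: A)) (subsetDl _ _) _; apply: hx.
Qed.

Lemma initial_idealE_mon : initial_ideal I = mon_span (init_mons I).
Proof.
rewrite initial_idealE; apply/eqP; rewrite eqEsubv sub_ideal_gen andbT.
by apply: ideal_gen_sub => // x y xS; case: (mon_span_ideal y init_mons_up xS).
Qed.

Lemma gideal_initial : gideal (initial_ideal I).
Proof.
rewrite initial_idealE_mon; split=> [x y|x y|j x].
- by move=> xS; case: (mon_span_ideal y init_mons_up xS).
- by move=> xS; case: (mon_span_ideal y init_mons_up xS).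
move/mem_mon_spanP=> hx; apply/mem_mon_spanP=> F; rewrite ffunE.
by case: ifP => [_ /hx//|]; rewrite eqxx.
Qed.

Definition meets (k : nat) : {set {set 'I_n}} := [set B : {set 'I_n} | [exists l in B, (l < k)%N]].

Lemma meetsP k B : reflect (exists2 l, l \in B & (l < k)%N) (B \in meets k).
Proof. by rewrite inE; apply: exists_inP. Qed.

(** If the initial monomial of [a + m], with [m] in the ideal of the first [k] variables, avoids
    these variables, it is also that of [a], since by [rlex_meet] the terms meeting them are
    smaller. So the initial monomials of the right-hand space span the left-hand one. *)
Lemma dim_initial_meets (j : nat) k :
  \dim (H j :&: (initial_ideal I + mon_span (meets k))) =
  \dim (H j :&: (I + mon_span (meets k))).
Proof.
have [_ _ cartan_dim] := gI.
set V := (H j :&: (I + _))%VS.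
suff -> : (H j :&: (initial_ideal I + mon_span (meets k)) = mon_span (init_set V))%VS.
  by rewrite dim_mon_span -dim_init_set.
have IV B : B \in init_set V = (#|B| == j) && ((B \in init_mons I) || (B \in meets k)).
  apply/init_setP/andP=> [[f]|[/eqP Bj /orP[]]].
  - rewrite memv_cap => /andP[fj /memv_addP[a aI [m mM fE]]] /init_monP[fB h].
    have Bj : #|B| = j by have /mem_homogP/(_ B fB)[] := fj.
    split; first exact/eqP.
    have [//|nB] := boolP (B \in meets k); rewrite ?orbT // orbF.
    pose m' := hcomp j%:Z m.
    have mM' : m' \in mon_span (meets k).
      apply/mem_mon_spanP=> F; rewrite ffunE; case: ifP => [_|]; last by rewrite eqxx.
      by move/mem_mon_spanP: mM => /(_ F).
    have fE' : f = hcomp j%:Z a + m' by rewrite /m' -linearD /= -fE hcomp_id.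
    have m'0 A : A \notin meets k -> m' A = 0.
      by move=> nA; apply/eqP/negPn/negP => hA; move/mem_mon_spanP: mM' => /(_ A hA); rewrite (negPf nA).
    rewrite inE; apply/init_setP; exists (hcomp j%:Z a).
      by rewrite memv_cap cartan_dim // Bj hcomp_homog.
    apply/init_monP; split.
      by move: fB; rewrite fE' ffunE (m'0 B nB) addr0.
    move=> A hA; have [AM|nA] := boolP (A \in meets k).
      apply/orP; right; apply: (rlex_meet (k := k)); first exact/meetsP.
      move=> l lB; rewrite leqNgt; apply: contraNN nB => lk; apply/meetsP; by exists l.
    by apply: h; rewrite fE' ffunE (m'0 A nA) addr0.
  - rewrite inE => /init_setP[f]; rewrite memv_cap Bj => /andP[fI fj] iB; exists f => //.
    by rewrite memv_cap fj (subvP (addvSl _ _)).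
  - move=> BM; exists (ext_mon K B); last exact: init_mon.
    rewrite memv_cap -Bj mon_homog (subvP (addvSr _ _)) //.
    by apply/mem_mon_spanP=> F /ext_mon_supp->.
rewrite initial_idealE_mon; apply/vspaceP=> x; rewrite memv_cap.
apply/andP/mem_mon_spanP => [[/mem_homogP hj /memv_addP[a /mem_mon_spanP ha [m /mem_mon_spanP hm xE]]] F hF|hx].
  rewrite IV; apply/andP; split.
    by have [->] := hj F hF.
  move: hF; rewrite xE; have [a0|/ha->//] := eqVneq (a F) 0.
  by rewrite ffunE a0 add0r => /hm->; rewrite orbT.
split; first by apply/mem_homogP=> F /hx; rewrite IV => /andP[/eqP-> _].
rewrite [x]ext_sumE; apply: memv_suml => F _.
have [->|/hx] := eqVneq (x F) 0; first by rewrite scale0r mem0v.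
rewrite IV => /andP[_ /orP[hF|hF]]; apply: memvZ.
  by apply: (subvP (addvSl _ _)); apply/mem_mon_spanP=> A /ext_mon_supp->.
by apply: (subvP (addvSr _ _)); apply/mem_mon_spanP=> A /ext_mon_supp->.
Qed.

End Ideal.

Definition gens (g : 'M[K]_n) : seq E := [seq lin_form g l | l <- enum 'I_n].

Lemma gens_nth g (l : 'I_n) : (gens g)`_l = lin_form g l.
Proof. by rewrite (nth_map l) ?nth_ord_enum // size_enum_ord. Qed.

Lemma gens_out g l : (n <= l)%N -> (gens g)`_l = 0.
Proof. by move=> nl; rewrite nth_default // size_map size_enum_ord. Qed.

Lemma gens1 g l : (gens g)`_l \in H 1.
Proof.
have [ln|nl] := ltnP l n; last by rewrite gens_out // mem0v.
by rewrite -[l]/(val (Ordinal ln)) gens_nth lin_form_homog.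
Qed.

Lemma ext_map_gens h g l : ext_map h (gens g)`_l = (gens (h *m g))`_l.
Proof.
have [ln|nl] := ltnP l n; last by rewrite !gens_out // linear0.
by rewrite -[l]/(val (Ordinal ln)) !gens_nth ext_map_lin_form.
Qed.

Lemma std_gens : [seq ext_gen K i | i <- enum 'I_n] = gens 1%:M.
Proof. by apply: eq_map => i; rewrite lin_form1. Qed.

Lemma lspan_std k : lspan (nth 0 (gens 1%:M)) k = mon_span (meets k).
Proof.
apply/vspaceP=> x; apply/idP/mem_mon_spanP=> [/mem_lspan[y ->] F|hx].
  rewrite sum_ffunE => h; apply/meetsP.
  have [l hl] : exists l : 'I_k, (y l * (gens 1%:M)`_l) F != 0.
    apply/existsP; apply: contraNT h => /existsPn h; rewrite big1 // => l _.
    by have := h l; rewrite negbK => /eqP.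
  have [ln|nl] := ltnP l n; last by rewrite gens_out // mulr0 ffunE eqxx in hl.
  move: hl; rewrite -[l : nat]/(val (Ordinal ln)) gens_nth lin_form1.
  move/mul_mon_supp=> [lF _]; exists (Ordinal ln); last exact: ltn_ord l.
  by apply: (subsetP lF); rewrite inE.
rewrite [x]ext_sumE; apply: memv_suml => F _.
have [->|/hx] := eqVneq (x F) 0; first by rewrite scale0r mem0v.
case/meetsP=> l lF lk; apply: memvZ; apply/mem_lspan.
have e : ext_mon K (F :\ l) * ext_gen K l = (-1) ^+ ext_inv (F :\ l) [set l] *: ext_mon K F.
  by rewrite ext_mon_mul disjoint_sym disjoints1 !inE eqxx /= setUC setD1K.
exists (fun m => if m == l :> nat then (-1) ^+ ext_inv (F :\ l) [set l] *: ext_mon K (F :\ l) else 0).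
rewrite (bigD1 (Ordinal lk)) //= eqxx big1 ?addr0 => [|m nm].
  by rewrite gens_nth lin_form1 -scalerAl e scalerA -exprD -signr_odd addnn odd_double scale1r.
by case: eqP => [ml|]; rewrite ?mul0r //; case/eqP: nm; apply: val_inj.
Qed.

Lemma dim_map_le g (J : {vspace E}) v w k j : g \in unitmx ->
    (forall l, ext_map g (v l) = w l) ->
  (\dim (H j :&: (J + lspan v k)) <= \dim (H j :&: (ext_map g @: J + lspan w k)))%N.
Proof.
move=> ug vw; rewrite -(@limg_dim_eq _ _ _ (ext_map g) (H j :&: (J + lspan v k))); last first.
  apply/eqP; rewrite -subv0; apply/subvP=> x; rewrite memv_cap memv_ker memv0 => /andP[_].
  by move/eqP/(congr1 (ext_map (invmx g))); rewrite ext_mapK // linear0 => ->.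
apply/dimvS/subvP=> _ /memv_imgP[x + ->]; rewrite memv_cap => /andP[xj].
case/memv_addP=> a aJ [b /mem_lspan[y bE] xE]; rewrite memv_cap ext_map_homog //= xE linearD.
rewrite memv_add ?memv_img //; apply/mem_lspan; exists (fun l => ext_map g (y l)).
by rewrite bE linear_sum; apply: eq_bigr => l _ /=; rewrite ext_mapM vw.
Qed.

Lemma dim_map g (J : {vspace E}) k j : g \in unitmx ->
  \dim (H j :&: (ext_map (invmx g) @: J + lspan (nth 0 (gens 1%:M)) k)) =
  \dim (H j :&: (J + lspan (nth 0 (gens g)) k)).
Proof.
move=> ug; apply/eqP; rewrite eqn_leq; apply/andP; split.
  have JE : (ext_map g @: (ext_map (invmx g) @: J) = J)%VS.
    apply/vspaceP=> x; apply/memv_imgP/idP => [[_ /memv_imgP[y yJ ->] ->]|xJ].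
      by rewrite ext_mapVK.
    by exists (ext_map (invmx g) x); rewrite ?memv_img // ext_mapVK.
  rewrite -[X in (_ <= \dim (_ :&: (X + _)))%N]JE.
  by apply: dim_map_le => // l; rewrite ext_map_gens mulmx1.
apply: dim_map_le => [|l]; first by rewrite unitmx_inv.
by rewrite ext_map_gens mulVmx.
Qed.

Section Gin.
Hypothesis infK : infinite_set [set: K]%classic.

Lemma polyvec_ext_map (u : E) : polyvec (fun g => ext_map g u).
Proof.
apply: (polyvec_eq (F := fun g => \sum_F (u F : K) *: \prod_(i <- enum F) lin_form g i)).
  by move=> g; rewrite ext_mapE; apply: eq_bigr => F _; rewrite prod_enum.
apply: polyvec_sum => F _.
apply: (polyvec_eq (F := fun g => ((u F : K)%:MP_[n * n]).@[mx_pt g] *: \prod_(i <- enum F) lin_form g i)).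
  by move=> g; rewrite mevalC.
apply: polyvecZ; elim: (enum F) => [|i s IH].
  by apply: (polyvec_eq (F := fun=> 1)); [move=> g; rewrite big_nil|apply: polyvec_cst].
apply: (polyvec_eq (F := fun g => lin_form g i * \prod_(i <- s) lin_form g i)).
  by move=> g; rewrite big_cons.
by apply: polyvec_mul => //; apply: polyvec_lin_form.
Qed.

Lemma map_homog_cap g (J : {vspace E}) (j : int) : g \in unitmx ->
  ((ext_map g @: J) :&: H j = ext_map g @: (J :&: H j))%VS.
Proof.
move=> ug; apply/vspaceP=> x; rewrite memv_cap; apply/andP/memv_imgP.
  case=> /memv_imgP[y yJ ->] hj; exists y => //; rewrite memv_cap yJ.
  by rewrite -(ext_mapK ug y) ext_map_homog.
case=> y; rewrite memv_cap => /andP[yJ yj] ->.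
by rewrite memv_img // ext_map_homog.
Qed.

(** For each of the finitely many [B], membership compares dimensions that are generically
    constant. *)
Lemma gin_generic (J : {vspace E}) :
  generic (fun h => gin J = initial_ideal (ext_map h @: J)%VS).
Proof.
have hB B : exists b, generic (fun h => (B \in init_mons (ext_map h @: J)%VS) = b).
  set U := (J :&: H #|B|)%VS.
  have [D1 [h1 _]] := generic_img infK U (mon_span [set A | rlex_lt A B]) polyvec_ext_map.
  have [D2 [h2 _]] := generic_img infK U (mon_span [set A | (A == B) || rlex_lt A B]) polyvec_ext_map.
  exists ((\dim U + #|[set A | rlex_lt A B]| - D1 < \dim U + #|[set A | (A == B) || rlex_lt A B]| - D2)%N).
  apply: generic_imp (genericI h1 h2) => h uh [e1 e2].
  rewrite inE init_set_dim map_homog_cap // -/U.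
  have dU : \dim (ext_map h @: U) = \dim U.
    apply: limg_dim_eq; apply/eqP; rewrite -subv0; apply/subvP=> x; rewrite memv_cap memv_ker memv0 => /andP[_].
    by move/eqP/(congr1 (ext_map (invmx h))); rewrite ext_mapK // linear0 => ->.
  have := dimv_sum_cap (ext_map h @: U) (mon_span [set A | rlex_lt A B]).
  have := dimv_sum_cap (ext_map h @: U) (mon_span [set A | (A == B) || rlex_lt A B]).
  rewrite e1 e2 !dim_mon_span dU => q1 q2.
  by congr (_ < _)%N; [rewrite -q2 addKn|rewrite -q1 addKn].
have [b hb] := choice hB.
have gen : generic (fun h => initial_ideal (ext_map h @: J)%VS = ideal_gen (mon_span [set B | b B])).
  apply: generic_imp (generic_all hb) => h _ e; rewrite initial_idealE.
  by congr (ideal_gen (mon_span _)); apply/setP=> B; rewrite e [RHS]inE.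
have e : gin J = ideal_gen (mon_span [set B | b B]) by apply: generic_value_eq.
by apply: generic_imp gen => h _ ->.
Qed.

Lemma alpha_generic (J : {vspace E}) : gideal J ->
  generic (fun g => forall k (j : nat), alpha J k.+1 j%:Z = annih_dim (nth 0 (gens g)) (Qtake (gens g) J) k j).
Proof.
(* The coordinate change carrying the forms [gens g] to the variables is the inverse of [g]. *)
move=> gJ; apply: generic_imp (generic_inv infK (gin_generic J)) => g ug eg k j.
have uv : invmx g \in unitmx by rewrite unitmx_inv.
have gI := gideal_map uv gJ; have gin_id := gideal_initial gI.
have [ir _ ih] := gin_id; have [jr _ jh] := gJ.
rewrite /alpha std_gens eg annihilator_dim_gens //; last exact: gens1.
rewrite !annih_dimE //; try exact: gens1.
have e (j' : nat) k' : \dim (H j' :&: Qtake (gens 1%:M) (initial_ideal (ext_map (invmx g) @: J)%VS) k') =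
    \dim (H j' :&: Qtake (gens g) J k').
  rewrite /Qtake !lspan_take; try exact: gens1.
  by rewrite -(dim_map J k' j' ug) !lspan_std dim_initial_meets.
have -> : j%:Z + 1 = j.+1%:Z by lia.
by rewrite !e.
Qed.

End Gin.
End InitialMonomials.

(** * Generic annihilators and Cartan homology *)

Section MulmxCoef.
Variables (K : fieldType) (N : nat).

Definition mxcoef m p (D : 'M[{mpoly K[N]}]_(m, p)) (a : 'X_{1..N}) : 'M[K]_(m, p) :=
  \matrix_(i, l) (D i l)@_a.

Lemma mxcoef_mul m p q (M : 'M[K]_(m, p)) (D : 'M[{mpoly K[N]}]_(p, q)) a :
  mxcoef (map_mx (@mpolyC N K) M *m D) a = M *m mxcoef D a.
Proof.
apply/matrixP=> i l; rewrite !mxE raddf_sum /=; apply: eq_bigr => e _.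
by rewrite !mxE mul_mpolyC mcoeffZ.
Qed.

Lemma mcoeffXUM (l : 'I_N) (f : {mpoly K[N]}) (a : 'X_{1..N}) :
  ('X_l * f)@_a = if (0 < a l)%N then f@_(a - U_(l)) else 0.
Proof.
case: ifP => [al|/negbT al].
  have {1}-> : a = (U_(l) + (a - U_(l)))%MM.
    apply/mnmP=> i; rewrite mnmDE mnmBE mnm1E.
    by case: eqP => [<-|]; rewrite ?subnKC // add0n subn0.
  by rewrite mulrC mcoeffMX.
rewrite [f]mpolyE mulr_sumr raddf_sum /= big1 // => m _.
rewrite -scalerAr mcoeffZ -mpolyXD mcoeffX; case: eqP => [e|]; last by rewrite mulr0.
by move: al; rewrite -e mnmDE mnm1E eqxx.
Qed.

End MulmxCoef.

(** * Separating functionals and generic maximal rank *)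

Section Functionals.
Import VectorInternalTheory.
Variables (K : fieldType) (V : vectType K).

Lemma sep_functional (B : {vspace V}) (x : V) : x \notin B ->
  exists2 c : 'cV[K]_(dim V), vs2mx B *m c = 0 & v2r x *m c != 0.
Proof.
rewrite memvE /subsetv /vline /= mx2vsK submxE => h.
have [i hi] : exists i, v2r x *m col i (cokermx (vs2mx B)) != 0.
  apply/existsP; apply: contraNT h => /existsPn h; apply/eqP/matrixP=> i k.
  have /eqP := negbNE (h k); rewrite colE mulmxA -colE => /matrixP/(_ i 0).
  by rewrite !mxE.
exists (col i (cokermx (vs2mx B))) => //.
by rewrite colE mulmxA mulmx_coker mul0mx.
Qed.

Lemma mem_vs2mx (B : {vspace V}) (u : V) : u \in B -> exists r, v2r u = r *m vs2mx B.
Proof. by rewrite memvE /subsetv /vline /= mx2vsK => /submxP. Qed.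

Lemma row_vs2mx (B : {vspace V}) i : r2v (row i (vs2mx B)) \in B.
Proof. by rewrite memvE /subsetv /vline /= mx2vsK r2vK row_sub. Qed.

Lemma lfun_mx (W : vectType K) (f : 'Hom(V, W)) u : v2r (f u) = v2r u *m f2mx f.
Proof. by rewrite unlock /= r2vK. Qed.

Lemma dim_add_img (U : vectType K) (f : 'Hom(U, V)) (A : {vspace U}) (B : {vspace V}) :
  \dim (B + f @: A) = \rank (col_mx (vs2mx B) (vs2mx A *m f2mx f)).
Proof.
have -> : (f @: A)%VS = mx2vs (vs2mx A *m f2mx f) by rewrite /lfun_img locked_withE.
rewrite /dimv /addv mx2vsK -addsmxE.
by rewrite (adds_eqmx (eqmx_refl _) (mx2vsK _)).
Qed.

End Functionals.

Section Regularity.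
Import VectorInternalTheory.
Variables (K : fieldType) (n : nat).
Hypothesis infK : infinite_set [set: K]%classic.
Local Notation E := (ext K n).
Local Notation H := (ext_homog K n).

(* Maximality among the directions of span(v_k, ..., v_(n-1)) is what allows a *)
(* functional to be extended to a polynomial family by kernel_lift.            *)
Definition max_rank (v : nat -> E) (Q : {vspace E}) (k : nat) (j : int) : Prop :=
  forall t : 'I_n -> K,
    (\dim ((Q + lspan v k) + amulr (\sum_(l < n | (k <= l)%N) t l *: v l) @: H (j - 1)) <=
     \dim ((Q + lspan v k) + amulr (v k) @: H (j - 1)))%N.

Section Psi.
Variables (k : 'I_n) (j : int).

(** One linear map, polynomial in [g], whose image on families with [y k] of degree [j - 1] gives
    both the ideal of the first [k] forms and the multiples of the next one. *)
Definition psi_fun (g : 'M[K]_n) (y : {ffun 'I_n -> E}) : E :=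
  \sum_(l < n | (l <= k)%N) y l * lin_form g l.
Lemma psi_linear g : linear (psi_fun g).
Proof.
move=> t y z; rewrite /psi_fun scaler_sumr -big_split; apply: eq_bigr => l _.
by rewrite !ffunE mulrDl scalerAl.
Qed.
HB.instance Definition _ g :=
  GRing.isLinear.Build K {ffun 'I_n -> E} E _ (psi_fun g) (psi_linear g).

Definition lastc (y : {ffun 'I_n -> E}) : E := y k.
Lemma lastc_linear : linear lastc.
Proof. by move=> t y z; rewrite /lastc !ffunE. Qed.
HB.instance Definition _ :=
  GRing.isLinear.Build K {ffun 'I_n -> E} E _ lastc lastc_linear.

Lemma psi_img g (Q : {vspace E}) :
  (linfun (psi_fun g) @: (linfun lastc @^-1: H (j - 1)) + Q =
   (Q + lspan (nth 0%R (gens g)) k) + amulr (lin_form g k) @: H (j - 1))%VS.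
Proof.
rewrite addvC -addvA; congr (_ + _)%VS; apply/vspaceP=> x.
apply/memv_imgP/memv_addP => [[y]|[_ /mem_lspan[z ->] [_ /memv_imgP[w wj ->] ->]]].
  rewrite -memv_preim lfunE => yk ->; rewrite lfunE /= /psi_fun.
  exists (\sum_(l < n | (l < k)%N) y l * lin_form g l).
    apply/mem_lspan; exists (fun l => if insub l is Some i then y i else 0).
    rewrite (big_ord_widen_cond n xpredT (fun l => (if insub l is Some i then y i else 0) * (gens g)`_l)).
      by apply: eq_bigr => l _; rewrite valK gens_nth.
    exact/ltnW/ltn_ord.
  exists (y k * lin_form g k).
    by apply/memv_imgP; exists (y k) => //; rewrite lfunE.
  rewrite (bigD1 k) //= addrC; congr (_ + _); apply: eq_bigl => l.
  by rewrite ltn_neqAle andbC.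
exists [ffun l : 'I_n => if l == k then w else z l].
  by rewrite -memv_preim lfunE /= /lastc ffunE eqxx.
rewrite !lfunE /= /psi_fun (bigD1 k) //= ffunE eqxx addrC; congr (_ + _).
rewrite (big_ord_widen_cond n xpredT (fun l => z l * (gens g)`_l)); last exact/ltnW/ltn_ord.
apply: eq_big => [l|l lk]; first by rewrite /= ltn_neqAle andbC.
by rewrite ffunE gens_nth ifN //; apply: contraTneq lk => ->; rewrite /= ltnn.
Qed.

Lemma max_rank_generic (Q : {vspace E}) :
  generic (fun g => max_rank (nth 0 (gens g)) Q k j).
Proof.
have hp u : polyvec (fun g => linfun (psi_fun g) u).
  apply: (polyvec_eq (F := fun g => \sum_(l < n | (l <= k)%N) u l * lin_form g l)).
    by move=> g; rewrite lfunE.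
  apply: polyvec_sum => l _; apply: polyvec_mul; last exact: polyvec_lin_form.
  exact: polyvec_cst.
have [D [h1 h2]] := generic_img infK (linfun lastc @^-1: H (j - 1))%VS Q hp.
apply: generic_imp h1 => g _ e t.
(* Column [k] is replaced by the direction [t] of the pencil. [gt] may be singular, but the bound
   [h2] holds for all matrices. *)
pose gt : 'M[K]_n := \matrix_(i, l) if l == k then \sum_(m < n | (k <= m)%N) t m * g i m else g i l.
have gtk : lin_form gt k = \sum_(l < n | (k <= l)%N) t l *: (gens g)`_l.
  rewrite /lin_form; under eq_bigr do rewrite mxE eqxx scaler_suml.
  rewrite exchange_big /=; apply: eq_bigr => m _; rewrite gens_nth /lin_form scaler_sumr.
  by apply: eq_bigr => i _; rewrite scalerA.
have gtl (l : 'I_n) : l != k -> lin_form gt l = lin_form g l.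
  by move=> lk; apply: eq_bigr => i _; rewrite mxE (negPf lk).
have sp : lspan (nth 0 (gens gt)) k = lspan (nth 0 (gens g)) k.
  rewrite /lspan; apply: eq_bigr => l _; congr (limg (amulr _)).
  have ln : (l < n)%N by apply: ltn_trans (ltn_ord k).
  rewrite -[l : nat]/(val (Ordinal ln)) !gens_nth gtl //.
  by rewrite -(inj_eq val_inj) /= ltn_eqF.
rewrite gens_nth -psi_img e -gtk -sp -psi_img; exact: h2.
Qed.

End Psi.

Section Family.
Variables (v : nat -> E) (Q : {vspace E}) (k : 'I_n) (j : int).
Hypothesis mr : max_rank v Q k j.
Local Notation q := (dim E).

(* D is the coefficient vector of the family of functionals, a polynomial in  *)
(* the parameters t of the pencil equal to c at v_k; the last condition is    *)
(* vanishing on the multiples of \sum_(l >= k) t_l v_l, taken coefficientwise. *)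
Lemma functional_family (c : 'cV[K]_q) :
    (forall u, u \in (Q + lspan v k)%VS -> v2r u *m c = 0) ->
    (forall u, u \in H (j - 1) -> v2r (u * v k) *m c = 0) ->
  exists2 D : 'cV[{mpoly K[n]}]_q, eval_mx (fun l => (l == k)%:R) D = c &
    [/\ forall a : 'X_{1..n}, a k = 0%N -> mxcoef D a = 0,
    (forall u a, u \in (Q + lspan v k)%VS -> v2r u *m mxcoef D a = 0) &
    (forall u (a : 'X_{1..n}), u \in H (j - 1) ->
      \sum_(l < n | (k <= l)%N && (0 < a l)%N) v2r (u * v l) *m mxcoef D (a - U_(l)) = 0)].
Proof.
move=> cQ cH.
pose C m p (M : 'M[K]_(m, p)) := map_mx (@mpolyC n K) M.
pose MQ := vs2mx (Q + lspan v k)%VS; pose MH := vs2mx (H (j - 1)).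
pose Nl l := f2mx (amulr (v l)).
pose P : 'M[{mpoly K[n]}]_q := \sum_(l < n | (k <= l)%N) 'X_l *: C _ _ (Nl l).
pose A := col_mx (C _ _ MQ) (C _ _ MH *m P).
have eval_mxA t : eval_mx t A = col_mx MQ (MH *m f2mx (amulr (\sum_(l < n | (k <= l)%N) t l *: v l))).
  rewrite /eval_mx map_col_mx -!/(eval_mx _ _) eval_mx_mul !eval_mx_C; congr (col_mx _ (_ *m _)).
  rewrite -/(eval_mx t P) /P; apply/row_matrixP=> i; rewrite !rowE.
  rewrite -[delta_mx 0 i]r2vK -lfun_mx lfunE /= mulr_sumr linear_sum /=.
  have -> : eval_mx t (\sum_(l < n | (k <= l)%N) 'X_l *: C _ _ (Nl l)) =
      \sum_(l < n | (k <= l)%N) t l *: Nl l.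
    elim/big_ind2: _ => [|M1 M2 M3 M4 <- <-|l _]; rewrite ?eval_mx_0 ?eval_mx_D //.
    by rewrite eval_mx_Z mevalXU eval_mx_C.
  rewrite mulmx_sumr; apply: eq_bigr => l _.
  by rewrite -scalemxAr -scalerAr linearZ /= /Nl -lfun_mx lfunE.
have t0E : \sum_(l < n | (k <= l)%N) ((l == k)%:R : K) *: v l = v k.
  rewrite (bigD1 k) //= eqxx scale1r big1 ?addr0 // => l /andP[_ /negPf->].
  by rewrite scale0r.
have rk t : (\rank (eval_mx t A) <= \rank (eval_mx (fun l => (l == k)%:R) A))%N.
  by rewrite !eval_mxA t0E -!dim_add_img; apply: mr.
have Ac : eval_mx (fun l => (l == k)%:R) A *m c = 0.
  rewrite eval_mxA t0E mul_col_mx; apply/eqP; rewrite col_mx_eq0; apply/andP; split; apply/eqP.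
    apply/row_matrixP=> i; by rewrite row_mul row0 -[row i MQ]r2vK cQ // row_vs2mx.
  apply/row_matrixP=> i; rewrite !row_mul row0 -[row i MH]r2vK -lfun_mx lfunE /= cH //.
  exact: row_vs2mx.
(* The factor ['X_k] is 1 at the base point and removes all coefficients at exponents without [k];
   cycles are available only for positive powers of [x_k]. *)
have [D0 AD0 D0c] := kernel_lift infK rk Ac; pose D := 'X_k *: D0.
have AD : A *m D = 0 by rewrite -scalemxAr AD0 scaler0.
exists D; first by rewrite eval_mx_Z mevalXU eqxx scale1r.
move: AD; rewrite /A mul_col_mx => /eqP; rewrite col_mx_eq0 => /andP[/eqP h1 /eqP h2].
split=> [a ak|u a /mem_vs2mx[r ->]|u a /mem_vs2mx[r hr]].
  by apply/matrixP=> i l; rewrite !mxE mcoeffXUM ak.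
  rewrite -mulmxA -mxcoef_mul h1; apply/matrixP=> i l; rewrite mxE big1 ?mxE // => m _.
  by rewrite !mxE mcoeff0 mulr0.
have e0 : r *m mxcoef (C _ _ MH *m P *m D) a = 0.
  rewrite h2; apply/matrixP=> i l; rewrite mxE big1 ?mxE // => m _.
  by rewrite !mxE mcoeff0 mulr0.
rewrite -mulmxA mxcoef_mul mulmxA -hr in e0; rewrite -[RHS]e0.
have -> : P *m D = \sum_(l < n | (k <= l)%N) 'X_l *: (C _ _ (Nl l) *m D).
  by rewrite /P mulmx_suml; apply: eq_bigr => l _; rewrite -scalemxAl.
have -> : mxcoef (\sum_(l < n | (k <= l)%N) 'X_l *: (C _ _ (Nl l) *m D)) a =
  \sum_(l < n | (k <= l)%N && (0 < a l)%N) Nl l *m mxcoef D (a - U_(l)).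
  rewrite -big_filter_cond -[in LHS]big_filter; elim: [seq _ <- _ | _] => [|l s IH].
    by rewrite !big_nil; apply/matrixP=> i m; rewrite !mxE mcoeff0.
  rewrite !big_cons -IH; apply/matrixP=> i m.
  rewrite 2!mxE raddfD /= [X in X@__ + _]mxE mcoeffXUM.
  case: ifP => _; last by rewrite add0r !mxE.
  rewrite [RHS]mxE -mxcoef_mul !mxE; congr (_ + _); by rewrite mxE.
rewrite mulmx_sumr; apply: eq_bigr => l _.
by rewrite mulmxA /Nl -lfun_mx lfunE.
Qed.

End Family.
End Regularity.

Section Lift.
Variables (K : fieldType) (n : nat).
Local Notation E := (ext K n).
Local Notation H := (ext_homog K n).
Variables (v : nat -> E).
Hypothesis v1 : forall l, v l \in H 1.
Variable Q : {vspace E}.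
Hypothesis QM : forall x y, x \in Q -> x * y \in Q.
Hypothesis QH : forall j x, x \in Q -> hcomp j x \in Q.

Definition epow (k p : nat) : nat -> nat := iter p (up^~ k) (fun=> 0%N).

Lemma epowE k p l : epow k p l = if l == k then p else 0%N.
Proof.
elim: p => [|p IH]; first by case: ifP.
by rewrite /epow iterS /up -/(epow k p) IH; case: ifP => _; rewrite ?addn1 ?addn0.
Qed.

(** Repeated use of [les_surj]: each lifting raises the power of [x_k] by one, the obstruction lying
    in a vanishing homology group in [k] variables. *)
Lemma lift_pow k j x p : (forall i, cartan_exact v Q k i.+1 (j + 1)) ->
    x \in H j -> in_add_span v Q k (x * v k) ->
  exists2 Z, is_cycle v Q k.+1 p.+1 j Z & Z (epow k p.+1) = x.
Proof.
move=> hex xj qx; elim: p => [|p [Z cZ Zx]].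
  have [||Z cZ ZE] := @les_surj _ _ v Q k 0 j (fun=> x).
  - by split.
  - by apply/bound0P => //; split=> //; apply: homog_mul.
  by exists Z; rewrite // /epow iterS ZE.
have [|Z2 cZ2 ZE] := les_surj cZ; first by apply: hex; apply: cycle_mulv.
by exists Z2 => //; rewrite /epow iterS ZE.
Qed.

Lemma cycle_extend k m p j Z : (k < m)%N -> is_cycle v Q k.+1 p j Z ->
  exists Z', [/\ is_cycle v Q m p j Z', forall a, expo k.+1 p a -> Z' a = Z a &
    forall a l, expo m p a -> (k < l)%N -> (0 < a l)%N -> Z' a = 0].
Proof.
move=> km cZ; elim: m km => [//|m IH]; rewrite ltnS leq_eqVlt => /orP[/eqP<-|km].
  exists Z; split=> // a l [a0 _] kl; by rewrite a0.
have [Z' [cZ' h1 h2]] := IH km; exists (incl m Z'); split=> [|a Xa|a l Xa kl al].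
- exact: cycle_incl.
- by rewrite /incl; have [a0 _] := Xa; rewrite a0 //= h1.
- rewrite /incl; case: eqP => // am; apply: h2 kl al; exact: expo_narrow.
Qed.
End Lift.

Section Regularity.
Import VectorInternalTheory.
Variables (K : fieldType) (n : nat).
Hypothesis infK : infinite_set [set: K]%classic.
Local Notation E := (ext K n).
Local Notation H := (ext_homog K n).
Variables (v : nat -> E).
Hypothesis v1 : forall l, v l \in H 1.
Variable Q : {vspace E}.
Hypothesis QM : forall x y, x \in Q -> x * y \in Q.
Hypothesis QH : forall j x, x \in Q -> hcomp j x \in Q.

Section Pairing.
Variables (k : 'I_n) (j : int) (d : nat) (M : 'X_{1..n} -> 'M[K]_(dim E, d)).
Hypothesis Mk : forall a l, (l < k)%N -> (0 < fromX a l)%N -> M a = 0.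
Hypothesis MQ : forall a u, u \in (Q + lspan v k)%VS -> v2r u *m M a = 0.
Hypothesis MH : forall (a : 'X_{1..n}) u, u \in H (j - 1) ->
  \sum_(l < n | (k <= l)%N && (0 < a l)%N) v2r (u * v l) *m M (a - U_(l)) = 0.

Definition pairing p (c : chains K n n p) : 'M[K]_(1, d) :=
  \sum_(a : chain_idx n p) v2r (c a) *m M (idx_mnm a).

(** Sorting the sum by exponents of [w], the terms with [l < k] die because the weights kill
    [lspan v k], and the rest is the relation [MH]. *)
Lemma pairing_bd p (w : chains K n n p.+1) : (forall a, w a \in H (j - 1)) ->
  pairing (chain_diff n v p.+1 p w) = 0.
Proof.
move=> hw; rewrite /pairing.
transitivity (\sum_(b : chain_idx n p) \sum_(a : chain_idx n p.+1)
    \sum_(l < n | idx_mnm a == (idx_mnm b + U_(l))%MM) v2r (w a * v l) *m M (idx_mnm b)).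
  apply: eq_bigr => b _; rewrite lfunE ffunE linear_sum mulmx_suml.
  by apply: eq_bigr => a _ /=; rewrite linear_sum mulmx_suml.
rewrite exchange_big big1 // => a _ /=; have {hw} := hw a; move: (w a) => u hu.
transitivity (\sum_(l < n | (k <= l)%N && (0 < idx_mnm a l)%N) v2r (u * v l) *m M (idx_mnm a - U_(l))); last exact: MH.
under eq_bigr do rewrite big_mkcond /=.
rewrite exchange_big [RHS]big_mkcond; apply: eq_bigr => l _ /=; rewrite -big_mkcond /=.
have [lk|kl] := ltnP l k.
  rewrite big1 // => b _; apply: MQ; apply: (subvP (addvSr _ _)).
  apply/mem_lspan; exists (fun m => if m == l :> nat then u else 0).
  rewrite (bigD1 (Ordinal lk)) //= eqxx big1 ?addr0 // => m nm.
  by case: eqP => [e|]; rewrite ?mul0r //; case/eqP: nm; apply: val_inj.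
have [al|al] := posnP (idx_mnm a l).
  rewrite big1 // => b /eqP e; move: al; rewrite e mnmDE mnm1E eqxx; lia.
have aE : idx_mnm a = (idx_mnm a - U_(l) + U_(l))%MM.
  apply/mnmP=> i; rewrite mnmDE mnmBE mnm1E.
  by case: eqP => [<-|]; rewrite ?subnK // subn0 addn0.
have [b hb] : exists b : chain_idx n p, idx_mnm b = (idx_mnm a - U_(l))%MM.
  have da : mdeg (idx_mnm a) = p.+1 by apply/eqP/(valP a).
  have db : mdeg (idx_mnm a - U_(l))%MM = p.
    by move: da; rewrite {1}aE mdegD mdeg1 addn1 => -[].
  have := fromX_expo (idx_mnm a - U_(l))%MM; rewrite db => /chain_idx_exists[b hb].
  by exists b; rewrite hb fromXK.
rewrite (big_pred1 b) ?hb // => b' /=.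
apply/eqP/eqP => [e|->]; last by rewrite hb.
by apply: idx_mnm_inj; rewrite hb e addmK.
Qed.

(** Exponents with a variable before [k] have weight zero, and the extended cycle vanishes at those
    with a later one. Only the pure power of [x_k] contributes, while the whole pairing is zero
    because the cycle bounds. *)
Lemma pairing_pow p Z x : cartan_exact v Q n p j -> is_cycle v Q k.+1 p j Z -> Z (epow k p) = x ->
  v2r x *m M (toX n (epow k p)) = 0.
Proof.
move=> hex cZ Zx; have [Z' [cZ' h1 h2]] := cycle_extend (ltn_ord k) cZ.
have cycle_lift r : (k < r)%N -> expo r p (epow k p).
  move=> kr; split=> [l rl|]; first by rewrite epowE; case: eqP => // lk; lia.
  rewrite (bigD1 (Ordinal kr)) //= epowE eqxx big1 ?addn0 // => l nl.
  by rewrite epowE; case: eqP => // lk; case/eqP: nl; apply: val_inj.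
have [_ [w hw bw]] := hex _ cZ'.
have pZ : pairing (chain_of n p Z') = 0.
  have hW a : chain_of n p.+1 w a \in H (j - 1) by rewrite ffunE; apply/hw/chain_idx_expo.
  rewrite -(pairing_bd hW); apply: eq_bigr => a _; apply/eqP; rewrite -subr_eq0 -mulmxBl -linearB.
  apply/eqP/MQ/(subvP (addvSl _ _)); rewrite ffunE -[chain_diff _ _ _ _ _ a]chain_fun_idx.
  rewrite chain_fun_diff; last exact: chain_idx_expo.
  have -> : bd v n (chain_fun (chain_of n p.+1 w)) (fromX (idx_mnm a)) = bd v n w (fromX (idx_mnm a)).
    by apply: eq_bigr => l _; rewrite chain_funK //; apply: expo_up => //; apply: chain_idx_expo.
  exact/bw/chain_idx_expo.
have [a0 ha0] := chain_idx_exists (cycle_lift n (ltn_ord k)).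
rewrite -pZ /pairing (bigD1 a0) //= big1 ?addr0 => [|a na].
  by rewrite ffunE ha0 (toXK (cycle_lift n _)) // h1 ?Zx //; apply: cycle_lift.
have Xa := chain_idx_expo a.
have [/existsP[l /andP[lk al]]|/existsPn hlt] := boolP [exists l : 'I_n, (l < k)%N && (0 < fromX (idx_mnm a) l)%N].
  by rewrite (Mk lk al) mulmx0.
have [/existsP[l /andP[lk al]]|/existsPn hgt] := boolP [exists l : 'I_n, (k < l)%N && (0 < fromX (idx_mnm a) l)%N].
  by rewrite ffunE (h2 _ _ Xa lk al) linear0 mul0mx.
case/eqP: na; apply: idx_mnm_inj; rewrite ha0 -(fromXK (idx_mnm a)); congr toX.
have az l : l != k :> nat -> fromX (idx_mnm a) l = 0%N.
  have [ln|nl] := ltnP l n; last by case: Xa => + _ => ->.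
  move=> lk; apply/eqP; rewrite -leqn0 leqNgt; apply/negP=> al.
  move: lk; rewrite neq_ltn => /orP[lk|kl].
    by have := hlt (Ordinal ln); rewrite /= lk al.
  by have := hgt (Ordinal ln); rewrite /= kl al.
apply: funext => l; rewrite epowE; have [->|/az->//] := eqVneq l k.
case: Xa => _; rewrite (bigD1 k) //= [X in (_ + X)%N]big1 ?addn0 // => i ik.
by apply: az; rewrite (inj_eq val_inj).
Qed.

End Pairing.

Lemma annih_exact_descent (k : 'I_n) (j : int) : max_rank v Q k j ->
    (forall i, cartan_exact v Q k i.+1 (j + 1)) -> (forall i, cartan_exact v Q n i.+1 j) ->
  annih_exact v Q k j.
Proof.
move=> mr hexk hexn x xj qx; apply/in_add_spanE.
have in_add_spanS : (Q + lspan v k + amulr (v k) @: H (j - 1) <= Q + lspan v k.+1)%VS.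
  rewrite /lspan big_ord_recr /= addvA; apply: addvS => //; exact/limgS/subvf.
apply: (subvP in_add_spanS); apply/negPn/negP => /sep_functional[c cB cx].
have cK u : u \in (Q + lspan v k + amulr (v k) @: H (j - 1))%VS -> v2r u *m c = 0.
  by case/mem_vs2mx=> r ->; rewrite -mulmxA cB mulmx0.
have [|u uH|D Dc [D0 DQ DH]] := functional_family infK mr (c := c).
- by move=> u uQ; apply/cK/(subvP (addvSl _ _)).
- apply/cK/(subvP (addvSr _ _))/memv_imgP; exists u => //; by rewrite lfunE.
pose low (a : 'X_{1..n}) := [exists l : 'I_n, (l < k)%N && (0 < a l)%N].
(* Cutting off exponents with a variable before [k] preserves the coefficient relations, which only
   subtract unit exponents [l] with [k <= l]. *)
pose M a := if low a then 0 else mxcoef D a.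
have pw p : v2r x *m M (toX n (epow k p.+1)) = 0.
  have [Z cZ Zx] := lift_pow v1 QM QH p hexk xj qx.
  apply: (pairing_pow (k := k) (j := j) (M := M)) (hexn p) cZ Zx.
  - move=> a l lk al; rewrite /M ifT //; apply/existsP.
    have ln : (l < n)%N by apply: ltn_trans (ltn_ord k).
    by exists (Ordinal ln); rewrite lk -fromXE.
  - by move=> a u uQ; rewrite /M; case: ifP => _; rewrite ?mulmx0 // DQ.
  - move=> a u uH; have lowE (l : 'I_n) : (k <= l)%N -> low (a - U_(l))%MM = low a.
      move=> kl; apply: eq_existsb => i; case ik: (i < k)%N => //=.
      by rewrite mnmBE mnm1E (_ : l == i = false) ?subn0 //; apply/negbTE; apply: contraTneq ik => <-; rewrite -leqNgt.
    case la: (low a).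
      rewrite big1 // => l /andP[kl _]; by rewrite /M lowE // la mulmx0.
    rewrite -[RHS](DH u a uH); apply: eq_bigr => l /andP[kl _].
    by rewrite /M lowE // la.
(* The family paired with [x]. It is nonzero at the point of the pencil giving [v k], so some pure
   power of ['X_k] has a nonzero coefficient, against [pw]. *)
pose f := (map_mx (@mpolyC n K) (v2r x) *m D) 0 0.
have fE m : f@_m = (v2r x *m mxcoef D m) 0 0 by rewrite -mxcoef_mul mxE.
have : f.@[fun l => (l == k)%:R] != 0.
  apply: contraNneq cx => e; apply/eqP/matrixP=> i l; rewrite !ord1 [RHS]mxE -Dc.
  by rewrite -(eval_mx_C (fun l => (l == k)%:R) (v2r x)) -eval_mx_mul mxE.
rewrite mevalE => h.
have [m hm] : exists m, f@_m * \prod_i ((i == k)%:R : K) ^+ m i != 0.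
  apply/not_existsP=> nh; case/eqP: h; rewrite big1_seq // => m _.
  by apply/eqP/negPn/negP/(nh m).
move: hm; rewrite mulf_eq0 negb_or => /andP[fm /prodf_neq0 hp].
have m0 i : i != k -> m i = 0%N.
  move=> ik; have := hp i isT; by rewrite (negPf ik) mulr0n expr0n; case: (m i) => // e; rewrite eqxx.
case/eqP: fm; rewrite fE; have [mk|mk] := posnP (m k); first by rewrite D0 // mulmx0 mxE.
have -> : m = toX n (epow k (m k).-1.+1).
  apply/mnmP=> i; rewrite mnmE epowE prednK //.
  by have [/val_inj->//|] := eqVneq (i : nat) k; rewrite (inj_eq val_inj) => /m0.
set a := toX _ _; have la : low a = false.
  apply/negbTE/existsPn=> l; rewrite negb_and mnmE epowE.
  by have [->|_] := eqVneq (l : nat) k; rewrite ?ltnn // orbT.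
by have := pw (m k).-1; rewrite -/a /M la => ->; rewrite mxE.
Qed.

(** Descending induction on the degree, starting above [n], where E vanishes. *)
Lemma regularity (d : nat) :
    (forall (k : 'I_n) (j : nat), max_rank v Q k j%:Z) ->
    (forall i (j : nat), (d <= j)%N -> cartan_exact v Q n i.+1 j) ->
  forall k (j : nat), (d <= j)%N -> (k < n)%N -> annih_exact v Q k j.
Proof.
move=> mr hex.
have dsc m : forall j, (d <= j)%N -> (n < j + m)%N -> forall k, (k < n)%N -> annih_exact v Q k j%:Z.
  elim: m => [|m IH] j dj nj k kn.
    move=> x xj _; have -> : x = 0.
      by apply: homog_gt xj; rewrite addn0 in nj; rewrite ltz_nat.
    apply/in_add_spanE; exact: mem0v.
  apply: (@annih_exact_descent (Ordinal kn) j (mr _ _)) => /= i; last exact: hex.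
  apply: annih_cartan_exact => // l lk; have -> : j%:Z + 1 = j.+1%:Z by lia.
  by apply: IH; [apply: leqW|rewrite addSnnS|apply: ltn_trans kn].
by move=> k j dj kn; apply: (dsc n.+1) => //; rewrite addnS ltnS leq_addl.
Qed.

End Regularity.

(** * Linear resolutions *)

Section FreeExactness.
Variables (K : fieldType) (n : nat) (g : 'M[K]_n).
Hypothesis ug : g \in unitmx.
Local Notation E := (ext K n).
Local Notation H := (ext_homog K n).
Local Notation v := (nth 0 (gens g)).
Local Notation e := (nth 0 (gens (1%:M : 'M[K]_n))).
Let v1 := gens1 g.

Lemma lspan_map h (w w' : nat -> E) k x : (forall l, ext_map h (w l) = w' l) ->
  x \in lspan w k -> ext_map h x \in lspan w' k.
Proof.
move=> ww' /mem_lspan[y ->]; apply/mem_lspan; exists (fun l => ext_map h (y l)).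
by rewrite linear_sum; apply: eq_bigr => l _ /=; rewrite ext_mapM ww'.
Qed.

Lemma gens_inv l : ext_map (invmx g) (v l) = e l.
Proof. by rewrite ext_map_gens mulVmx. Qed.

Lemma gens_fwd l : ext_map g (e l) = v l.
Proof. by rewrite ext_map_gens mulmx1. Qed.

(** After the change of coordinates, a monomial avoiding [k] lies in the ideal of the earlier
    variables as soon as its product with variable [k] does. *)
Lemma annih_exact_free k (j : int) : (k < n)%N -> annih_exact v 0%VS k j.
Proof.
move=> kn x xj /in_add_spanE; rewrite add0v => h; apply/in_add_spanE; rewrite add0v.
have {h} := lspan_map gens_inv h; rewrite ext_mapM gens_inv.
move=> h; rewrite -(ext_mapVK ug x); apply: (lspan_map gens_fwd); move: h.
move: (ext_map _ x) => y; rewrite !lspan_std => /mem_mon_spanP h.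
apply/mem_mon_spanP=> F yF; apply/meetsP.
have [kF|kF] := boolP (Ordinal kn \in F); first by exists (Ordinal kn).
have dF : [disjoint F & [set Ordinal kn]] by rewrite disjoint_sym disjoints1.
have := h (F :|: [set Ordinal kn]); rewrite -[k]/(val (Ordinal kn)) gens_nth lin_form1.
move/(_ (mul_mon_neq0 dF yF))/meetsP=> [l]; rewrite !inE => /orP[lF|/eqP->] lk.
  by exists l => //; apply: ltnW.
by rewrite ltnn in lk.
Qed.

Lemma zeroM (x y : E) : x \in 0%VS -> x * y \in 0%VS.
Proof. by rewrite !memv0 => /eqP->; rewrite mul0r. Qed.

Lemma zeroH (j : int) (x : E) : x \in 0%VS -> hcomp j x \in 0%VS.
Proof. by rewrite !memv0 => /eqP->; rewrite linear0. Qed.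

Lemma cartan_exact_free i j : cartan_exact v 0%VS n i.+1 j.
Proof. by apply: (annih_cartan_exact v1 zeroM zeroH) => k kn; apply: annih_exact_free. Qed.

Lemma pos_lspan (j : int) x : (1 <= j)%R -> x \in H j -> x \in lspan v n.
Proof.
move=> j1 xj; rewrite -(ext_mapVK ug x); apply: (lspan_map gens_fwd).
rewrite lspan_std; apply/mem_mon_spanP=> F.
have /mem_homogP h := ext_map_homog (invmx g) xj.
move/h=> hF; have [F0|[l lF]] := set_0Vmem F; last by apply/meetsP; exists l.
by move: hF j1; rewrite F0 cards0 => <-.
Qed.

Local Notation bdn := (bd v n).

(** Cartan exactness for a free module, one coordinate at a time. In homological degree 0 positive
    coefficient degree is needed, since H_0 is the field. *)
Lemma exactF b i (j : int) (c : (nat -> nat) -> 'I_b -> E) :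
    (i = 0%N -> (1 <= j)%R) ->
    (forall a k, expo n i a -> c a k \in H j) ->
    (forall i' a k, i = i'.+1 -> expo n i' a -> bdn (c^~ k) a = 0) ->
  exists2 w : (nat -> nat) -> 'I_b -> E, forall a k, expo n i.+1 a -> w a k \in H (j - 1) &
    forall a k, expo n i a -> c a k = bdn (w^~ k) a.
Proof.
move=> hj hc h0.
have ex k : exists w : (nat -> nat) -> E, (forall a, expo n i.+1 a -> w a \in H (j - 1)) /\
    forall a, expo n i a -> c a k = bdn w a.
  have [_ [w hw bw]] : is_bound v 0%VS n i j (c^~ k).
    case: i hj hc h0 => [|i] hj hc h0.
      apply/(bound0P v1 zeroH); split; first exact/hc/expo0.
      by apply/in_add_spanE; rewrite add0v; apply: pos_lspan (hj erefl) _; apply/hc/expo0.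
    apply: cartan_exact_free; split=> [a /hc//|_ a [<-] Xa]; by rewrite (h0 _ _ k erefl Xa) mem0v.
  by exists w; split=> // a /bw; rewrite memv0 subr_eq0 => /eqP.
have [w hw] := choice ex; exists (fun a k => w k a) => a k Xa; first exact: (hw k).1.
exact: (hw k).2.
Qed.

Definition lincomb b b' (D : 'I_b' -> 'I_b -> E) (y : 'I_b' -> E) : 'I_b -> E :=
  fun l => \sum_k y k * D k l.

Lemma lincomb_bd b b' (D : 'I_b' -> 'I_b -> E) (e0 : nat) z l a :
    (forall k l, D k l \in H e0) ->
  bdn (fun a => lincomb D (z a) l) a = (-1) ^+ e0 *: lincomb D (fun k => bdn (z^~ k) a) l.
Proof.
move=> hD; rewrite /bd /lincomb; under eq_bigr do rewrite mulr_suml.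
rewrite exchange_big scaler_sumr /=; apply: eq_bigr => k _.
rewrite mulr_suml scaler_sumr; apply: eq_bigr => m _.
rewrite -!mulrA (homog_comm1 (v1 m) (hD k l)) -scalerAr scalerA.
by rewrite -exprD addnn -signr_odd odd_double scale1r.
Qed.

Lemma lincombB b b' (D : 'I_b' -> 'I_b -> E) y z l :
  lincomb D (fun k => y k - z k) l = lincomb D y l - lincomb D z l.
Proof. by rewrite /lincomb -sumrB; apply: eq_bigr => k _; rewrite mulrBl. Qed.

Lemma lincombZ b b' (D : 'I_b' -> 'I_b -> E) t y l :
  lincomb D (fun k => t *: y k) l = t *: lincomb D y l.
Proof. by rewrite /lincomb scaler_sumr; apply: eq_bigr => k _; rewrite scalerAl. Qed.

Lemma lincomb_hcomp b b' (D : 'I_b' -> 'I_b -> E) (e0 : nat) (j : int) y l :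
    (forall k l, D k l \in H e0) ->
  lincomb D (fun k => hcomp (j - e0%:Z) (y k)) l = hcomp j (lincomb D y l).
Proof.
move=> hD; rewrite /lincomb linear_sum; apply: eq_bigr => k _ /=.
by rewrite -{2}[j](subrK e0%:Z) hcomp_mulr.
Qed.

Lemma lincomb_homog b b' (D : 'I_b' -> 'I_b -> E) (e0 : nat) (j : int) y l :
    (forall k l, D k l \in H e0) -> (forall k, y k \in H j) -> lincomb D y l \in H (j + e0%:Z).
Proof. by move=> hD hy; apply: memv_suml => k _; apply: homog_mul. Qed.

(* Vanishing of the Cartan homology of the quotient of E^b by N in            *)
(* homological degree i and coefficient degrees at least e0.                  *)
Definition cycle_lift b (N : ('I_b -> E) -> Prop) (i e0 : nat) : Prop :=
  forall (j : int) (z : (nat -> nat) -> 'I_b -> E), (e0%:Z <= j)%R ->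
    (forall a k, expo n i a -> z a k \in H j) ->
    (forall i' a, i = i'.+1 -> expo n i' a -> N (fun k => bdn (z^~ k) a)) ->
  exists2 w : (nat -> nat) -> 'I_b -> E,
    forall a k, expo n i.+1 a -> w a k \in H (j - 1) &
    forall a, expo n i a -> N (fun k => z a k - bdn (w^~ k) a).

Section Steps.
Variables (b b' e0 : nat) (D : 'I_b' -> 'I_b -> E) (N : ('I_b -> E) -> Prop).
Hypothesis hD : forall k l, D k l \in H e0.
Hypothesis hN : forall f, N f <-> exists y, f = lincomb D y.
Let N' (y : 'I_b' -> E) : Prop := lincomb D y = fun=> 0.

Lemma N_homog (j : int) f : N f -> (forall l, f l \in H j) ->
  exists2 y, forall k, y k \in H (j - e0%:Z) & f = lincomb D y.
Proof.
move=> /hN[y fE] hf; exists (fun k => hcomp (j - e0%:Z) (y k)) => [k|]; first exact: hcomp_homog.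
by apply: funext => l; rewrite lincomb_hcomp // -fE hcomp_id.
Qed.

Lemma chain_lift i (j : int) (z : (nat -> nat) -> 'I_b -> E) :
    (forall a, expo n i a -> N (z a)) -> (forall a l, expo n i a -> z a l \in H j) ->
  exists2 y : (nat -> nat) -> 'I_b' -> E, forall a k, y a k \in H (j - e0%:Z) &
    forall a, expo n i a -> z a = lincomb D (y a).
Proof.
move=> zN zj.
have ex a : exists y : 'I_b' -> E, (forall k, y k \in H (j - e0%:Z)) /\ (expo n i a -> z a = lincomb D y).
  have [Xa|nX] := EM (expo n i a).
    by have [y hy yE] := N_homog (zN a Xa) (fun l => zj a l Xa); exists y.
  by exists (fun=> 0); split=> // k; apply: mem0v.
have [y hy] := choice ex; exists y => [a k|a]; [exact: (hy a).1|exact: (hy a).2].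
Qed.

(** Dimension shifting along 0 -> N -> E^b -> E^b/N -> 0, where [N] is E^b' modulo the syzygies [N']
    with coefficient degrees shifted by [e0]. The free module has no homology in these degrees. *)
Lemma cycle_lift_up i : cycle_lift N i.+2 e0 -> cycle_lift N' i.+1 1.
Proof.
move=> XN j z j1 hz zN.
have [|a l Xa|i' a l [<-] Xa|u hu uE] := @exactF b i.+1 (j + e0%:Z) (fun a => lincomb D (z a)).
- by [].
- by apply: lincomb_homog => // k; apply: hz.
- by rewrite (lincomb_bd _ _ _ hD) (congr1 (@^~ l) (zN i a erefl Xa)) scaler0.
have [|a k Xa|i' a [<-] Xa|w hw wN] := XN (j + e0%:Z - 1) u.
- by lia.
- exact: hu.
- by apply/hN; exists (z a); apply: funext => l; rewrite -uE.
have [|a l Xa|y hy yE] := chain_lift (j := j + e0%:Z - 1) (z := fun a k => u a k - bdn (w^~ k) a) (i := i.+2).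
- exact: wN.
- rewrite rpredB ?hu // -[_ - 1](subrK1) ; apply: (bd_homog v1) Xa => c Xc; exact: hw.
exists (fun a k => (-1) ^+ e0 *: y a k) => [a k _|a Xa].
  by rewrite memvZ // (_ : j - 1 = j + e0%:Z - 1 - e0%:Z) //; lia.
apply: funext => l; rewrite lincombB; apply/eqP; rewrite subr_eq0 uE //; apply/eqP.
have -> : lincomb D (fun k => bdn (fun a => (-1) ^+ e0 *: y a k) a) l = (-1) ^+ e0 *: lincomb D (fun k => bdn (y^~ k) a) l.
  rewrite -lincombZ; congr (lincomb D _ l); apply: funext => k; exact: bdZ.
rewrite -(lincomb_bd _ _ _ hD).
have -> : bdn (fun a => lincomb D (y a) l) a = bdn (fun a => u a l - bdn (w^~ l) a) a.
  by apply: eq_bigr => m _; rewrite -yE //; apply: expo_up.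
by rewrite bdB (bdbd v1) subr0.
Qed.

(** The same shift read backwards. For [i = 0] nothing is asked of [N']: elements of positive degree
    are combinations of the linear forms. *)
Lemma cycle_lift_down i : (forall i', i = i'.+1 -> cycle_lift N' i 1) -> cycle_lift N i.+1 e0.
Proof.
move=> XN' j z je hz zN.
have [a Xa|a l Xa|y hy yE] := chain_lift (j := j + 1) (z := fun a k => bdn (z^~ k) a) (i := i).
- exact: zN Xa.
- apply: (bd_homog v1) Xa => c Xc; exact: hz.
have yj : (1 <= j + 1 - e0%:Z)%R by lia.
have y0 i' a : i = i'.+1 -> expo n i' a -> N' (fun k => bdn (y^~ k) a).
  move=> Ei Xa; apply: funext => l; apply/eqP.
  have : (-1) ^+ e0 *: lincomb D (fun k => bdn (y^~ k) a) l = 0.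
    rewrite -(lincomb_bd _ _ _ hD).
    have -> : bdn (fun a => lincomb D (y a) l) a = bdn (fun a => bdn (z^~ l) a) a.
      by apply: eq_bigr => m _; rewrite -yE // Ei; apply: expo_up.
    exact: (bdbd v1).
  by move/eqP; rewrite scaler_eq0 signr_eq0.
have [u hu uE] : exists2 u : (nat -> nat) -> 'I_b' -> E,
    forall a k, expo n i.+1 a -> u a k \in H (j + 1 - e0%:Z - 1) &
    forall a, expo n i a -> lincomb D (y a) = lincomb D (fun k => bdn (u^~ k) a).
  case: i XN' hz zN yE y0 => [|i] XN' hz zN yE y0.
    have [|a k Xa|//|u hu uE] := @exactF b' 0 (j + 1 - e0%:Z) y.
    - by [].
    - exact: hy.
    exists u => // a Xa; congr lincomb; apply: funext => k; exact: uE.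
  have [a k Xa||u hu uE] := XN' i erefl (j + 1 - e0%:Z) y yj.
  - exact: hy.
  - exact: y0.
  exists u => // a Xa; apply: funext => l; apply/eqP; rewrite -subr_eq0 -lincombB.
  by rewrite (uE a Xa).
pose t a l := z a l - (-1) ^+ e0 *: lincomb D (u a) l.
have [//|a k Xa|i' a l [<-] Xa|w hw wE] := @exactF b i.+1 j t.
- rewrite rpredB ?hz // rpredZsign (_ : j = j + 1 - e0%:Z - 1 + e0%:Z); last by lia.
  by apply: lincomb_homog => // l; apply: hu.
- rewrite bdB bdZ (lincomb_bd _ _ _ hD) scalerA -exprD addnn -signr_odd odd_double scale1r.
  by rewrite (congr1 (@^~ l) (yE a Xa)) (uE a Xa) subrr.
exists w => // a Xa; apply/hN; exists (fun k => (-1) ^+ e0 *: u a k).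
by apply: funext => l; rewrite -wE // /t subKr lincombZ.
Qed.

End Steps.

(** An element of [N'] of degree at least 2 is a combination of the forms [v]. Its coefficients are
    a 1-cycle modulo [N']; by vanishing of H_1 they can be moved into [N'], and induction on the
    degree applies. *)
Lemma gen_up b (N' : ('I_b -> E) -> Prop) (b'' : nat) (D' : 'I_b'' -> 'I_b -> E) :
    (forall y, N' y -> (forall k, y k \in H 0) -> y = fun=> 0) ->
    (forall (j : int) y, N' y -> N' (fun k => hcomp j (y k))) ->
    (forall y, N' y -> (forall k, y k \in H 1) -> exists z, y = lincomb D' z) ->
    (forall k l, D' k l \in H 1) ->
    cycle_lift N' 1 1 ->
  forall y, N' y -> exists z, y = lincomb D' z.
Proof.
move=> h0 cartan_dim h1 hD' XN'.
have hom (j : nat) y : N' y -> (forall k, y k \in H j) -> exists z, y = lincomb D' z.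
  elim: j y => [|j IH] y yN yj.
    exists (fun=> 0); rewrite (h0 y yN yj); apply: funext => l.
    by rewrite /lincomb big1 // => k _; rewrite mul0r.
  case: j IH yj => [|j] IH yj; first exact: h1.
  have [//|a k _|//|u hu uE] := @exactF b 0 j.+2%:Z (fun=> y); first exact: yj.
  have [||i' a [<-] Xa|w hw wN] := XN' (j.+2%:Z - 1) u.
  - by lia.
  - exact: hu.
  - rewrite (_ : (fun k => _) = y) //; apply: funext => k; by rewrite -uE.
  pose u' a k := u a k - bdn (w^~ k) a.
  have ex (m : 'I_n) : exists z, u' (up (fun=> 0%N) m) = lincomb D' z.
    have Xm := expo_up (ltn_ord m) (expo0 n).
    apply: IH; first exact: wN.
    move=> k; rewrite rpredB ?hu // (_ : j.+1%:Z = j.+2%:Z - 1 - 1 + 1); last by lia.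
    by apply: (bd_homog v1) Xm => c Xc; apply: hw.
  have [zz hz] := choice ex.
  exists (fun k => - \sum_m zz m k * v m); apply: funext => l.
  rewrite (uE (fun=> 0%N)); last exact: expo0.
  have -> : bdn (u^~ l) (fun=> 0%N) = bdn (fun a => u' a l) (fun=> 0%N).
    by rewrite /u' bdB (bdbd v1) subr0.
  rewrite /bd /lincomb; under eq_bigr => m _ do rewrite hz /lincomb mulr_suml.
  rewrite exchange_big; apply: eq_bigr => k _ /=.
  rewrite mulNr mulr_suml -sumrN; apply: eq_bigr => m _.
  by rewrite -!mulrA (homog1_anti (hD' k l) (v1 m)) mulrN.
move=> y yN.
have ex (j : 'I_n.+1) : exists z, (fun k => hcomp j%:Z (y k)) = lincomb D' z.
  by apply: (hom j); [exact: cartan_dim|move=> k; apply: hcomp_homog].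
have [zz hz] := choice ex.
exists (fun k => \sum_j zz j k); apply: funext => l; rewrite [y l]hcomp_sum.
rewrite /lincomb; under [RHS]eq_bigr do rewrite mulr_suml.
by rewrite exchange_big; apply: eq_bigr => j _; apply: (congr1 (@^~ l) (hz j)).
Qed.

End FreeExactness.

(** * Linear resolutions versus vanishing Cartan homology *)

Section FromResolution.
Variables (K : fieldType) (n : nat) (g : 'M[K]_n).
Hypothesis ug : g \in unitmx.
Local Notation E := (ext K n).
Local Notation H := (ext_homog K n).
Local Notation v := (nth 0 (gens g)).

Lemma row_lincomb b b' (A : 'M[E]_(b', b)) (y : 'I_b' -> E) l :
  ((\row_k y k) *m A) 0 l = lincomb (fun k l => A k l) y l.
Proof. by rewrite mxE; apply: eq_bigr => k _; rewrite mxE. Qed.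

Lemma lincomb_row b b' (A : 'M[E]_(b', b)) (y : 'rV[E]_b') l :
  (y *m A) 0 l = lincomb (fun k l => A k l) (fun k => y 0 k) l.
Proof. by rewrite mxE. Qed.

Lemma linear_resolution_exact I d : has_linear_resolution I d ->
  forall i (j : nat), (d <= j)%N -> cartan_exact v I n i.+1 j.
Proof.
case=> R _ lin i j dj.
have degE s (k : 'I_(res_rank R s)) : res_deg k = (s + d)%:Z.
  apply/eqP/negPn/negP => h; have := lin s (res_deg k) h.
  move/eqP; rewrite cards_eq0 => /eqP/setP/(_ k); by rewrite !inE eqxx.
pose Da k (l : 'I_1) := res_aug R k l.
pose Dd s k l := res_diff R s k l.
have hDa k l : Da k l \in H d by rewrite /Da ord1 -[d]add0n -(degE 0%N k) res_aug_homog.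
have hDd s k l : Dd s k l \in H 1%:Z.
  have := res_diff_homog k l; rewrite !degE.
  by rewrite (_ : (s.+1 + d)%:Z - (s + d)%:Z = 1%:Z) //; lia.
pose Im s f := exists y, f = lincomb (Dd s) y.
have Na : (fun y => lincomb Da y = fun=> 0) = Im 0.
  apply: funext => y; apply: propext; split=> [h|[z zE]].
    have /res_exact0[z zE] : (\row_k y k) *m res_aug R = 0.
      by apply/matrixP=> i1 l; rewrite !ord1 row_lincomb mxE; apply: (congr1 (@^~ 0) h).
    exists (fun k => z 0 k); apply: funext => l; rewrite -lincomb_row -zE mxE //.
  have /res_exact0 e : exists z0, \row_k y k = z0 *m res_diff R 0.
    by exists (\row_k z k); apply/matrixP=> i1 l; rewrite !ord1 row_lincomb mxE zE.
  by apply: funext => l; rewrite /Da -row_lincomb e mxE.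
have Nd s : (fun y => lincomb (Dd s) y = fun=> 0) = Im s.+1.
  apply: funext => y; apply: propext; split=> [h|[z zE]].
    have /res_exactS[z zE] : (\row_k y k) *m res_diff R s = 0.
      by apply/matrixP=> i1 l; rewrite !ord1 row_lincomb mxE; apply: (congr1 (@^~ l) h).
    by exists (fun k => z 0 k); apply: funext => l; rewrite -lincomb_row -zE mxE.
  have /res_exactS e : exists z0, \row_k y k = z0 *m res_diff R s.+1.
    by exists (\row_k z k); apply/matrixP=> i1 l; rewrite !ord1 row_lincomb mxE zE.
  by apply: funext => l; rewrite /Dd -row_lincomb e mxE.
(* Each step along the resolution lowers the homological degree by one. *)
have XIm i1 s : cycle_lift g (Im s) i1.+1 1.
  elim: i1 s => [|i1 IH] s; apply: (cycle_lift_down ug (hDd s) (fun f => iff_refl _)) => // i' _.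
  by rewrite Nd; apply: IH.
pose NI (f : 'I_1 -> E) := f 0 \in I.
have hNI f : NI f <-> exists y, f = lincomb Da y.
  rewrite /NI res_aug_im; split=> [[y yE]|[y yE]].
    exists (fun k => y 0 k); apply: funext => l.
    by rewrite /Da -lincomb_row yE mxE (ord1 l) eqxx mulr1n.
  exists (\row_k y k); apply/matrixP=> i1 l; rewrite !ord1 row_lincomb yE.
  by rewrite [RHS]mxE eqxx mulr1n.
have XI : cycle_lift g NI i.+1 d.
  by apply: (cycle_lift_down ug hDa hNI) => i' Ei; rewrite Na Ei; apply: XIm.
move=> z [hz cz]; split=> //.
have [||i' a Ei Xa|w hw wI] := XI j (fun a _ => z a).
- by [].
- by move=> a k; apply: hz.
- exact: cz Ei Xa.
exists (fun a => w a 0) => [a Xa|a Xa]; first exact: hw.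
exact: wI.
Qed.

End FromResolution.

Section HomogeneousIdeals.
Variables (K : fieldType) (n : nat) (d : nat) (U : {vspace ext K n}).
Local Notation E := (ext K n).
Local Notation H := (ext_homog K n).
Hypothesis UH : (U <= H d)%VS.

Lemma vbasis_mem_nth (V : vectType K) (B : {vspace V}) k : (vbasis B)`_k \in B.
Proof.
have [kB|Bk] := ltnP k (\dim B); last by rewrite nth_default ?size_tuple ?mem0v.
by apply: vbasis_mem; rewrite mem_nth // size_tuple.
Qed.

Lemma ideal_gen_homog x : x \in ideal_gen U ->
  exists y : 'I_(\dim U) -> E, x = \sum_k y k * (vbasis U)`_k.
Proof.
pose X (k : 'I_(\dim U)) : E := (vbasis U)`_k.
have XH k : X k \in H d by apply/(subvP UH)/vbasis_mem_nth.
pose W : {vspace E} := (\sum_k limg (amulr (X k)))%VS.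
have WP z : z \in W <-> exists y : 'I_(\dim U) -> E, z = \sum_k y k * X k.
  split=> [/memv_sumP[w hw ->]|[y ->]]; last first.
    by apply: memv_sumr => k _; apply/memv_imgP; exists (y k); rewrite ?memvf // lfunE.
  have ex k : exists y, w k = y * X k.
    by have /memv_imgP[y _ ->] := hw k isT; exists y; rewrite lfunE.
  by have [y hy] := choice ex; exists y; apply: eq_bigr.
have Wl z y : z \in W -> y * z \in W.
  move=> /WP[c ->]; apply/WP; exists (fun k => y * c k).
  by rewrite mulr_sumr; apply: eq_bigr => k _; rewrite mulrA.
have Wg z l : z \in W -> z * ext_gen K l \in W.
  move=> /WP[c ->]; apply/WP; exists (fun k => (-1) ^+ d *: (c k * ext_gen K l)).
  rewrite mulr_suml; apply: eq_bigr => k _.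
  rewrite -!mulrA -scalerAl -!mulrA (homog_comm1 (gen_homog K l) (XH k)).
  by rewrite -scalerAr scalerA -exprD addnn -signr_odd odd_double scale1r.
have Wm z F : z \in W -> z * ext_mon K F \in W.
  elim/set_min_ind: F z => [|k C kC IH] z zW; first by rewrite -[ext_mon K set0]/(1 : E) mulr1.
  by rewrite mon_setU1_min // mulrA; apply/IH/Wg.
have Wr z y : z \in W -> z * y \in W.
  move=> zW; rewrite [y]ext_sumE mulr_sumr; apply: memv_suml => F _.
  by rewrite -scalerAr; apply/memvZ/Wm.
have UW : (U <= W)%VS.
  apply/subvP=> z /coord_vbasis ->; apply/WP; exists (fun k => coord (vbasis U) k z *: 1).
  by apply: eq_bigr => k _; rewrite -scalerAl mul1r.
by move/(subvP (ideal_gen_sub UW Wl Wr))/WP.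
Qed.

Lemma ideal_gen_hcomp j x : x \in ideal_gen U -> hcomp j x \in ideal_gen U.
Proof.
move/ideal_gen_homog=> [y ->]; rewrite linear_sum; apply: memv_suml => k _ /=.
have xU := vbasis_mem_nth U k.
rewrite -[j](subrK d%:Z) hcomp_mulr; last exact: (subvP UH).
exact/ideal_gen_mull/(subvP (sub_ideal_gen U)).
Qed.

End HomogeneousIdeals.

Section ToResolution.
Variables (K : fieldType) (n : nat) (g : 'M[K]_n).
Hypothesis ug : g \in unitmx.
Local Notation E := (ext K n).
Local Notation H := (ext_homog K n).
Local Notation v := (nth 0 (gens g)).

Definition fam_coef b (k : 'I_b) (y : {ffun 'I_b -> E}) : E := y k.
Lemma fam_coef_linear b (k : 'I_b) : linear (fam_coef k).
Proof. by move=> t y z; rewrite /fam_coef !ffunE. Qed.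
HB.instance Definition _ b (k : 'I_b) :=
  GRing.isLinear.Build K {ffun 'I_b -> E} E _ (fam_coef k) (fam_coef_linear k).

Definition fam_in b (U : {vspace E}) : {vspace {ffun 'I_b -> E}} :=
  (\bigcap_(k < b) (linfun (fam_coef k) @^-1: U))%VS.

Lemma mem_fam_in b (U : {vspace E}) (y : {ffun 'I_b -> E}) : reflect (forall k, y k \in U) (y \in fam_in b U).
Proof.
apply: (iffP idP) => [hy k|hy].
  by move/subv_bigcapP: hy => /(_ k isT); rewrite -memvE -memv_preim lfunE.
by rewrite memvE; apply/subv_bigcapP => k _; rewrite -memvE -memv_preim lfunE; apply: hy.
Qed.

(* A syzygy module: a rank b together with a subspace N of E^b.               *)
Definition module_state := {b : nat & {vspace {ffun 'I_b -> E}}}.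

Section Next.
Variables (e : nat) (S : module_state).
Let b := tag S.
Let N : {vspace {ffun 'I_b -> E}} := tagged S.

Definition next_rank : nat := \dim (N :&: fam_in b (H e)).

Definition next_gens (k : 'I_next_rank) (l : 'I_b) : E := (vbasis (N :&: fam_in b (H e)))`_k l.

Definition next_map_fun (y : {ffun 'I_next_rank -> E}) : {ffun 'I_b -> E} :=
  [ffun l => lincomb next_gens y l].
Lemma next_map_linear : linear next_map_fun.
Proof.
move=> t y z; apply/ffunP=> l; rewrite !ffunE /lincomb scaler_sumr -big_split.
by apply: eq_bigr => k _; rewrite !ffunE mulrDl scalerAl.
Qed.
HB.instance Definition _ :=
  GRing.isLinear.Build K {ffun 'I_next_rank -> E} {ffun 'I_b -> E} _ next_map_fun next_map_linear.

(** The syzygies of a basis of the degree [e] part of [N]; in the resolution [e] is [d] once and 1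
    ever after. *)
Definition next_state : module_state :=
  existT (fun b => {vspace {ffun 'I_b -> E}}) next_rank (lker (linfun next_map_fun)).

Definition state_pred (f : 'I_b -> E) : Prop := finfun f \in N.

(** The invariant of the construction: generation in degree [e], and vanishing Cartan homology,
    which forces the next syzygies to be generated in degree 1. *)
Definition state_inv : Prop :=
  (forall f, state_pred f <-> exists y, f = lincomb next_gens y) /\
  (forall i, cycle_lift g state_pred i.+1 e).

Lemma next_gens_mem k : (vbasis (N :&: fam_in b (H e)))`_k \in (N :&: fam_in b (H e))%VS \/ (next_rank <= k)%N.
Proof.
have [kd|dk] := ltnP k next_rank; last by right.
by left; apply: vbasis_mem; rewrite mem_nth // size_tuple.
Qed.

Lemma next_gens_homog k l : next_gens k l \in H e.
Proof.
case: (next_gens_mem k) => [|h]; last by have := ltn_ord k; rewrite ltnNge h.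
by rewrite memv_cap => /andP[_ /mem_fam_in h]; apply: h.
Qed.

Lemma next_gens_span f : state_pred f -> (forall k, f k \in H e) ->
  exists y, f = lincomb next_gens y.
Proof.
move=> fN fH; have : finfun f \in (N :&: fam_in b (H e))%VS.
  by rewrite memv_cap [_ \in N]fN; apply/mem_fam_in => k; rewrite ffunE.
move/coord_vbasis => fE; exists (fun k => coord (vbasis (N :&: fam_in b (H e))) k (finfun f) *: 1).
apply: funext => l; have := congr1 (fun x : {ffun 'I_b -> E} => x l) fE.
rewrite ffunE => ->; rewrite sum_ffunE; apply: eq_bigr => k _.
by rewrite ffunE -scalerAl mul1r.
Qed.

End Next.

Lemma next_state_pred e (S : module_state) y :
  state_pred (S := next_state e S) y <-> lincomb (next_gens (S := S)) y = fun=> 0.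
Proof.
rewrite /state_pred /= memv_ker lfunE /=; split=> [/eqP/ffunP h|h].
  apply: funext => l; have := h l; rewrite !ffunE => <-.
  by apply: eq_bigr => k _; rewrite ffunE.
apply/eqP/ffunP=> l; rewrite !ffunE -[RHS](congr1 (@^~ l) h).
by apply: eq_bigr => k _; rewrite ffunE.
Qed.

Lemma state_inv_next e (S : module_state) : state_inv e S -> state_inv 1 (next_state e S).
Proof.
case=> hN XN.
have hD := @next_gens_homog e S.
have NE : @state_pred (next_state e S) = fun y => lincomb (next_gens (S := S) (e := e)) y = fun=> 0.
  by apply: funext => y; apply: propext; apply: next_state_pred.
have XN' i : cycle_lift g (@state_pred (next_state e S)) i.+1 1.
  by rewrite NE; apply: (cycle_lift_up ug hD hN).
split=> // f; split=> [|[y ->]].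
  apply: (gen_up ug (N' := @state_pred (next_state e S))) => //.
  (* A degree 0 syzygy is a scalar relation between basis vectors, hence zero. *)
  - move=> y; rewrite NE => h yH; apply: funext => k.
    have yE m : y m = (y m set0 : K) *: 1.
      apply/ffunP=> F; rewrite !ffunE; have [->|F0] := eqVneq F set0.
        by rewrite /GRing.scale /= mulr1.
      rewrite /GRing.scale /= mulr0; apply/eqP/negPn/negP => yF.
      have /mem_homogP/(_ F yF)[] := yH m; move/eqP; by rewrite cards_eq0 (negPf F0).
    set X := vbasis (tagged S :&: fam_in (tag S) (H e)).
    have /freeP fr := basis_free (vbasisP (tagged S :&: fam_in (tag S) (H e))).
    rewrite yE (fr (fun m => y m set0 : K)) ?scale0r //.
    apply/ffunP=> l; rewrite sum_ffunE ffunE -[RHS](congr1 (@^~ l) h).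
    by apply: eq_bigr => m _; rewrite ffunE [in RHS](yE m) -scalerAl mul1r.
  - move=> j y; rewrite NE => h; apply: funext => l.
    have -> : (fun k => hcomp j (y k)) = (fun k => hcomp (j + e%:Z - e%:Z) (y k)) by rewrite addrK.
    by rewrite lincomb_hcomp // (congr1 (@^~ l) h) linear0.
  - exact: next_gens_span.
  - exact: next_gens_homog.
rewrite NE; apply: funext => l; rewrite /lincomb.
under eq_bigr do rewrite mulr_suml; rewrite exchange_big big1 // => k _ /=.
under eq_bigr do rewrite -mulrA; rewrite -mulr_sumr.
case: (@next_gens_mem 1 (next_state e S) k) => [|h]; last by have := ltn_ord k; rewrite ltnNge h.
rewrite memv_cap => /andP[hk _].
have : @state_pred (next_state e S) (next_gens (e := 1) (S := next_state e S) k).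
  rewrite /state_pred; suff -> : finfun (next_gens (e := 1) (S := next_state e S) k) = (vbasis (tagged (next_state e S) :&: fam_in (tag (next_state e S)) (H 1)))`_k by [].
  by apply/ffunP=> m; rewrite ffunE.
rewrite NE => h; by rewrite [X in _ * X](congr1 (@^~ l) h) mulr0.
Qed.

Section Ideal.
Variables (J : {vspace E}) (d : nat).
Let U := (J :&: H d)%VS.
Let I := ideal_gen U.
Hypothesis hex : forall i (j : nat), (d <= j)%N -> cartan_exact v I n i.+1 j.

Definition ideal_state : module_state :=
  existT (fun b => {vspace {ffun 'I_b -> E}}) 1%N (fam_in 1 I).

Lemma ideal_state_pred f : @state_pred ideal_state f <-> f 0 \in I.
Proof.
rewrite /state_pred /=; split=> [/mem_fam_in/(_ 0)|h]; first by rewrite ffunE.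
by apply/mem_fam_in => k; rewrite ffunE ord1.
Qed.

Lemma ideal_state_inv : state_inv d ideal_state.
Proof.
have IE : @state_pred ideal_state = fun f => f 0 \in I.
  by apply: funext => f; apply: propext; apply: ideal_state_pred.
set D := next_gens (e := d) (S := ideal_state).
have DI k : D k 0 \in I.
  case: (@next_gens_mem d ideal_state k) => [|h]; last by have := ltn_ord k; rewrite ltnNge h.
  by rewrite memv_cap => /andP[/mem_fam_in h _]; apply: h.
split.
  move=> f; rewrite IE; split=> [fI|[y ->]]; last first.
    by apply: memv_suml => k _; apply: ideal_gen_mull.
  have UX k : exists z, (vbasis U)`_k = lincomb D z 0.
    have [kU|Uk] := ltnP k (\dim U); last first.
      exists (fun=> 0); rewrite nth_default ?size_tuple //.
      by rewrite /lincomb big1 // => l _; rewrite mul0r.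
    have xU : (vbasis U)`_k \in U by apply: vbasis_mem; rewrite mem_nth // size_tuple.
    have [||y yE] := @next_gens_span d ideal_state (fun=> (vbasis U)`_k).
    - by rewrite IE; apply: (subvP (sub_ideal_gen U)).
    - by move=> _; move: xU; rewrite memv_cap => /andP[].
    by exists y; rewrite -/D -yE.
  have [zz hz] := choice UX; have [y fE] := ideal_gen_homog (capvSr _ _) fI.
  exists (fun l => \sum_k y k * zz k l); apply: funext => l; rewrite (ord1 l) fE.
  under eq_bigr do rewrite hz /lincomb mulr_sumr.
  rewrite exchange_big; apply: eq_bigr => m _; rewrite mulr_suml.
  by apply: eq_bigr => k _; rewrite mulrA.
move=> i j z; case: j => [j|j] dj hz zN; last by exfalso; lia.
have [|_ [w hw wI]] := @hex i j dj (fun a => z a 0).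
  split=> [a Xa|i' a Ei Xa]; first exact: hz.
  by have := zN i' a Ei Xa; rewrite IE.
exists (fun a k => w a) => [a k Xa|a Xa]; first exact: hw.
by rewrite IE; apply: wI.
Qed.

Fixpoint res_state (i : nat) : module_state :=
  match i with 0 => next_state d ideal_state | i.+1 => next_state 1 (res_state i) end.

Lemma res_state_inv i : state_inv 1 (res_state i).
Proof. by elim: i => [|i IH]; apply: state_inv_next => //; apply: ideal_state_inv. Qed.

Definition rk i := tag (res_state i).
Definition aug : 'cV[E]_(rk 0) := \matrix_(k, l) next_gens (e := d) (S := ideal_state) k l.
Definition dif i : 'M[E]_(rk i.+1, rk i) := \matrix_(k, l) next_gens (e := 1) (S := res_state i) k l.

Lemma mulmx_aug (y : 'rV[E]_(rk 0)) l :
  (y *m aug) 0 l = lincomb (next_gens (e := d) (S := ideal_state)) (fun k => y 0 k) l.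
Proof. by rewrite mxE; apply: eq_bigr => k _; rewrite mxE. Qed.

Lemma mulmx_dif i (y : 'rV[E]_(rk i.+1)) l :
  (y *m dif i) 0 l = lincomb (next_gens (e := 1) (S := res_state i)) (fun k => y 0 k) l.
Proof. by rewrite mxE; apply: eq_bigr => k _; rewrite mxE. Qed.

Lemma image_dif i (y : 'rV[E]_(rk i)) :
  (exists z, y = z *m dif i) <-> @state_pred (res_state i) (fun k => y 0 k).
Proof.
have [h _] := res_state_inv i; rewrite h; split=> [[z ->]|[z zE]].
  by exists (fun k => z 0 k); apply: funext => l; rewrite mulmx_dif.
exists (\row_k z k); apply/matrixP=> i0 l; rewrite ord1 mulmx_dif.
rewrite -[LHS]/((fun k => y 0 k) l) zE; congr (lincomb _ _ l).
by apply: funext => k; rewrite mxE.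
Qed.

Lemma cartan_exact_linear_resolution : has_linear_resolution I d.
Proof.
have augH k : aug k 0 \in H d%:Z by rewrite mxE; apply: next_gens_homog.
have difH i k l : dif i k l \in H 1%:Z by rewrite mxE; apply: next_gens_homog.
have augI (x : E) : x \in I <-> exists y : 'rV[E]_(rk 0), y *m aug = x%:M.
  have [h _] := ideal_state_inv.
  rewrite -[x \in I]/((fun _ : 'I_1 => x) 0 \in I) -ideal_state_pred h.
  split=> [[y yE]|[y yE]].
    exists (\row_k y k); apply/matrixP=> i l; rewrite !ord1 mulmx_aug [RHS]mxE eqxx mulr1n.
    rewrite -[RHS]/((fun _ : 'I_1 => x) 0) yE; congr (lincomb _ _ _).
    by apply: funext => k; rewrite mxE.
  exists (fun k => y 0 k); apply: funext => l.
  by rewrite -mulmx_aug yE mxE (ord1 l) eqxx mulr1n.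
have ex0 (y : 'rV[E]_(rk 0)) : y *m aug = 0 <-> exists z, y = z *m dif 0.
  rewrite image_dif next_state_pred; split=> [h|h].
    by apply: funext => l; rewrite -mulmx_aug h mxE.
  by apply/matrixP=> i l; rewrite !ord1 mulmx_aug h mxE.
have exS i (y : 'rV[E]_(rk i.+1)) : y *m dif i = 0 <-> exists z, y = z *m dif i.+1.
  rewrite image_dif next_state_pred; split=> [h|h].
    by apply: funext => l; rewrite -mulmx_dif h mxE.
  by apply/matrixP=> i0 l; rewrite !ord1 mulmx_dif h mxE.
pose deg i (k : 'I_(rk i)) := (i + d)%:Z.
have difH' i k l : dif i k l \in H (deg i.+1 k - deg i l).
  by rewrite /deg (_ : _ - _ = 1%:Z) ?difH //; lia.
exists (@GradedFreeResolution K n I rk deg aug dif augH difH' augI ex0 exS).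
  move=> i k l /=; apply/eqP/negPn/negP => h.
  by have /mem_homogP/(_ _ h) := difH i k l; rewrite cards0.
move=> i j ji; apply/eqP; rewrite cards_eq0; apply/eqP/setP=> k; rewrite !inE /=.
by rewrite eq_sym (negPf ji).
Qed.

End Ideal.
End ToResolution.

(** * Components of a graded ideal *)

Section Components.
Variables (K : fieldType) (n : nat) (g : 'M[K]_n).
Hypothesis ug : g \in unitmx.
Local Notation E := (ext K n).
Local Notation H := (ext_homog K n).
Local Notation v := (nth 0 (gens g)).
Let v1 := gens1 g.

Section Generated.
Variables (d : nat) (U : {vspace E}).
Hypothesis UH : (U <= H d)%VS.
Let I := ideal_gen U.
Let IM (x y : E) : x \in I -> x * y \in I. Proof. exact: ideal_gen_mulr. Qed.
Let IH (j : int) (x : E) : x \in I -> hcomp j x \in I. Proof. exact: (ideal_gen_hcomp UH). Qed.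

(** The coefficients of the generators have positive degree, so a linear form can be split off each
    and moved past the generator at the cost of a sign. *)
Lemma ideal_gen_succ (j : nat) x : (d <= j)%N -> x \in I -> x \in H j.+1 ->
  exists2 y : nat -> E, forall l, y l \in (I :&: H j)%VS & x = \sum_(l < n) y l * v l.
Proof.
move=> dj /(ideal_gen_homog UH)[y0 xE] xj.
pose X (k : nat) : E := (vbasis U)`_k.
have XU k : X k \in U by apply: vbasis_mem_nth.
have XH k : X k \in H d by apply: (subvP UH).
pose y k := hcomp (j.+1%:Z - d%:Z) (y0 k).
have {}xE : x = \sum_k y k * X k.
  rewrite -(hcomp_id xj) xE linear_sum; apply: eq_bigr => k _ /=.
  rewrite -{1}[j.+1%:Z](subrK d%:Z) hcomp_mulr //; exact: XH.
have ex (k : 'I_(\dim U)) : exists c : nat -> E, (forall l, c l \in H (j.+1%:Z - d%:Z - 1)) /\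
    y k = \sum_(l < n) c l * v l.
  have yH : y k \in H (j.+1%:Z - d%:Z) by apply: hcomp_homog.
  have : in_add_span v 0%VS n (y k).
    by apply/in_add_spanE; rewrite add0v; apply: (pos_lspan ug) yH; lia.
  move/(in_add_span_homog v1 (@zeroH K n) yH)=> [c hc]; rewrite memv0 subr_eq0 => /eqP e.
  by exists c.
have [c hc] := choice ex.
exists (fun l => (-1) ^+ d *: \sum_k c k l * X k) => [l|].
  rewrite rpredZsign; apply: memv_suml => k _; rewrite memv_cap; apply/andP; split.
    exact/ideal_gen_mull/(subvP (sub_ideal_gen U)).
  have -> : j%:Z = j.+1%:Z - d%:Z - 1 + d%:Z by lia.
  by apply: homog_mul; [apply: (hc k).1|apply: XH].
rewrite xE; under eq_bigr => k _ do rewrite (hc k).2 mulr_suml.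
rewrite exchange_big; apply: eq_bigr => l _ /=.
rewrite -scalerAl mulr_suml scaler_sumr; apply: eq_bigr => k _.
by rewrite -!mulrA (homog_comm1 (v1 l) (XH k)) -scalerAr.
Qed.

Definition linchain (y : nat -> E) : (nat -> nat) -> E := fun a => \sum_(l < n) y l *+ a l.

Lemma linchain_up y l : (l < n)%N -> linchain y (up (fun=> 0%N) l) = y l.
Proof.
move=> ln; rewrite /linchain (bigD1 (Ordinal ln)) //= big1 ?addr0 => [|k nk].
  by rewrite /up eqxx.
by rewrite /up add0n; case: eqP => // e; case/eqP: nk; apply: val_inj.
Qed.

Lemma bd_linchain y : bd v n (linchain y) (fun=> 0%N) = \sum_(l < n) y l * v l.
Proof. by apply: eq_bigr => l _; rewrite linchain_up. Qed.

Lemma linchain_in y (V : {vspace E}) a : (forall l, y l \in V) -> linchain y a \in V.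
Proof. by move=> hy; apply: memv_suml => l _; apply: rpredMn. Qed.

(** By [ideal_gen_succ] the boundary of a 1-cycle modulo [I] is also the boundary of a chain with
    coefficients in [I]. The difference is a cycle over E, hence bounds. *)
Lemma cartan_exact1_generated (j : nat) : (d <= j)%N -> cartan_exact v I n 1 j.
Proof.
move=> dj z [hz cz]; split=> //.
have zI : bd v n z (fun=> 0%N) \in I by apply: cz (erefl _) _; apply: expo0.
have [|y hy yE] := ideal_gen_succ dj zI.
  rewrite (_ : j.+1%:Z = j%:Z + 1); last by lia.
  exact: (bd_homog v1) (expo0 n).
have [|_ [w hw bw]] := @cartan_exact_free K n g ug 0 j (fun a => z a - linchain y a).
  split=> [a Xa|_ b [<-] /expo0E->]; last by rewrite bdB bd_linchain yE subrr mem0v.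
  rewrite rpredB ?hz //; apply: linchain_in => l.
  by have := hy l; rewrite memv_cap => /andP[].
exists w => // a Xa; have := bw a Xa; rewrite memv0 => /eqP e.
have -> : z a - bd v n w a = linchain y a + (z a - linchain y a - bd v n w a).
  by rewrite addrA addrCA subrr addr0.
rewrite e addr0; apply: linchain_in => l.
by have := hy l; rewrite memv_cap => /andP[].
Qed.

(** [annih_exact_succ] carries the vanishing from degree [d] upwards, its condition on H_1 being
    supplied by generation in degree [d]. *)
Lemma annih_exact_linear_resolution : (forall k, (k < n)%N -> annih_exact v I k d) ->
  forall i (j : nat), (d <= j)%N -> cartan_exact v I n i.+1 j.
Proof.
move=> aex i j dj; apply: (annih_cartan_exact v1 IM IH).
rewrite -(subnK dj) addnC; elim: (j - d)%N => [|m IHm]; first by rewrite addn0.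
rewrite addnS (_ : (d + m).+1%:Z = (d + m)%:Z + 1); last by lia.
apply: (annih_exact_succ v1 IM IH IHm); rewrite (_ : (d + m)%:Z + 1 = (d + m).+1%:Z); last by lia.
by apply: cartan_exact1_generated; rewrite -addnS leq_addr.
Qed.

End Generated.

Section Ideal.
Variable J : {vspace E}.
Hypothesis gJ : gideal J.
Let JM (x y : E) : x \in J -> x * y \in J. Proof. by case: gJ => h _ _; apply: h. Qed.
Let JH (j : int) (x : E) : x \in J -> hcomp j x \in J. Proof. by case: gJ => _ _ h; apply: h. Qed.
Let comp (d : nat) : {vspace E} := ideal_gen (J :&: H d)%VS.
Let compM d (x y : E) : x \in comp d -> x * y \in comp d. Proof. exact: ideal_gen_mulr. Qed.
Let compH d (j : int) (x : E) : x \in comp d -> hcomp j x \in comp d.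
Proof. exact: (ideal_gen_hcomp (capvSr _ _)). Qed.

Let compJ d : (comp d <= J)%VS.
Proof.
have [hr hl _] := gJ; apply: ideal_gen_sub => [|x y|x y]; [exact: capvSl|exact: hl|exact: hr].
Qed.

Lemma bound_restrict (k m : nat) j z : (k < m)%N ->
    (forall r z, (r < m)%N -> is_cycle v J r 1 j z -> is_bound v J r.+1 1 j (incl r z) -> is_bound v J r 1 j z) ->
    (forall a l, (k < l)%N -> (0 < a l)%N -> (l < m)%N -> z a = 0) ->
  is_cycle v J k.+1 1 j z -> is_bound v J m 1 j z -> is_bound v J k.+1 1 j z.
Proof.
move=> km inj hz cz.
have izE l : (k < l < m)%N -> incl l z = z.
  case/andP=> kl lm; apply: funext => a; rewrite /incl.
  by case: posnP => // al; rewrite (hz a l).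
have cycle_up : forall l, (k < l <= m)%N -> is_cycle v J l 1 j z.
  elim=> [//|l IHl] /andP[]; rewrite ltnS leq_eqVlt => /orP[/eqP<-//|kl] lm.
  by have := cycle_incl (IHl _); rewrite izE ?kl //; apply; apply: ltnW.
have descent : forall l, (k < l <= m)%N -> is_bound v J l 1 j z -> is_bound v J k.+1 1 j z.
  elim=> [//|l IHl] /andP[]; rewrite ltnS leq_eqVlt => /orP[/eqP<-//|kl] lm bz.
  apply: IHl; first by rewrite kl ltnW.
  by apply: inj => //; rewrite ?izE ?kl //; apply: cycle_up; rewrite kl ltnW.
by apply: descent; rewrite km leqnn.
Qed.

(** An annihilation relation for [x] is a 1-cycle modulo [J] in [k + 1] variables that bounds in all
    [n] variables. By injectivity it bounds already in [k + 1] variables, and its coefficient at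
    [x_k] is [x]. *)
Lemma inj_annih_exact (d : nat) :
    (forall r z, (r < n)%N -> is_cycle v J r 1 d z -> is_bound v J r.+1 1 d (incl r z) -> is_bound v J r 1 d z) ->
  forall k, (k < n)%N -> annih_exact v (comp d) k d.
Proof.
move=> inj k kn x xd qx.
have [xl hxl] := in_add_span_homog v1 (@compH d) (homog_mul xd (v1 k)) qx.
rewrite addrK1 in hxl; set t := _ - _ => tI.
have tH : t \in H d.+1.
  rewrite /t (_ : d.+1%:Z = d%:Z + 1); last by lia.
  by rewrite rpredB ?homog_mul //; apply: memv_suml => l _; apply: homog_mul.
have [y hy tE] := ideal_gen_succ (capvSr _ _) (leqnn d) tI tH.
(* The relation that [x * v k] equals the sum of the [xl l * v l] plus [t], read as a 1-chain with
   boundary [t]. *)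
pose c l := if l == k then x else - xl l.
have cH l : c l \in H d by rewrite /c; case: eqP => // _; rewrite rpredN.
pose z : (nat -> nat) -> E := fun a =>
  if [exists l : 'I_n, (k < l)%N && (0 < a l)%N] then 0 else \sum_(l < k.+1) c l *+ a l.
have zu l : (l <= k)%N -> z (up (fun=> 0%N) l) = c l.
  move=> lk; rewrite /z ifF; last first.
    apply/existsPn=> i; rewrite negb_and -leqNgt /up add0n; case: eqP => [->|_]; rewrite ?lk ?orbT //.
  have lk1 : (l < k.+1)%N by [].
  rewrite (bigD1 (Ordinal lk1)) //= big1 ?addr0 => [|i ni]; first by rewrite /up eqxx.
  by rewrite /up add0n; case: eqP => // e; case/eqP: ni; apply: val_inj.
have zu0 (l : 'I_n) : (k < l)%N -> z (up (fun=> 0%N) l) = 0.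
  move=> kl; rewrite /z ifT //; apply/existsP; exists l; by rewrite kl /up eqxx.
have zH a : z a \in H d.
  rewrite /z; case: ifP => _; first exact: mem0v.
  by apply: memv_suml => l _; apply: rpredMn.
have bz : bd v k.+1 z (fun=> 0%N) = t.
  rewrite bdS zu // {1}/c eqxx addrC /t; congr (_ + _); rewrite -sumrN.
  apply: eq_bigr => l _; rewrite zu ?(ltnW (ltn_ord l)) // /c ltn_eqF ?ltn_ord //.
  by rewrite mulNr.
have bzn : bd v n z (fun=> 0%N) = t.
  rewrite -bz /bd [RHS](big_ord_widen_cond n xpredT (fun l => z (up (fun=> 0%N) l) * v l)) //.
  rewrite [LHS](bigID (fun l : 'I_n => (l < k.+1)%N)) /= [X in _ + X]big1 ?addr0 // => l.
  by rewrite -leqNgt => kl; rewrite zu0 // mul0r.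
have cz : is_cycle v J k.+1 1 d z.
  split=> [a _|_ b [<-] /expo0E->]; first exact: zH.
  by rewrite bz (subvP (compJ d)).
have bndn : is_bound v J n 1 d z.
  split=> [a _|]; first exact: zH.
  have [|_ [w hw bw]] := @cartan_exact_free K n g ug 0 d (fun a => z a - linchain y a).
    split=> [a Xa|_ b [<-] /expo0E->]; last by rewrite bdB bd_linchain bzn tE subrr mem0v.
    rewrite rpredB //; apply: linchain_in => l.
    by have := hy l; rewrite memv_cap => /andP[].
  exists w => // a Xa; have := bw a Xa; rewrite memv0 => /eqP e.
  have -> : z a - bd v n w a = linchain y a + (z a - linchain y a - bd v n w a).
    by rewrite addrA addrCA subrr addr0.
  rewrite e addr0; apply: linchain_in => l.
  by have := hy l; rewrite memv_cap => /andP[yI _]; apply: (subvP (compJ d)).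
have zv a l : (k < l)%N -> (0 < a l)%N -> (l < n)%N -> z a = 0.
  by move=> kl al ln; rewrite /z ifT //; apply/existsP; exists (Ordinal ln); rewrite /= kl.
have [_ [w hw bw]] := bound_restrict kn inj zv cz bndn.
have Xk := expo_up (ltnSn k) (expo0 k.+1).
have := bw _ Xk; rewrite zu // {1}/c eqxx => xJ.
exists (fun l => w (up (up (fun=> 0%N) k) l)).
(* Homogeneity of degree [d] brings the remainder from [J] back into the ideal generated by its
   degree [d] part. *)
apply: (subvP (sub_ideal_gen _)); rewrite memv_cap; apply/andP; split; first exact: xJ.
rewrite rpredB //; apply: memv_suml => l _; rewrite -[d%:Z](@subrK1) homog_mul //.
by apply/hw/expo_up.
Qed.

(** A cycle modulo [J] with coefficients of degree [d] has its boundary in degree [d + 1] of [J], so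
    it is a cycle modulo that component ideal. There its product with [v k] bounds. *)
Lemma mul_trivial_of_components (d : nat) : (forall k, (k < n)%N -> annih_exact v (comp d.+1) k d.+1) ->
  forall k i, (k < n)%N -> mul_trivial v J k i.+1 d.
Proof.
move=> aex k i kn y cy.
have sub := compJ d.+1.
have cyI : is_cycle v (comp d.+1) k.+1 i.+1 d y.
  case: cy => hy by_; split=> // i' b Ei Xb; apply: (subvP (sub_ideal_gen _)).
  rewrite memv_cap (by_ i' b Ei Xb) /= (_ : d.+1%:Z = d%:Z + 1); last by lia.
  by apply: (bd_homog v1) Xb; rewrite -Ei.
have hex : cartan_exact v (comp d.+1) k i.+1 d.+1.
  by apply: (annih_cartan_exact v1 (@compM _) (@compH _)) => l lk; apply/aex/(ltn_trans lk).
have dE : d%:Z + 1 = d.+1%:Z by lia.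
have := cycle_mulv v1 (@compM _) cyI; rewrite dE => /hex[hz [w hw bw]].
split; rewrite ?dE //; exists w => // a Xa; exact/(subvP sub)/bw.
Qed.

Lemma mul_trivial_neg (j : int) k i : (j < 0)%R -> mul_trivial v J k i j.
Proof.
move=> j0 y [hy _]; apply: bound_eq (bound0 v J k i (j + 1)) => a Xa.
by rewrite (homog_lt0 j0 (hy a (expo_widen Xa))) mul0r.
Qed.

Lemma mul_trivial_gt (j : int) k i : (n%:Z < j)%R -> mul_trivial v J k i j.
Proof.
move=> j0 y [hy _]; apply: bound_eq (bound0 v J k i (j + 1)) => a Xa.
by rewrite (homog_gt j0 (hy a (expo_widen Xa))) mul0r.
Qed.

End Ideal.
End Components.

(** * Generic values and the two implications *)

Section GenericNumbers.
Variables (K : fieldType) (n : nat).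
Hypothesis infK : infinite_set [set: K]%classic.
Local Notation E := (ext K n).
Local Notation H := (ext_homog K n).
Local Notation v g := (nth 0 (gens g)).

Definition single r i (b : chain_idx r i) (x : E) : chains K n r i :=
  [ffun a => if a == b then x else 0].
Lemma single_linear r i b : linear (@single r i b).
Proof.
move=> t x y; apply/ffunP=> a; rewrite !ffunE; case: eqP => // _.
by rewrite scaler0 addr0.
Qed.
HB.instance Definition _ r i b :=
  GRing.isLinear.Build K E (chains K n r i) _ (@single r i b) (@single_linear r i b).

Lemma polyvec_gens l : polyvec (fun g : 'M[K]_n => (gens g)`_l).
Proof.
have [ln|nl] := ltnP l n.
  apply: (polyvec_eq (F := fun g => lin_form g (Ordinal ln))); last exact: polyvec_lin_form.
  by move=> g; rewrite -[l]/(val (Ordinal ln)) gens_nth.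
apply: (polyvec_eq (F := fun=> 0)); last exact: polyvec0.
by move=> g; rewrite gens_out.
Qed.

Lemma polyvec_chain_diff r i i' (c : chains K n r i) : polyvec (fun g => chain_diff r (v g) i i' c).
Proof.
apply: (polyvec_eq (F := fun g => \sum_b linfun (single b) (chain_diff r (v g) i i' c b))).
  move=> g; apply/ffunP=> a; rewrite sum_ffunE (bigD1 a) //= lfunE ffunE eqxx.
  rewrite big1 ?addr0 // => b ba; by rewrite lfunE ffunE eq_sym (negPf ba).
apply: polyvec_sum => b _; apply: polyvec_lin.
apply: (polyvec_eq (F := fun g => \sum_a \sum_(k < r | idx_mnm a == (idx_mnm b + U_(k))%MM) c a * (gens g)`_k)).
  by move=> g; rewrite lfunE ffunE.
apply: polyvec_sum => a _; apply: polyvec_sum => k _.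
by apply: polyvec_mul; [apply: polyvec_cst|apply: polyvec_gens].
Qed.

Lemma homology_dim_generic r (J : {vspace E}) i j :
  exists D, generic (fun g => homology_dim r (v g) J i j = D).
Proof.
have [D1 [h1 _]] := generic_img infK (chains_in r i (H (j - i%:Z))) (chains_in r i.-1 J)
   (psi := fun g => chain_diff r (v g) i i.-1) (@polyvec_chain_diff r i i.-1).
have [D2 [h2 _]] := generic_img infK (chains_in r i.+1 (H (j - i.+1%:Z))) (chains_in r i (H (j - i%:Z)) :&: chains_in r i J)%VS
   (psi := fun g => chain_diff r (v g) i.+1 i) (@polyvec_chain_diff r i.+1 i).
exists (\dim (chains_in r i (H (j - i%:Z))) + \dim (chains_in r i.-1 J) - D1 - D2)%N.
apply: generic_imp (genericI h1 h2) => g _ [e1 e2].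
rewrite /homology_dim /quot_homology_dim e2; congr (_ - _)%N.
have := dim_preim_cap (chain_diff r (v g) i i.-1) (chains_in r i (H (j - i%:Z))) (chains_in r i.-1 J).
by rewrite e1 => <-; rewrite addnK.
Qed.

Lemma cartan_betti_generic (J : {vspace E}) r i j : (r <= n)%N ->
  generic (fun g => homology_dim r (v g) J i j = cartan_betti J r i j).
Proof.
move=> rn; have [D hD] := homology_dim_generic r J i j.
suff e : cartan_betti J r i j = D by apply: generic_imp hD => g _ ->.
apply: (generic_value_eq infK); apply: generic_imp hD => g _ <-.
rewrite -/(gens g) cartan_homology_dimE size_takel; last first.
  by rewrite size_map size_enum_ord.
by apply: homology_dim_ext => l lr; rewrite nth_take.
Qed.

Lemma max_rank_all (Q : nat -> {vspace E}) m :
  generic (fun g => forall d, (d < m)%N -> forall (k : 'I_n) (j : nat), max_rank (v g) (Q d) k j).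
Proof.
have gen := generic_all (I := ('I_m * 'I_n * 'I_n.+2)%type)
  (fun i => max_rank_generic infK i.1.2 i.2%:Z (Q i.1.1)).
apply: generic_imp gen => g _ h d dm k j.
(* Finitely many [j] suffice: from [n + 2] on, [H (j - 1)] is zero. *)
have [jn|nj] := ltnP j n.+2; first exact: (h (Ordinal dm, k, Ordinal jn)).
have H0 : H (j%:Z - 1) = 0%VS.
  apply/eqP; rewrite -subv0; apply/subvP=> x /homog_gt->; rewrite ?mem0v //.
  by move: nj; lia.
by move=> t; rewrite H0 !limg0.
Qed.

End GenericNumbers.

Section Main.
Variables (K : fieldType) (n : nat) (J : {vspace ext K n}).
Hypothesis infK : infinite_set [set: K]%classic.
Hypothesis gJ : gideal J.
Local Notation E := (ext K n).
Local Notation H := (ext_homog K n).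
Local Notation v g := (nth 0 (gens g)).
Local Notation cbound r i j :=
  (\sum_(1 <= k < r.+1) 'C(r + i - k - 1, i - 1) * alpha J k j%:Z)%N.

Let JM (x y : E) : x \in J -> x * y \in J. Proof. by case: gJ => h _ _; apply: h. Qed.
Let JH (j : int) (x : E) : x \in J -> hcomp j x \in J. Proof. by case: gJ => _ _ h; apply: h. Qed.

Let alpha_at (g : 'M[K]_n) : Prop :=
  forall k (j : nat), alpha J k.+1 j%:Z = annih_dim (v g) (Qtake (gens g) J) k j.

Lemma cbound_binsum g r i (j : nat) : alpha_at g ->
  cbound r i.+1 j = binsum (v g) (Qtake (gens g) J) r i j.
Proof.
move=> ha; rewrite big_add1 big_mkord; apply: eq_bigr => k _; rewrite ha.
by rewrite addnS subSS (subn1 i.+1).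
Qed.

Lemma cartan_at g r i (j : nat) :
  homology_dim r (v g) J i (i + j)%:Z = cartan_betti J r i (i + j)%:Z ->
  cartan_betti J r i (i + j)%:Z = cartan_dim (v g) J r i j.
Proof. by move=> <-; rewrite /cartan_dim addnC PoszD. Qed.

Lemma cartan_le r i (j : nat) : (r <= n)%N ->
  (cartan_betti J r i.+1 (i.+1 + j)%:Z <= cbound r i.+1 j)%N.
Proof.
move=> rn; have gen := genericI (alpha_generic infK gJ)
  (cartan_betti_generic infK J i.+1 (i.+1 + j)%:Z rn).
have [g ug [ha hc]] := generic_ex infK gen.
rewrite (cartan_at hc) (cbound_binsum _ _ _ ha).
apply: (cartan_dim_le_binsum (gens1 g) JM JH) => k x; exact: QtakeP (gens1 g) _ _ _.
Qed.

Lemma cartan_eq_linear :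
    (forall r (j : nat), (1 <= r <= n)%N ->
       cartan_betti J r 1 (1 + j)%:Z = cbound r 1 j) ->
  componentwise_linear J.
Proof.
move=> heq d.
have gen := genericI (alpha_generic infK gJ)
  (generic_all (fun r : 'I_n.+1 => cartan_betti_generic infK J 1 (1 + d)%:Z (ltn_ord r : r <= n)%N)).
have [g ug [ha hc]] := generic_ex infK gen.
apply: (cartan_exact_linear_resolution ug); apply: (annih_exact_linear_resolution ug (capvSr _ _)).
apply: (inj_annih_exact ug gJ) => r z rn.
apply: (cartan_dim_binsum_inj (gens1 g) JM JH (fun k x => QtakeP (gens1 g) J k x) _ rn) => k kn.
have [->|k0] := posnP k; first by rewrite (cartan_dim0 (gens1 g)) /binsum big_ord0.
by rewrite -(cartan_at (hc (Ordinal (kn : k < n.+1)%N))) heq ?k0 // -(cbound_binsum _ _ _ ha).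
Qed.

Lemma linear_cartan_eq : componentwise_linear J ->
  forall r i (j : nat), (r <= n)%N ->
    cartan_betti J r i.+1 (i.+1 + j)%:Z = cbound r i.+1 j.
Proof.
move=> lin r i j rn.
pose comp d := ideal_gen (J :&: H d%:Z)%VS.
have gen := genericI (genericI (alpha_generic infK gJ)
  (cartan_betti_generic infK J i.+1 (i.+1 + j)%:Z rn)) (max_rank_all infK comp n.+2).
have [g ug [[ha hc] hm]] := generic_ex infK gen.
(* Connecting maps on coefficients of degree [d] are controlled by the component of degree [d + 1],
   so [max_rank_all] is invoked for components up to degree [n + 1]. *)
have mu k i' (j' : int) : (k < n)%N -> mul_trivial (v g) J k i'.+1 j'.
  move=> kn; case: j' => [d|d]; last exact: mul_trivial_neg.
  have [dn|nd] := leqP d n; last exact: mul_trivial_gt.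
  apply: (mul_trivial_of_components ug gJ) => // {k kn} k kn.
  apply: (@regularity _ _ infK _ (gens1 g) (comp d.+1) _ _ d.+1) kn => //.
  - by move=> x y; apply: ideal_gen_mulr.
  - by move=> j' x; apply: (ideal_gen_hcomp (capvSr _ _)).
  - exact: hm.
  - by move=> i1 j1; apply: (linear_resolution_exact ug (lin d.+1)).
rewrite (cartan_at hc) (cbound_binsum _ _ _ ha).
apply: (cartan_dim_eq_binsum (gens1 g) JM JH (fun k x => QtakeP (gens1 g) J k x) (m := n)) => // k i'; exact: mu.
Qed.

End Main.

Theorem theorem3p15 (K : fieldType) (n : nat) (J : {vspace ext K n})
    (infK : infinite_set [set: K]%classic) (gradJ : graded_ideal J) :
  (forall r i j : nat, (1 <= r <= n)%N -> (1 <= i)%N ->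
     (cartan_betti J r i (i + j)%:Z <=
      \sum_(1 <= k < r.+1) 'C(r + i - k - 1, i - 1) * alpha J k j%:Z)%N) /\
  ((forall r i j : nat, (1 <= r <= n)%N -> (1 <= i)%N ->
     cartan_betti J r i (i + j)%:Z =
      (\sum_(1 <= k < r.+1) 'C(r + i - k - 1, i - 1) * alpha J k j%:Z)%N) <->
   componentwise_linear J).
Proof.
have gJ := graded_idealP gradJ; split=> [r [//|i] j /andP[_ rn] _|].
  exact: cartan_le.
split=> [h|lin r [//|i] j /andP[_ rn] _]; last exact: linear_cartan_eq.
by apply: cartan_eq_linear => // r j hr; apply: h.
Qed.
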